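(* Let $(M,\alpha_1,\alpha_2,\phi,g)$ be a metric contact pair with decomposable $\phi$ and Reeb vector fields $Z_1$ and $Z_2$, and let $N$ be a connected $\phi$-invariant submanifold of $M$ of dimension $\geq 2$. (1) When $N$ has even dimension, it inherits a metric $f$-structure with two complemented frames (given by the restrictions to $N$ of $\phi$, $Z_1,Z_2$, $\alpha_1,\alpha_2$ and $g$). (2) Suppose that $N$ has odd dimension. Along $N$ let $\zeta$ be the normalized (unit) vector field of a nonzero vector field among $Z_1^T$ and $Z_2^T$, the tangential parts of $Z_1$ and $Z_2$, and set $\omega=g(\zeta,\cdot)$. Then (a) $\omega$ induces a contact form on $N$ with Reeb vector field $\zeta$, and $(\phi,\zeta,\omega,g)$ induces an almost contact metric structure on $N$; (b) the induced almost contact metric structure on $N$ is contact metric if and only if $N$ is tangent to one Reeb vector field and orthogonal to the other one. In all cases, if the metric contact pair on $M$ is normal, the induced structure on $N$ is normal.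
   Context: All objects are smooth. A contact pair of type $(h,k)$ on a manifold $M$ of dimension $2h+2k+2$ is a pair of $1$-forms $(\alpha_1,\alpha_2)$ such that $\alpha_1\wedge(d\alpha_1)^h\wedge\alpha_2\wedge(d\alpha_2)^k$ is a volume form, $(d\alpha_1)^{h+1}=0$ and $(d\alpha_2)^{k+1}=0$. Convention: $2\,d\alpha(X,Y)=X\alpha(Y)-Y\alpha(X)-\alpha([X,Y])$ for $1$-forms. For $i=1,2$, the integrable subbundle $T\mathcal{F}_i=\{X:\alpha_i(X)=0,\ d\alpha_i(X,Y)=0\ \forall Y\}$ defines the characteristic foliation $\mathcal{F}_i$ of $\alpha_i$. The Reeb vector fields $Z_1,Z_2$ are the unique vector fields with $\alpha_i(Z_j)=\delta_{ij}$ and $i_{Z_i}d\alpha_j=0$ for all $i,j\in\{1,2\}$. A contact pair structure $(\alpha_1,\alpha_2,\phi)$ is a contact pair together with a $(1,1)$-tensor field $\phi$ with $\phi^2=-\mathrm{Id}+\alpha_1\otimes Z_1+\alpha_2\otimes Z_2$ and $\phi Z_1=\phi Z_2=0$. $\phi$ is decomposable if $\phi(T\mathcal{F}_i)\subset T\mathcal{F}_i$ for $i=1,2$. The structure is normal if both almost complex structures $J=\phi-\alpha_2\otimes Z_1+\alpha_1\otimes Z_2$ and $T=\phi+\alpha_2\otimes Z_1-\alpha_1\otimes Z_2$ are integrable; equivalently, $[\phi,\phi](X,Y)+2d\alpha_1(X,Y)Z_1+2d\alpha_2(X,Y)Z_2=0$ for all $X,Y$, where $[\phi,\phi](X,Y)=\phi^2[X,Y]+[\phi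 X,\phi Y]-\phi[\phi X,Y]-\phi[X,\phi Y]$. A metric contact pair $(M,\alpha_1,\alpha_2,\phi,g)$ is a contact pair structure with a Riemannian metric $g$ that is associated: $g(X,\phi Y)=(d\alpha_1+d\alpha_2)(X,Y)$ and $g(X,Z_i)=\alpha_i(X)$ for $i=1,2$ and all $X,Y$. A submanifold $N\subset M$ is $\phi$-invariant if $\phi(TN)\subset TN$. A metric $f$-structure with two complemented frames on a manifold consists of a $(1,1)$-tensor field $f$, vector fields $\xi_1,\xi_2$, $1$-forms $\eta_1,\eta_2$ and a Riemannian metric $g$ with $f^2=-\mathrm{Id}+\eta_1\otimes\xi_1+\eta_2\otimes\xi_2$, $f\xi_a=0$, $\eta_a\circ f=0$, $\eta_a(\xi_b)=\delta_{ab}$ and $g(fX,fY)=g(X,Y)-\eta_1(X)\eta_1(Y)-\eta_2(X)\eta_2(Y)$; it is normal if $[f,f]+2d\eta_1\otimes\xi_1+2d\eta_2\otimes\xi_2=0$. An almost contact metric structure $(\phi,\zeta,\omega,g)$ on an odd-dimensional manifold satisfies $\phi^2=-\mathrm{Id}+\omega\otimes\zeta$, $\omega(\zeta)=1$, $\phi\zeta=0$, $\omega\circ\phi=0$ and $g(\phi X,\phi Y)=g(X,Y)-\omega(X)\omega(Y)$. It is contact metric if moreover $g$ is associated, i.e. $g(X,\zeta)=\omega(X)$ and $g(X,\phi Y)=d\omega(X,Y)$ for all $X,Y$. It is normal if $[\phi,\phi]+2d\omega\otimes\zeta=0$. The Reeb vector field of a contact form $\omega$ is the unique $\zeta$ with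 $\omega(\zeta)=1$, $i_\zeta d\omega=0$. *)

(* Defs.v *)
From HB Require Import structures.
From mathcomp Require Export all_boot all_order all_algebra all_fingroup.
From mathcomp Require Export all_classical all_reals all_analysis.
Export Order.TTheory GRing.Theory Num.Theory numFieldNormedType.Exports.

Set Implicit Arguments.
Unset Strict Implicit.
Unset Printing Implicit Defensive.

Local Open Scope classical_set_scope.
Local Open Scope ring_scope.

(** * Smooth manifolds *)

(* C^infinity on an open set [U]: all iterated directional derivatives exist
   and are (Frechet) differentiable at every point of [U]. *)
Definition smooth_on (R : realType) (n : nat) (V : normedModType R)
    (U : set 'rV[R]_n) (f : 'rV[R]_n -> V) : Prop :=
  forall (vs : seq 'rV[R]_n) (x : 'rV[R]_n), U x ->
    differentiable (foldr (fun v (F : 'rV[R]_n -> V) => 'D_v F) f vs) x.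

Record chart (R : realType) (n : nat) (T : topologicalType) := Chart {
  dom : set T;
  coord : T -> 'rV[R]_n;
  icoord : 'rV[R]_n -> T;
  dom_open : open dom;
  coord_open : open (coord @` dom);
  coordK : forall p, dom p -> icoord (coord p) = p;
  coord_cts : forall p, dom p -> {for p, continuous coord};
  icoord_cts : forall x, (coord @` dom) x -> {for x, continuous icoord} }.

(* The atlas is indexed by the points of the manifold, [chart_at p] being a
   chart around [p]; every atlas contains a subatlas of this kind, defining
   the same smooth structure. *)
Record manifold (R : realType) (n : nat) := Manifold {
  carrier :> topologicalType;
  manifold_hausdorff : hausdorff_space carrier;
  manifold_countable : @second_countable carrier;
  chart_at : carrier -> chart R n carrier;
  chart_at_dom : forall p, dom (chart_at p) p;
  chart_at_compat : forall p q,
    smooth_on (coord (chart_at p) @` (dom (chart_at p) `&` dom (chart_at q)))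
      (coord (chart_at q) \o icoord (chart_at p)) }.
Arguments chart_at {R n m} p : rename.

(** * Tangent vectors and tensor fields *)

(* The tangent space T_pM is R^n, a tangent vector at [p] being given by its
   components in the preferred chart [chart_at p].  The preferred chart varies
   with [p], so a field is smooth when its components in every fixed chart of
   the atlas are, not when it is smooth as a function on M. *)
Definition vfield (R : realType) n (M : manifold R n) := M -> 'rV[R]_n.
Definition field1 (R : realType) n (M : manifold R n) := M -> 'rV[R]_n -> R.
Definition field2 (R : realType) n (M : manifold R n) :=
  M -> 'rV[R]_n -> 'rV[R]_n -> R.
Definition field11 (R : realType) n (M : manifold R n) :=
  M -> 'rV[R]_n -> 'rV[R]_n.

Section Fields.
Context (R : realType) (n : nat) (M : manifold R n).

(* components in the chart [c] of a vector of T_pM *)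
Definition to_chart (c : chart R n M) (p : M) : 'rV[R]_n -> 'rV[R]_n :=
  'd (coord c \o icoord (chart_at p)) (coord (chart_at p) p).

(* vector of T_pM with given components in the chart [c] *)
Definition of_chart (c : chart R n M) (p : M) : 'rV[R]_n -> 'rV[R]_n :=
  'd (coord (chart_at p) \o icoord c) (coord c p).

Definition vfield_in (c : chart R n M) (X : vfield M) (x : 'rV[R]_n) :=
  to_chart c (icoord c x) (X (icoord c x)).

Definition field1_in (c : chart R n M) (a : field1 M) (x u : 'rV[R]_n) : R :=
  a (icoord c x) (of_chart c (icoord c x) u).

Definition field2_in (c : chart R n M) (g : field2 M) (x u v : 'rV[R]_n) : R :=
  g (icoord c x) (of_chart c (icoord c x) u) (of_chart c (icoord c x) v).

Definition field11_in (c : chart R n M) (A : field11 M) (x u : 'rV[R]_n) :=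
  to_chart c (icoord c x) (A (icoord c x) (of_chart c (icoord c x) u)).

Definition smooth_vfield_on (U : set M) (X : vfield M) : Prop :=
  forall q : M, smooth_on (coord (chart_at q) @` (dom (chart_at q) `&` U))
    (vfield_in (chart_at q) X).

Definition smooth_vfield (X : vfield M) : Prop := smooth_vfield_on setT X.

Definition one_form (a : field1 M) : Prop :=
  (forall p, scalar (a p)) /\
  (forall (q : M) (u : 'rV[R]_n),
     smooth_on (coord (chart_at q) @` dom (chart_at q))
       (fun x => field1_in (chart_at q) a x u)).

Definition tensor11 (A : field11 M) : Prop :=
  (forall p, linear (A p)) /\
  (forall (q : M) (u : 'rV[R]_n),
     smooth_on (coord (chart_at q) @` dom (chart_at q))
       (fun x => field11_in (chart_at q) A x u)).

Record riemannian_metric (g : field2 M) : Prop := RiemannianMetric {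
  metric_scalar : forall p u, scalar (g p u);
  metric_sym : forall p u v, g p u v = g p v u;
  metric_pos : forall p u, u != 0 -> 0 < g p u u;
  metric_smooth : forall (q : M) (u v : 'rV[R]_n),
    smooth_on (coord (chart_at q) @` dom (chart_at q))
      (fun x => field2_in (chart_at q) g x u v) }.

(* 2 da(X,Y) = X a(Y) - Y a(X) - a([X,Y]), evaluated on the fields X and Y
   with constant components [u] and [v] in the chart at [p]. *)
Definition extd (a : field1 M) : field2 M := fun p u v =>
  2^-1 * ('D_u (fun x => field1_in (chart_at p) a x v) (coord (chart_at p) p)
        - 'D_v (fun x => field1_in (chart_at p) a x u) (coord (chart_at p) p)).

Definition lie (X Y : vfield M) : vfield M := fun p =>
    'D_(X p) (vfield_in (chart_at p) Y) (coord (chart_at p) p)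
  - 'D_(Y p) (vfield_in (chart_at p) X) (coord (chart_at p) p).

Definition app11 (A : field11 M) (X : vfield M) : vfield M := fun p => A p (X p).

Definition nijenhuis (A : field11 M) (X Y : vfield M) : vfield M := fun p =>
  A p (A p (lie X Y p)) + lie (app11 A X) (app11 A Y) p
  - A p (lie (app11 A X) Y p) - A p (lie X (app11 A Y) p).

(* [X] and [Y] range over locally defined smooth vector fields; the fields are
   total functions, unconstrained outside [U]. *)
Definition for_all_local_vfields (P : vfield M -> vfield M -> M -> Prop) :=
  forall (U : set M) (X Y : vfield M), open U ->
    smooth_vfield_on U X -> smooth_vfield_on U Y -> forall p, U p -> P X Y p.

End Fields.

(** * Exterior algebra of R^n *)

(* The wedge product is normalized by 1/(p+q)!, in accordance with the factor
   2 in the convention for the exterior derivative. *)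
Definition kform (R : realType) (n k : nat) := ('I_k -> 'rV[R]_n) -> R.

Definition wedge (R : realType) (n p q : nat) (a : kform R n p)
    (b : kform R n q) : kform R n (p + q) := fun v =>
  ((p + q)`!%:R)^-1 * \sum_(s : 'S_(p + q)) (-1) ^+ odd_perm s *
    a (fun i => v (s (lshift q i))) * b (fun j => v (s (rshift p j))).

Fixpoint wedge_pow (R : realType) (n : nat) (b : kform R n 2) (k : nat) :
    kform R n (k * 2) :=
  if k is k'.+1 then wedge b (@wedge_pow R n b k') else fun=> 1.
Arguments wedge_pow {R n} b k _.

Definition kform1 (R : realType) n (a : 'rV[R]_n -> R) : kform R n 1 :=
  fun v => a (v ord0).

Definition kform2 (R : realType) n (b : 'rV[R]_n -> 'rV[R]_n -> R) :
    kform R n 2 := fun v => b (v ord0) (v ord_max).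

(* the value at a point of a /\ (da)^k *)
Definition contact_wedge (R : realType) n (M : manifold R n) (a : field1 M)
    (k : nat) (p : M) : kform R n (1 + k * 2) :=
  wedge (kform1 (a p)) (wedge_pow (kform2 (extd a p)) k).
Arguments contact_wedge {R n M} a k p _.

(** * Submanifolds *)

Section Maps.
Context (R : realType) (m n : nat) (N : manifold R m) (M : manifold R n).
Variable F : N -> M.

Definition tmap (p : N) : 'rV[R]_m -> 'rV[R]_n :=
  'd (coord (chart_at (F p)) \o F \o icoord (chart_at p))
     (coord (chart_at p) p).

Definition smooth_map : Prop := continuous F /\
  forall (p : N) (q : M),
    smooth_on (coord (chart_at p) @` (dom (chart_at p) `&` F @^-1` dom (chart_at q)))
      (coord (chart_at q) \o F \o icoord (chart_at p)).

(* [F] is the inclusion of a (possibly only immersed) submanifold *)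
Definition submanifold : Prop :=
  [/\ smooth_map, injective F & forall p, injective (tmap p)].

Definition pull1 (a : field1 M) : field1 N := fun p u => a (F p) (tmap p u).
Definition pull2 (g : field2 M) : field2 N :=
  fun p u v => g (F p) (tmap p u) (tmap p v).

Definition tangent_to (X : vfield M) : Prop :=
  forall p, exists u, tmap p u = X (F p).

Definition orthogonal_to (g : field2 M) (X : vfield M) : Prop :=
  forall p u, g (F p) (X (F p)) (tmap p u) = 0.

Definition invariant_under (A : field11 M) : Prop :=
  forall p u, exists w, tmap p w = A (F p) (tmap p u).

Definition restricts_vfield (X : vfield M) (XN : vfield N) : Prop :=
  forall p, tmap p (XN p) = X (F p).

Definition restricts11 (A : field11 M) (AN : field11 N) : Prop :=
  forall p u, tmap p (AN p u) = A (F p) (tmap p u).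

(* the unique [t] in T_pN such that X - t is orthogonal to T_pN *)
Definition tangential_part (g : field2 M) (X : vfield M) : vfield N := fun p =>
  xget 0 [set t | forall u, g (F p) (X (F p) - tmap p t) (tmap p u) = 0].

End Maps.

Definition normalized (R : realType) n (N : manifold R n) (g : field2 N)
    (X : vfield N) : vfield N := fun p => (Num.sqrt (g p (X p) (X p)))^-1 *: X p.

(** * Contact pairs, f-structures, almost contact structures *)

Section Structures.
Context (R : realType) (n : nat) (M : manifold R n).
Implicit Types (a : field1 M) (Z : vfield M) (phi : field11 M) (g : field2 M).

Record contact_pair (h k : nat) a1 a2 : Prop := ContactPair {
  cp_dim : n = (2 * h + 2 * k + 2)%N;
  cp_form1 : one_form a1;
  cp_form2 : one_form a2;
  cp_volume : forall p, exists v,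
    wedge (contact_wedge a1 h p) (contact_wedge a2 k p) v != 0;
  cp_rank1 : forall p v, wedge_pow (kform2 (extd a1 p)) h.+1 v = 0;
  cp_rank2 : forall p v, wedge_pow (kform2 (extd a2 p)) k.+1 v = 0 }.

Record reeb_pair a1 a2 Z1 Z2 : Prop := ReebPair {
  reeb_smooth : smooth_vfield Z1 /\ smooth_vfield Z2;
  reeb_dual : forall p,
    [/\ a1 p (Z1 p) = 1, a1 p (Z2 p) = 0, a2 p (Z1 p) = 0 & a2 p (Z2 p) = 1];
  reeb_inner : forall p u,
    [/\ extd a1 p (Z1 p) u = 0, extd a1 p (Z2 p) u = 0,
        extd a2 p (Z1 p) u = 0 & extd a2 p (Z2 p) u = 0] }.

Record contact_pair_structure (h k : nat) a1 a2 Z1 Z2 phi : Prop :=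
  ContactPairStructure {
  cps_pair : contact_pair h k a1 a2;
  cps_reeb : reeb_pair a1 a2 Z1 Z2;
  cps_tensor : tensor11 phi;
  cps_sqr : forall p u,
    phi p (phi p u) = - u + a1 p u *: Z1 p + a2 p u *: Z2 p;
  cps_ker : forall p, phi p (Z1 p) = 0 /\ phi p (Z2 p) = 0 }.

Record metric_contact_pair (h k : nat) a1 a2 Z1 Z2 phi g : Prop :=
  MetricContactPair {
  mcp_structure : contact_pair_structure h k a1 a2 Z1 Z2 phi;
  mcp_metric : riemannian_metric g;
  mcp_associated : forall p u v,
    g p u (phi p v) = extd a1 p u v + extd a2 p u v;
  mcp_reeb : forall p u,
    g p u (Z1 p) = a1 p u /\ g p u (Z2 p) = a2 p u }.

Definition char_foliation a (p : M) (u : 'rV[R]_n) : Prop :=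
  a p u = 0 /\ forall v, extd a p u v = 0.

Definition decomposable a1 a2 phi : Prop := forall p u,
  (char_foliation a1 p u -> char_foliation a1 p (phi p u)) /\
  (char_foliation a2 p u -> char_foliation a2 p (phi p u)).

(* integrability of an almost complex structure, as vanishing of its torsion *)
Definition integrable_acs (J : field11 M) : Prop :=
  for_all_local_vfields (fun X Y p => nijenhuis J X Y p = 0).

Definition normal_contact_pair a1 a2 Z1 Z2 phi : Prop :=
  integrable_acs (fun p u => phi p u - a2 p u *: Z1 p + a1 p u *: Z2 p) /\
  integrable_acs (fun p u => phi p u + a2 p u *: Z1 p - a1 p u *: Z2 p).

Record metric_f_structure (f : field11 M) (xi1 xi2 : vfield M)
    (eta1 eta2 : field1 M) g : Prop := MetricFStructure {
  mfs_tensor : tensor11 f;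
  mfs_vfields : smooth_vfield xi1 /\ smooth_vfield xi2;
  mfs_forms : one_form eta1 /\ one_form eta2;
  mfs_metric : riemannian_metric g;
  mfs_sqr : forall p u,
    f p (f p u) = - u + eta1 p u *: xi1 p + eta2 p u *: xi2 p;
  mfs_ker : forall p, f p (xi1 p) = 0 /\ f p (xi2 p) = 0;
  mfs_im : forall p u, eta1 p (f p u) = 0 /\ eta2 p (f p u) = 0;
  mfs_dual : forall p, [/\ eta1 p (xi1 p) = 1, eta1 p (xi2 p) = 0,
                           eta2 p (xi1 p) = 0 & eta2 p (xi2 p) = 1];
  mfs_compat : forall p u v, g p (f p u) (f p v) =
    g p u v - eta1 p u * eta1 p v - eta2 p u * eta2 p v }.

Definition normal_f_structure (f : field11 M) (xi1 xi2 : vfield M)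
    (eta1 eta2 : field1 M) : Prop :=
  for_all_local_vfields (fun X Y p =>
    nijenhuis f X Y p + (2 * extd eta1 p (X p) (Y p)) *: xi1 p
                      + (2 * extd eta2 p (X p) (Y p)) *: xi2 p = 0).

Record almost_contact_metric phi (zeta : vfield M) (omega : field1 M) g : Prop :=
  AlmostContactMetric {
  acm_odd : odd n;
  acm_tensor : tensor11 phi;
  acm_vfield : smooth_vfield zeta;
  acm_form : one_form omega;
  acm_metric : riemannian_metric g;
  acm_sqr : forall p u, phi p (phi p u) = - u + omega p u *: zeta p;
  acm_unit : forall p, omega p (zeta p) = 1;
  acm_ker : forall p, phi p (zeta p) = 0;
  acm_im : forall p u, omega p (phi p u) = 0;
  acm_compat : forall p u v,
    g p (phi p u) (phi p v) = g p u v - omega p u * omega p v }.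

Definition contact_metric phi (zeta : vfield M) (omega : field1 M) g : Prop :=
  [/\ almost_contact_metric phi zeta omega g,
      forall p u, g p u (zeta p) = omega p u &
      forall p u v, g p u (phi p v) = extd omega p u v].

Definition normal_almost_contact phi (zeta : vfield M) (omega : field1 M) : Prop :=
  for_all_local_vfields (fun X Y p =>
    nijenhuis phi X Y p + (2 * extd omega p (X p) (Y p)) *: zeta p = 0).

Definition contact_form (omega : field1 M) : Prop :=
  [/\ odd n, one_form omega &
      forall p, exists v, contact_wedge omega n./2 p v != 0].

Definition reeb_field (omega : field1 M) (zeta : vfield M) : Prop :=
  [/\ smooth_vfield zeta, forall p, omega p (zeta p) = 1 &
      forall p u, extd omega p (zeta p) u = 0].

End Structures.

(* Main.v *)
From HB Require Import structures.
Require Import Defs.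
From mathcomp Require Import ring zify.

(** The whole argument takes place on N.  Let c1, c2 be the pulled back forms,
    G the induced metric, A the restriction of phi, and t1, t2 the tangential
    parts of the Reeb fields.  They satisfy ([induced_pair_submanifold])
      A^2 = - Id + c1 (x) t1 + c2 (x) t2,  A t_i = 0,  G(u, t_i) = c_i(u),
      G(u, A v) = (dc1 + dc2)(u, v),       dc_i(t_j, .) = 0,
    where the last relation holds because phi kills t_j, which puts t_j in the
    span of the Reeb fields.  The ambient manifold is the special case in which
    c_i(t_j) is the identity matrix.

    Applying A^2 to t_1 and t_2 shows that their Gram matrix, with entries
    a = c1(t1), b = c2(t1) = c1(t2), d = c2(t2), is idempotent, so its trace is
    0, 1 or 2; this is the dimension of the kernel of A ([ip_cases]).  On the
    orthogonal complement of the kernel A is skew with square - Id, and pairing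
    e with A e shows that the dimension of N has the parity of the trace
    ([adapted_basis]).

    If N has even dimension the trace is 0 or 2.  Were it 0 at a point it would
    be 0 nearby by continuity; then c1 and c2, hence dc1 + dc2, would vanish
    there, and so would A, against A^2 = - Id ([ip_even]).  So the trace is 2,
    t1 and t2 have the length of the Reeb fields, hence are the Reeb fields,
    and the metric f-structure is the restriction of the one on M.

    If N has odd dimension the trace is 1.  Where a is nonzero, c2 = lam c1 with
    lam = b / a and a (1 + lam^2) = 1.  Contracting dc2 = d lam /\ c1 + lam dc1
    with t1 gives d lam = f c1, and differentiating again f dc1 = 0 on the kernel
    of c1; there (1 + lam) dc1 = G(., A .) is not zero, so f = 0
    ([proportional_forms]).  Hence a is locally constant; as a + d = 1 and the
    roles of a and d are symmetric, a is constant on the connected N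
    ([ip_odd_const]).  Therefore zeta is a constant multiple of t1, omega the
    same multiple of c1, and G(u, A v) = mu d omega(u, v) with mu nonzero.  On a
    basis zeta, e, A e, e', A e', ... all terms of omega /\ (d omega)^k have the
    same sign, so omega is a contact form ([contact_wedge_paired]).  The
    structure is contact metric iff mu = 1, and this forces a = 1, b = d = 0:
    t1 is the first Reeb field and t2 vanishes.

    For normality, J and T are phi plus and minus the quarter turn P of the plane
    of the Reeb fields, so the torsions of phi and P add up to zero; since the
    Reeb fields commute the torsion of P is 2 da1 (x) Z1 + 2 da2 (x) Z2
    ([normal_torsion]).  The torsion of A is related to that of phi by the
    inclusion, and projecting orthogonally to N gives
    [A, A] + 2 dc1 (x) t1 + 2 dc2 (x) t2 = 0 ([induced_torsion]).

    Exterior derivative and torsion are natural because the second derivatives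
    of a smooth map are symmetric ([derive_symmetric], [extd_pull],
    [torsion_related]). *)

Set Implicit Arguments.
Unset Strict Implicit.
Unset Printing Implicit Defensive.

Local Open Scope classical_set_scope.
Local Open Scope ring_scope.

Lemma near_eq_diff (R : realType) (V W : normedModType R)
    (f g : V -> W) (x : V) :
  (\near x, f x = g x) -> differentiable f x -> differentiable g x.
Proof.
move=> fg df.
have fgx : f x = g x by exact: nbhs_singleton fg.
have fg0 : \forall h \near (0:V), f (h + x) = g (h + x).
   by move: fg; rewrite (near_shift 0 x) /= subr0.
have H : g \o shift x = cst (g x) + 'd f x +o_ (0 : V) id.
  have := diff_locally df.
  move=> H.
  apply/eqaddoP => eps eps0.
  move/eqaddoP: H => /(_ eps eps0).
  apply: filterS2 fg0 => h /= e.
  by rewrite !fctE /= -e fgx.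
have e : 'd g x = 'd f x :> (V -> W).
  by apply: diff_unique => //; exact: diff_continuous.
apply/diff_locallyP; rewrite e; split => //.
exact: diff_continuous.
Qed.

(** * Differentiability of class C^k on open sets *)

(** Counting derivatives makes closure under products, quotients and composition
    provable by induction, each derivative being an expression of the same kind
    in functions of one class lower. *)
Fixpoint Ck (R : realType) n (V : normedModType R) (k : nat)
    (U : set 'rV[R]_n) (f : 'rV[R]_n -> V) : Prop :=
  (forall x, U x -> differentiable f x) /\
  if k is k'.+1 then forall v, Ck k' U ('D_v f) else True.

Lemma smooth_onP (R : realType) n (V : normedModType R) (U : set 'rV[R]_n)
    (f : 'rV[R]_n -> V) : smooth_on U f <-> forall k, Ck k U f.
Proof.
split=> [+ k|].
  elim: k f => [|k IH] f sf /=; split=> //.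
  - by move=> x Ux; apply: (sf [::]).
  - by move=> x Ux; apply: (sf [::]).
  - move=> v; apply: IH => vs x Ux.
    by have := sf (rcons vs v) x Ux; rewrite -cats1 foldr_cat.
move=> ckf vs; elim/last_ind: vs f ckf => [|vs v IH] f ckf x Ux.
  by have [+ _] := ckf 0%N; apply.
rewrite -cats1 foldr_cat; apply: IH => // k.
by have [_ +] := ckf k.+1; apply.
Qed.

Lemma Ck0 (R : realType) n (V : normedModType R) (U : set 'rV[R]_n)
    (f : 'rV[R]_n -> V) : Ck 0 U f <-> (forall x, U x -> differentiable f x).
Proof. by split=> [[]|]. Qed.

Lemma CkSP (R : realType) n (V : normedModType R) k (U : set 'rV[R]_n)
    (f : 'rV[R]_n -> V) :
  Ck k.+1 U f <->
  (forall x, U x -> differentiable f x) /\ (forall v, Ck k U ('D_v f)).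
Proof. by []. Qed.

Section CkTheory.
Context (R : realType) (n : nat).
Implicit Types (U : set 'rV[R]_n) (x v : 'rV[R]_n).

Lemma Ck_diff (V : normedModType R) k U (f : 'rV[R]_n -> V) x :
  Ck k U f -> U x -> differentiable f x.
Proof. by case: k => [|k] [+ _]; apply. Qed.

Lemma CkS (V : normedModType R) k U (f : 'rV[R]_n -> V) :
  Ck k.+1 U f -> Ck k U f.
Proof.
elim: k f => [|k IH] f; first by case/CkSP => df _; apply/Ck0.
by move=> /CkSP[df Df]; apply/CkSP; split=> // v; exact/IH/Df.
Qed.

Lemma open_eq_near (T : Type) U (f g : 'rV[R]_n -> T) x :
  open U -> (forall y, U y -> f y = g y) -> U x -> \near x, f x = g x.
Proof.
move=> oU fg Ux; have : nbhs x U by exact: open_nbhs_nbhs.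
by apply: filterS => y /fg.
Qed.

Lemma Ck_eq (V : normedModType R) k U (f g : 'rV[R]_n -> V) :
  open U -> (forall x, U x -> f x = g x) -> Ck k U f -> Ck k U g.
Proof.
move=> oU; elim: k f g => [|k IH] f g fg.
  move=> /Ck0 df; apply/Ck0 => x Ux.
  by apply: near_eq_diff (df _ Ux); exact: (open_eq_near oU fg).
move=> /CkSP[df Df]; apply/CkSP; split=> [x Ux|v].
  by apply: near_eq_diff (df _ Ux); exact: (open_eq_near oU fg).
apply: IH (Df v) => x Ux.
by apply: near_eq_derive; exact: (open_eq_near oU fg).
Qed.

Lemma Ck_cst (V : normedModType R) k U (c : V) : Ck k U (fun=> c).
Proof.
elim: k c => [|k IH] c; first by apply/Ck0 => x _; exact: differentiable_cst.
apply/CkSP; split=> [x _|v]; first exact: differentiable_cst.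
suff -> : 'D_v (fun=> c) = (fun=> 0) :> ('rV[R]_n -> V) by exact: IH.
by apply/funext => x; exact: derive_cst.
Qed.

Lemma Ck_D (V : normedModType R) k U (f g : 'rV[R]_n -> V) : open U ->
  Ck k U f -> Ck k U g -> Ck k U (fun x => f x + g x).
Proof.
move=> oU; elim: k f g => [|k IH] f g.
  by move=> /Ck0 df /Ck0 dg; apply/Ck0 => x Ux; apply: differentiableD; auto.
move=> /CkSP[df Df] /CkSP[dg Dg]; apply/CkSP; split=> [x Ux|v].
  by apply: differentiableD; auto.
apply: (@Ck_eq _ _ _ (fun x => 'D_v f x + 'D_v g x)) (IH _ _ (Df v) (Dg v)).
  exact: oU.
by move=> x Ux; rewrite deriveD //; apply: diff_derivable; auto.
Qed.

Lemma Ck_sum (V : normedModType R) k U (I : Type) (s : seq I)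
    (f : I -> 'rV[R]_n -> V) : open U ->
  (forall i, Ck k U (f i)) -> Ck k U (fun x => \sum_(i <- s) f i x).
Proof.
move=> oU Hf; elim: s => [|i s IH].
  by apply: (Ck_eq oU) (Ck_cst _ _ 0) => x _; rewrite big_nil.
by apply: (Ck_eq oU) (Ck_D oU (Hf i) IH) => x _; rewrite big_cons.
Qed.

Lemma Ck_M k U (f g : 'rV[R]_n -> R) : open U ->
  Ck k U f -> Ck k U g -> Ck k U (fun x => f x * g x).
Proof.
move=> oU; elim: k f g => [|k IH] f g Cf Cg.
  by apply/Ck0 => x Ux; exact: differentiableM (Ck_diff Cf Ux) (Ck_diff Cg Ux).
have /CkSP[df Df] := Cf; have /CkSP[dg Dg] := Cg.
apply/CkSP; split=> [x Ux|v].
  by apply: differentiableM; auto.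
apply: (Ck_eq oU) (Ck_D oU (IH _ _ (CkS Cf) (Dg v)) (IH _ _ (CkS Cg) (Df v))).
by move=> x Ux; rewrite deriveM //; apply: diff_derivable; auto.
Qed.

Lemma Ck_V k U (f : 'rV[R]_n -> R) : open U -> (forall x, U x -> f x != 0) ->
  Ck k U f -> Ck k U (fun x => (f x)^-1).
Proof.
move=> oU f0; elim: k => [|k IH] Cf.
  by apply/Ck0 => x Ux; apply: differentiableV; [exact: Ck_diff Cf Ux|exact: f0].
have /CkSP[df Df] := Cf; have CV := IH (CkS Cf).
apply/CkSP; split=> [x Ux|v].
  by apply: differentiableV; auto.
have Cm : Ck k U (fun x => (-1 * ((f x)^-1 * (f x)^-1)) * 'D_v f x).
  by apply: Ck_M => //; apply: Ck_M => //; [exact: Ck_cst|exact: Ck_M].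
apply: (Ck_eq oU) Cm.
move=> x Ux; rewrite deriveV; auto; last by apply: diff_derivable; auto.
by rewrite mulN1r -exprVn expr2.
Qed.

Lemma differentiable_rV m (f : 'rV[R]_n -> 'rV[R]_m) x :
  (forall j, differentiable (fun x => f x 0 j) x) -> differentiable f x.
Proof.
move=> df; have -> : f = \sum_j (fun x => f x 0 j *: delta_mx 0 j).
  by apply/funext => y; rewrite [LHS]row_sum_delta fct_sumE.
by apply: differentiable_sum => j; apply: differentiableZl.
Qed.

Lemma differentiable_rVE m (f : 'rV[R]_n -> 'rV[R]_m) x j :
  differentiable f x -> differentiable (fun x => f x 0 j) x.
Proof.
move=> df; apply: (@differentiable_comp _ _ _ _ f (fun M : 'rV_m => M 0 j)) => //.
exact: differentiable_coord.
Qed.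

Lemma derive_rVE m (f : 'rV[R]_n -> 'rV[R]_m) x v j :
  differentiable f x -> ('D_v f x) 0 j = 'D_v (fun x => f x 0 j) x.
Proof. by move=> df; rewrite derive_mx ?mxE //; exact: diff_derivable. Qed.

Lemma Ck_rV m k U (f : 'rV[R]_n -> 'rV[R]_m) : open U ->
  Ck k U f <-> (forall j, Ck k U (fun x => f x 0 j)).
Proof.
move=> oU; split.
  elim: k f => [|k IH] f.
    by move=> /Ck0 df j; apply/Ck0 => x Ux; apply: differentiable_rVE; auto.
  move=> /CkSP[df Df] j; apply/CkSP; split=> [x Ux|v].
    by apply: differentiable_rVE; auto.
  by apply: (Ck_eq oU) (IH _ (Df v) j) => x Ux; rewrite derive_rVE; auto.
elim: k f => [|k IH] f Cf; have df x : U x -> differentiable f x.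
- by move=> Ux; apply: differentiable_rV => j; exact: Ck_diff (Cf j) Ux.
- exact/Ck0.
- by move=> Ux; apply: differentiable_rV => j; exact: Ck_diff (Cf j) Ux.
apply/CkSP; split=> // v; apply: IH => j.
have /CkSP[_ /(_ v)] := Cf j; apply: (Ck_eq oU) => x Ux.
by rewrite derive_rVE; auto.
Qed.

Lemma linear_rV_sum m (V : lmodType R) (L : 'rV[R]_m -> V) (u : 'rV[R]_m) :
  linear L -> L u = \sum_j u 0 j *: L (delta_mx 0 j).
Proof.
move=> linL; pose Lm := GRing.isLinear.Build _ _ _ _ _ linL.
pose L' : {linear 'rV[R]_m -> V} := HB.pack L Lm.
rewrite -[L]/(L' : _ -> _) [in LHS](row_sum_delta u) linear_sum.
by apply: eq_bigr => j _; rewrite linearZ.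
Qed.

Lemma derive_linear (V : normedModType R) (f : 'rV[R]_n -> V) x :
  differentiable f x -> linear (fun v => 'D_v f x).
Proof. by move=> df a u v; rewrite !deriveE // linearP. Qed.

Lemma derive_comp m (V : normedModType R) (f : 'rV[R]_m -> V)
    (psi : 'rV[R]_n -> 'rV[R]_m) x v :
  differentiable psi x -> differentiable f (psi x) ->
  'D_v (f \o psi) x = 'D_('D_v psi x) f (psi x).
Proof.
move=> dp df; rewrite deriveE; last exact: differentiable_comp.
by rewrite diff_comp //= !deriveE.
Qed.

End CkTheory.

(** The derivatives of a composite are sums of products of a derivative of [psi]
    and a composite of [psi] with a partial derivative of [f]. *)
Lemma Ck_comp (R : realType) n m k (U : set 'rV[R]_n) (U' : set 'rV[R]_m)
    (f : 'rV[R]_m -> R) (psi : 'rV[R]_n -> 'rV[R]_m) :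
  open U -> (forall x, U x -> U' (psi x)) ->
  Ck k U psi -> Ck k U' f -> Ck k U (f \o psi).
Proof.
move=> oU sU; elim: k f => [|k IH] f Cp Cf.
  apply/Ck0 => x Ux; apply: differentiable_comp; first exact: Ck_diff Cp Ux.
  by apply: Ck_diff Cf _; auto.
have /CkSP[dp Dp] := Cp; have /CkSP[df Df] := Cf; apply/CkSP; split=> [x Ux|v].
  by apply: differentiable_comp; auto.
apply: (Ck_eq (f := fun x => \sum_(j < m)
   ('D_v psi x) 0 j * ('D_(delta_mx 0 j) f \o psi) x) oU).
  move=> x Ux; rewrite (derive_comp v (dp _ Ux) (df _ (sU _ Ux))).
  rewrite [RHS](linear_rV_sum (L := fun w => 'D_w f (psi x))) //.
  by apply: derive_linear; auto.
apply: Ck_sum => // j; apply: Ck_M => //; first exact: (Ck_rV _ _ oU).1.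
by apply: IH => //; exact: CkS.
Qed.

(** * Mean value theorem and symmetry of second derivatives *)

Lemma is_derive_line (R : realType) n (f : 'rV[R]_n -> R) (a u : 'rV[R]_n)
    (r : R) : differentiable f (a + r *: u) ->
  is_derive r 1 (fun s => f (a + s *: u)) ('D_u f (a + r *: u)).
Proof.
move=> df; pose l : R -> 'rV[R]_n := fun s => a + s *: u.
have dl : is_diff r l (fun s => s *: u).
  have := is_diffD (is_diff_cst a r) (is_diff_scalel r u).
  by move=> H; apply: is_diff_eq H _; apply/funext => s; rewrite !fctE add0r.
have dl' : differentiable l r by exact: ex_diff.
have dc : differentiable (f \o l) r.
  by apply: differentiable_comp; [exact: dl'|exact: df].
apply: DeriveDef; first exact: diff_derivable dc.
rewrite (deriveE _ dc) (diff_comp dl' df) /=.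
by rewrite diff_val scale1r deriveE.
Qed.

Lemma mean_value_line (R : realType) n (f : 'rV[R]_n -> R) (a u : 'rV[R]_n)
    (s : R) : 0 < s ->
  (forall r, 0 <= r <= s -> differentiable f (a + r *: u)) ->
  exists2 r, 0 < r < s & f (a + s *: u) - f a = s * 'D_u f (a + r *: u).
Proof.
move=> s0 df.
have [r|/=|r rs e] := @MVT R (fun r => f (a + r *: u))
  (fun r => 'D_u f (a + r *: u)) 0 s s0.
- rewrite in_itv => /= /andP[r0 r1].
  by apply: is_derive_line; apply: df; rewrite !ltW.
- apply: derivable_within_continuous => r' ; rewrite in_itv => /= rs.
  by have [//] := is_derive_line (df _ rs).
exists r; first by move: rs; rewrite in_itv.
by move: e; rewrite scale0r addr0 subr0 mulrC.
Qed.

(** The mean value theorem, along [u] for the increment of [f] by [v] and then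
    along [v] for the derivative of [f] along [u]. *)
Lemma second_difference (R : realType) n (U : set 'rV[R]_n) (f : 'rV[R]_n -> R)
    (x u v : 'rV[R]_n) (s : R) : 0 < s ->
  (forall r q, 0 <= r <= s -> 0 <= q <= s -> U (x + r *: u + q *: v)) ->
  Ck 1 U f ->
  exists r q, [/\ 0 < r < s, 0 < q < s &
    f (x + s *: u + s *: v) - f (x + s *: u) - f (x + s *: v) + f x =
    s * s * 'D_v ('D_u f) (x + r *: u + q *: v)].
Proof.
move=> s0 sU /CkSP[df /(_ u) /Ck0 Df].
have s00 : 0 <= (0 : R) <= s by rewrite lexx ltW.
have s11 : 0 <= s <= s by rewrite lexx ltW.
have d0 r : 0 <= r <= s -> differentiable f (x + r *: u).
  by move=> rs; apply: df; have := sU r 0 rs s00; rewrite scale0r addr0.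
have d1 r : 0 <= r <= s -> differentiable f (x + s *: v + r *: u).
  by move=> rs; rewrite addrAC; apply/df/sU.
have dg r : 0 <= r <= s ->
  is_derive r 1 ((fun r => f (x + s *: v + r *: u)) - (fun r => f (x + r *: u)))
    ('D_u f (x + s *: v + r *: u) - 'D_u f (x + r *: u)).
  move=> rs; apply: is_deriveB.
    exact: is_derive_line (d1 _ rs).
  exact: is_derive_line (d0 _ rs).
have [r rs|/=|r rs e] := @MVT R
  ((fun r => f (x + s *: v + r *: u)) - (fun r => f (x + r *: u)))
  (fun r => 'D_u f (x + s *: v + r *: u) - 'D_u f (x + r *: u)) 0 s s0.
- by apply: dg; move: rs; rewrite in_itv /= => /andP[r0 r1]; rewrite !ltW.
- apply: derivable_within_continuous => r' ; rewrite in_itv => /= rs.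
  by have [] := dg _ rs.
have {}rs : 0 < r < s by move: rs; rewrite in_itv.
have rs' : 0 <= r <= s by case/andP: rs => ? ?; rewrite !ltW.
have [q qs e'] := @mean_value_line R n ('D_u f) (x + r *: u) v s s0
  (fun q qs => Df _ (sU _ _ rs' qs)).
exists r, q; split=> //; rewrite -mulrA -e'.
move: e; rewrite !fctE scale0r !addr0 subr0 [in RHS]mulrC.
rewrite -[x + r *: u + s *: v]addrAC => <-.
by rewrite [x + s *: u + _]addrAC; ring.
Qed.

Lemma continuous_pair_ball (R : realType) n (U : set 'rV[R]_n)
    (A B : 'rV[R]_n -> R) x (e : R) : open U -> U x ->
  {for x, continuous A} -> {for x, continuous B} -> 0 < e ->
  exists2 d : R, 0 < d & forall y, `|y - x| < d ->
  [/\ U y, `|A y - A x| < e & `|B y - B x| < e].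
Proof.
move=> oU Ux cA cB e0.
have /cvgrPdistC_lt/(_ e e0) c1 := cA.
have /cvgrPdistC_lt/(_ e e0) c2 := cB.
have c0 : nbhs x U by exact: open_nbhs_nbhs (conj oU Ux).
have /nbhs_ballP[d /= d0 H] :
    \forall y \near x, [/\ U y, `|A y - A x| < e & `|B y - B x| < e].
  by apply: filterS3 c0 c1 c2 => y Uy H1 H2; split.
exists d => // y yx; apply: H.
by rewrite -ball_normE /ball_ /= distrC.
Qed.

(** The two values of the second difference are taken at points that tend to [x]
    with the size of the parallelogram. *)
Lemma second_difference_limit (R : realType) n (U : set 'rV[R]_n)
    (Delta : R -> R) (A B : 'rV[R]_n -> R) (x u v : 'rV[R]_n) :
  open U -> U x -> {for x, continuous A} -> {for x, continuous B} ->
  (forall s, 0 < s ->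
    (forall r q, 0 <= r <= s -> 0 <= q <= s -> U (x + r *: u + q *: v)) ->
    exists r q, [/\ 0 < r < s, 0 < q < s &
      Delta s = s * s * A (x + r *: u + q *: v)]) ->
  (forall s, 0 < s ->
    (forall r q, 0 <= r <= s -> 0 <= q <= s -> U (x + r *: v + q *: u)) ->
    exists r q, [/\ 0 < r < s, 0 < q < s &
      Delta s = s * s * B (x + r *: v + q *: u)]) ->
  A x = B x.
Proof.
move=> oU Ux cA cB HA HB.
apply/eqP; rewrite -subr_eq0; apply/negP => /negP ne0.
set e := `|A x - B x| / 2.
have e0 : 0 < e by rewrite divr_gt0 // normr_gt0.
have [d d0 Hd] := continuous_pair_ball oU Ux cA cB e0.
(* so small that the parallelogram stays in the ball of radius d *)
pose s := d / (`|u| + `|v| + 1) / 2.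
have K0 : 0 < `|u| + `|v| + 1 by rewrite ltr_wpDl ?addr_ge0.
have s0 : 0 < s by rewrite !divr_gt0.
have sK : s * (`|u| + `|v|) < d.
  have sE : s * (`|u| + `|v| + 1) = d / 2 by rewrite /s; field; rewrite gt_eqF.
  apply: (@le_lt_trans _ _ (s * (`|u| + `|v| + 1))).
    by rewrite ler_pM2l // lerDl.
  by rewrite sE ltr_pdivrMr // ltr_pMr // ltr1n.
have near_x a b r q : a = u /\ b = v \/ a = v /\ b = u ->
    0 <= r <= s -> 0 <= q <= s -> `|x + r *: a + q *: b - x| < d.
  move=> ab /andP[r0 r1] /andP[q0 q1]; apply: le_lt_trans sK.
  have -> : x + r *: a + q *: b - x = r *: a + q *: b.
    by rewrite -[x + _ + _]addrA [x + _]addrC addrK.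
  apply: le_trans (ler_normD _ _) _; rewrite !normrZ !ger0_norm //.
  have H : s * (`|u| + `|v|) = s * `|a| + s * `|b|.
    by rewrite -mulrDr; case: ab => -[-> ->] //; rewrite addrC.
  by rewrite H lerD // ler_wpM2r.
have [|r [q [/andP[r0 rs] /andP[q0 qs] E1]]] := HA s s0.
  by move=> r q rs qs; have [] := Hd _ (near_x u v r q (or_introl (conj erefl erefl)) rs qs).
have [|r' [q' [/andP[r0' rs'] /andP[q0' qs'] E2]]] := HB s s0.
  by move=> r' q' rs' qs'; have [] := Hd _ (near_x v u r' q' (or_intror (conj erefl erefl)) rs' qs').
have E : A (x + r *: u + q *: v) = B (x + r' *: v + q' *: u).
  by apply: (mulfI (lt0r_neq0 (mulr_gt0 s0 s0))); rewrite -E1 -E2.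
have [|_ H1 _] := Hd (x + r *: u + q *: v).
  by apply: near_x; [left|rewrite !ltW|rewrite !ltW].
have [|_ _ H2] := Hd (x + r' *: v + q' *: u).
  by apply: near_x; [right|rewrite !ltW|rewrite !ltW].
move: H1; rewrite E => H1.
have : `|A x - B x| < e + e.
  set C := B (x + r' *: v + q' *: u) in H1 H2.
  rewrite (_ : _ - _ = (C - B x) - (C - A x)); last by ring.
  by apply: le_lt_trans (ler_normB _ _) _; apply: ltrD.
by rewrite /e -splitr ltxx.
Qed.

(** The second difference of [f] over a small parallelogram is a value of each
    of the two mixed derivatives at a nearby point. *)
Lemma derive_symmetric (R : realType) n (U : set 'rV[R]_n) (f : 'rV[R]_n -> R)
    (x u v : 'rV[R]_n) : open U -> Ck 2 U f -> U x ->
  'D_u ('D_v f) x = 'D_v ('D_u f) x.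
Proof.
move=> oU Cf Ux; have /CkSP[_ Df] := Cf.
have cts a b : {for x, continuous ('D_b ('D_a f))}.
  by have /CkSP[_ /(_ b)/Ck0 H] := Df a; exact/differentiable_continuous/H.
apply: (@second_difference_limit _ _ U (fun s =>
    f (x + s *: v + s *: u) - f (x + s *: v) - f (x + s *: u) + f x)
    ('D_u ('D_v f)) ('D_v ('D_u f)) x v u oU Ux (cts v u) (cts u v)).
  by move=> s s0 sU; exact: (second_difference s0 sU (CkS Cf)).
move=> s s0 sU; have [r [q [rs qs E]]] := second_difference s0 sU (CkS Cf).
exists r, q; split=> //; rewrite -E [x + s *: v + _]addrAC.
by rewrite [_ - f (x + s *: v) - _]addrAC.
Qed.

(** * Calculus of smooth functions on open sets *)

Section Smooth.
Context (R : realType) (n : nat) (U : set 'rV[R]_n).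
Hypothesis oU : open U.
Implicit Types (x u v w : 'rV[R]_n).

Lemma smooth_diff (V : normedModType R) (f : 'rV[R]_n -> V) x :
  smooth_on U f -> U x -> differentiable f x.
Proof. by move=> sf; apply: (sf [::]). Qed.

Lemma smooth_eq (V : normedModType R) (f g : 'rV[R]_n -> V) :
  (forall x, U x -> f x = g x) -> smooth_on U f -> smooth_on U g.
Proof.
move=> fg /smooth_onP sf; apply/smooth_onP => k; exact: (Ck_eq oU fg (sf k)).
Qed.

Lemma smooth_sub (V : normedModType R) (U' : set 'rV[R]_n) (f : 'rV[R]_n -> V) :
  U `<=` U' -> smooth_on U' f -> smooth_on U f.
Proof. by move=> sU sf vs x /sU; apply: sf. Qed.

Lemma smooth_local (V : normedModType R) (f : 'rV[R]_n -> V) :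
  (forall x, U x -> exists2 U', U' x & smooth_on U' f) -> smooth_on U f.
Proof. by move=> H vs x /H[U' U'x sf]; exact: sf. Qed.

Lemma smooth_derive (V : normedModType R) (f : 'rV[R]_n -> V) v :
  smooth_on U f -> smooth_on U ('D_v f).
Proof. by move=> /smooth_onP sf; apply/smooth_onP => k; have /CkSP[_] := sf k.+1; exact. Qed.

Lemma smooth_cst (V : normedModType R) (c : V) : smooth_on U (fun=> c).
Proof. by apply/smooth_onP => k; exact: Ck_cst. Qed.

Lemma smoothD (V : normedModType R) (f g : 'rV[R]_n -> V) :
  smooth_on U f -> smooth_on U g -> smooth_on U (fun x => f x + g x).
Proof.
move=> /smooth_onP sf /smooth_onP sg; apply/smooth_onP => k; exact: Ck_D.
Qed.

Lemma smooth_sum (V : normedModType R) (I : Type) (s : seq I)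
    (f : I -> 'rV[R]_n -> V) :
  (forall i, smooth_on U (f i)) -> smooth_on U (fun x => \sum_(i <- s) f i x).
Proof.
move=> sf; apply/smooth_onP => k; apply: Ck_sum => // i.
by have /smooth_onP := sf i; apply.
Qed.

Lemma smoothM (f g : 'rV[R]_n -> R) :
  smooth_on U f -> smooth_on U g -> smooth_on U (fun x => f x * g x).
Proof.
move=> /smooth_onP sf /smooth_onP sg; apply/smooth_onP => k; exact: Ck_M.
Qed.

Lemma smoothV (f : 'rV[R]_n -> R) : (forall x, U x -> f x != 0) ->
  smooth_on U f -> smooth_on U (fun x => (f x)^-1).
Proof. by move=> f0 /smooth_onP sf; apply/smooth_onP => k; exact: Ck_V. Qed.

Lemma smooth_prod (I : Type) (s : seq I) (f : I -> 'rV[R]_n -> R) :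
  (forall i, smooth_on U (f i)) -> smooth_on U (fun x => \prod_(i <- s) f i x).
Proof.
move=> sf; elim: s => [|i s IH].
  by apply: smooth_eq (smooth_cst (1 : R)) => x _; rewrite big_nil.
by apply: smooth_eq (smoothM (sf i) IH) => x _; rewrite big_cons.
Qed.

Lemma smooth_rV m (f : 'rV[R]_n -> 'rV[R]_m) :
  smooth_on U f <-> (forall j, smooth_on U (fun x => f x 0 j)).
Proof.
split=> [/smooth_onP sf j|sf].
  by apply/smooth_onP => k; exact: ((Ck_rV _ _ oU).1 (sf k)).
apply/smooth_onP => k; apply/(Ck_rV _ _ oU) => j.
by have /smooth_onP := sf j; apply.
Qed.

Lemma smoothZ m (f : 'rV[R]_n -> R) (g : 'rV[R]_n -> 'rV[R]_m) :
  smooth_on U f -> smooth_on U g -> smooth_on U (fun x => f x *: g x).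
Proof.
move=> sf /smooth_rV sg; apply/smooth_rV => j.
by apply: smooth_eq (smoothM sf (sg j)) => x _; rewrite mxE.
Qed.

Lemma smooth_comp m (U' : set 'rV[R]_m) (f : 'rV[R]_m -> R)
    (psi : 'rV[R]_n -> 'rV[R]_m) :
  (forall x, U x -> U' (psi x)) -> smooth_on U psi -> smooth_on U' f ->
  smooth_on U (f \o psi).
Proof.
move=> sU /smooth_onP sp /smooth_onP sf; apply/smooth_onP => k.
exact: Ck_comp oU sU (sp k) (sf k).
Qed.

End Smooth.

Lemma smooth_comp_rV (R : realType) n m p (U : set 'rV[R]_n)
    (U' : set 'rV[R]_m) (f : 'rV[R]_m -> 'rV[R]_p) (psi : 'rV[R]_n -> 'rV[R]_m) :
  open U -> open U' -> (forall x, U x -> U' (psi x)) ->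
  smooth_on U psi -> smooth_on U' f -> smooth_on U (f \o psi).
Proof.
move=> oU oU' sU sp sf; apply/(smooth_rV oU) => j.
exact: (smooth_comp oU sU sp ((smooth_rV oU' _).1 sf j)).
Qed.

Lemma scalar_sum (R : pzRingType) m (L : 'rV[R]_m -> R) (u : 'rV[R]_m) :
  scalar L -> L u = \sum_j u 0 j * L (delta_mx 0 j).
Proof.
move=> linL; pose Lm := GRing.isLinear.Build _ _ _ _ _ linL.
pose L' : {scalar 'rV[R]_m} := HB.pack L Lm.
rewrite -[L]/(L' : _ -> _) [in LHS](row_sum_delta u) linear_sum.
by apply: eq_bigr => j _; rewrite linearZ.
Qed.

Section ScalarRules.
Context (R : pzRingType) (V : lmodType R).

Lemma scalarD (L : V -> R) : scalar L -> {morph L : u v / u + v}.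
Proof. by move=> H u v; rewrite -[u]scale1r H scale1r mul1r. Qed.

Lemma scalar0 (L : V -> R) : scalar L -> L 0 = 0.
Proof. by move=> H; have := H (-1) 0 0; rewrite scaler0 addr0 mulN1r addNr. Qed.

Lemma scalarZ (L : V -> R) a u : scalar L -> L (a *: u) = a * L u.
Proof. by move=> H; rewrite -[a *: u]addr0 H scalar0 // addr0. Qed.

Lemma scalarN (L : V -> R) : scalar L -> {morph L : u / - u}.
Proof. by move=> H u; rewrite -scaleN1r scalarZ // mulN1r. Qed.

Lemma scalarB (L : V -> R) : scalar L -> {morph L : u v / u - v}.
Proof. by move=> H u v; rewrite scalarD // scalarN. Qed.

End ScalarRules.

Section LinearRules.
Context (R : pzRingType) (V W : lmodType R).

Lemma linD (L : V -> W) : linear L -> {morph L : u v / u + v}.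
Proof. by move=> H u v; rewrite -[u]scale1r H !scale1r. Qed.

Lemma lin0 (L : V -> W) : linear L -> L 0 = 0.
Proof. by move=> H; have := H (-1) 0 0; rewrite scaler0 addr0 scaleN1r addNr. Qed.

Lemma linZ (L : V -> W) a u : linear L -> L (a *: u) = a *: L u.
Proof. by move=> H; rewrite -[a *: u]addr0 H lin0 // addr0. Qed.

Lemma linN (L : V -> W) : linear L -> {morph L : u / - u}.
Proof. by move=> H u; rewrite -scaleN1r linZ // scaleN1r. Qed.

Lemma linB (L : V -> W) : linear L -> {morph L : u v / u - v}.
Proof. by move=> H u v; rewrite linD // linN. Qed.

End LinearRules.

Section Apply.
Context (R : realType) (n m : nat) (U : set 'rV[R]_n).
Hypothesis oU : open U.

Section ScalarFamily.
Variables (L : 'rV[R]_n -> 'rV[R]_m -> R) (Y : 'rV[R]_n -> 'rV[R]_m).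
Hypothesis linL : forall x, U x -> scalar (L x).
Hypothesis smL : forall u, smooth_on U (fun x => L x u).
Hypothesis smY : smooth_on U Y.

Lemma smooth_apply : smooth_on U (fun x => L x (Y x)).
Proof.
apply: (smooth_eq oU (f := fun x => \sum_j Y x 0 j * L x (delta_mx 0 j))).
  by move=> x Ux; rewrite [RHS]scalar_sum //; apply: linL.
apply: (smooth_sum oU) => // j; apply: (smoothM oU) => //.
exact: ((smooth_rV oU _).1 smY).
Qed.

(** Leibniz rule: in coordinates [L y (Y y)] is a sum of products. *)
Lemma derive_apply x w : U x ->
  'D_w (fun y => L y (Y y)) x =
  'D_w (fun y => L y (Y x)) x + L x ('D_w Y x).
Proof.
move=> Ux; have dL u : derivable (fun y => L y u) x w.
  by apply: diff_derivable; exact: smooth_diff (smL u) Ux.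
have dY j : derivable (fun y => Y y 0 j) x w.
  by apply: diff_derivable; exact: smooth_diff ((smooth_rV oU _).1 smY j) Ux.
have E1 : 'D_w (fun y => L y (Y y)) x =
    'D_w (\sum_j ((fun y => Y y 0 j) * (fun y => L y (delta_mx 0 j)))) x.
  apply: near_eq_derive; apply: (open_eq_near oU _ Ux) => y Uy.
  by rewrite [LHS]scalar_sum; [rewrite fct_sumE|exact: linL].
have E2 : 'D_w (fun y => L y (Y x)) x =
    'D_w (\sum_j (Y x 0 j \*: (fun y => L y (delta_mx 0 j)))) x.
  apply: near_eq_derive; apply: (open_eq_near oU _ Ux) => y Uy.
  by rewrite [LHS]scalar_sum; [rewrite fct_sumE|exact: linL].
rewrite E1 E2 derive_sum; last by move=> j; apply: derivableM.
rewrite derive_sum; last by move=> j; apply: derivableZ.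
rewrite (scalar_sum ('D_w Y x) (linL Ux)) -big_split /=.
apply: eq_bigr => j _.
rewrite (deriveM (dY j) (dL _)) (deriveZ _ (dL _)).
rewrite (derive_rVE _ _ (smooth_diff smY Ux)).
by rewrite [X in _ + X = _]mulrC.
Qed.

End ScalarFamily.

Lemma derive_scalar_family (L : 'rV[R]_n -> 'rV[R]_m -> R) x w :
  (forall x, U x -> scalar (L x)) ->
  (forall u, smooth_on U (fun x => L x u)) -> U x ->
  scalar (fun u => 'D_w (fun y => L y u) x).
Proof.
move=> linL smL Ux a u v.
have dL u' : derivable (fun y => L y u') x w.
  by apply: diff_derivable; exact: smooth_diff (smL u') Ux.
have E : 'D_w (fun y => L y (a *: u + v)) x =
    'D_w ((a \*: (fun y => L y u)) + (fun y => L y v)) x.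
  apply: near_eq_derive; apply: (open_eq_near oU _ Ux) => y Uy.
  by rewrite (linL _ Uy).
rewrite E deriveD; [|exact: derivableZ|exact: dL].
by rewrite deriveZ.
Qed.

Section LinearFamily.
Variables (p : nat) (L : 'rV[R]_n -> 'rV[R]_m -> 'rV[R]_p)
  (Y : 'rV[R]_n -> 'rV[R]_m).
Hypothesis linL : forall x, U x -> linear (L x).
Hypothesis smL : forall u, smooth_on U (fun x => L x u).

Let linLj x j : U x -> scalar (fun u => L x u 0 j).
Proof. by move=> Ux a u v; rewrite linL // !mxE. Qed.

Let smLj u j : smooth_on U (fun x => L x u 0 j).
Proof. exact: (smooth_rV oU _).1. Qed.

Hypothesis smY : smooth_on U Y.

Lemma smooth_applyv : smooth_on U (fun x => L x (Y x)).
Proof.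
apply/(smooth_rV oU) => j.
by apply: (@smooth_apply (fun y u => L y u 0 j)) => // x; exact: linLj.
Qed.

Lemma derive_applyv x w : U x ->
  'D_w (fun y => L y (Y y)) x =
  'D_w (fun y => L y (Y x)) x + L x ('D_w Y x).
Proof.
move=> Ux; apply/rowP => j; rewrite mxE.
rewrite (derive_rVE _ _ (smooth_diff smooth_applyv Ux)).
rewrite (derive_rVE _ _ (smooth_diff (smL _) Ux)).
by apply: (@derive_apply (fun y u => L y u 0 j)) => // y; exact: linLj.
Qed.

End LinearFamily.
End Apply.

Lemma smooth_derive_symmetric (R : realType) n m (U : set 'rV[R]_n)
    (f : 'rV[R]_n -> 'rV[R]_m) x u v : open U -> smooth_on U f -> U x ->
  'D_u ('D_v f) x = 'D_v ('D_u f) x.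
Proof.
move=> oU sf Ux; apply/rowP => j.
have E a b : 'D_a ('D_b f) x 0 j = 'D_a ('D_b (fun y => f y 0 j)) x.
  rewrite derive_rVE; last exact: smooth_diff (smooth_derive b sf) Ux.
  apply: near_eq_derive; apply: (open_eq_near oU _ Ux) => y Uy.
  by rewrite derive_rVE //; exact: smooth_diff sf Uy.
have /smooth_onP/(_ 2%N) Cj := (smooth_rV oU _).1 sf j.
have S := derive_symmetric u v oU Cj Ux.
exact: etrans (E u v) (etrans S (esym (E v u))).
Qed.

(** Points of a ball are joined to its centre by segments. *)
Lemma derive0_near_constant (R : realType) n (U : set 'rV[R]_n)
    (f : 'rV[R]_n -> R) x : open U -> U x ->
  (forall y, U y -> differentiable f y) -> (forall y v, U y -> 'D_v f y = 0) ->
  \forall y \near x, f y = f x.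
Proof.
move=> oU Ux df Df0.
have /nbhs_ballP[e /= e0 He] : nbhs x U by exact: open_nbhs_nbhs.
apply/nbhs_ballP; exists e => //= y xy.
have inU r : 0 <= r <= 1 -> U (x + r *: (y - x)).
  move=> /andP[r0 r1]; apply: He.
  rewrite -ball_normE /ball_ /= opprD addNKr normrN normrZ ger0_norm //.
  move: xy; rewrite -ball_normE /ball_ /= distrC => xy.
  by apply: le_lt_trans xy; rewrite ler_piMl.
have [|r rs] := @mean_value_line R n f x (y - x) 1 ltr01.
  by move=> r rs; apply/df/inU.
rewrite scale1r [x + _]addrC subrK Df0 ?mulr0.
  by move/eqP; rewrite subr_eq0 => /eqP.
by apply: inU; case/andP: rs => ? ?; rewrite !ltW.
Qed.

(** * Directional derivatives of smooth functions *)

(** Sealed forms of ['D_v f x] for values in R and in R^m, so that unification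
    never unfolds the underlying limit. *)
HB.lock Definition Ds (R : realType) n (f : 'rV[R]_n -> R) (x v : 'rV[R]_n) : R :=
  'D_v f x.
HB.lock Definition Dv (R : realType) n m (f : 'rV[R]_n -> 'rV[R]_m)
  (x v : 'rV[R]_n) : 'rV[R]_m := 'D_v f x.

Section Derivatives.
Context (R : realType) (n : nat) (U : set 'rV[R]_n).
Hypothesis oU : open U.
Implicit Types x u v w : 'rV[R]_n.

Lemma smooth_Ds (f : 'rV[R]_n -> R) v :
  smooth_on U f -> smooth_on U (fun x => Ds f x v).
Proof.
move=> sf; have -> : (fun x => Ds f x v) = 'D_v f.
  by apply/funext => x; rewrite Ds.unlock.
exact: smooth_derive.
Qed.

Lemma smooth_Dv m (f : 'rV[R]_n -> 'rV[R]_m) v :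
  smooth_on U f -> smooth_on U (fun x => Dv f x v).
Proof.
move=> sf; have -> : (fun x => Dv f x v) = 'D_v f.
  by apply/funext => x; rewrite Dv.unlock.
exact: smooth_derive.
Qed.

Lemma Ds_eq (f g : 'rV[R]_n -> R) x v :
  (forall y, U y -> f y = g y) -> U x -> Ds f x v = Ds g x v.
Proof.
move=> fg Ux; rewrite Ds.unlock.
by apply: near_eq_derive; exact: (open_eq_near oU fg Ux).
Qed.

Lemma Dv_eq m (f g : 'rV[R]_n -> 'rV[R]_m) x v :
  (forall y, U y -> f y = g y) -> U x -> Dv f x v = Dv g x v.
Proof.
move=> fg Ux; rewrite Dv.unlock.
by apply: near_eq_derive; exact: (open_eq_near oU fg Ux).
Qed.

Lemma Ds_scalar (f : 'rV[R]_n -> R) x : smooth_on U f -> U x -> scalar (Ds f x).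
Proof. by move=> sf Ux; rewrite Ds.unlock; exact: derive_linear (smooth_diff sf Ux). Qed.

Lemma Dv_linear m (f : 'rV[R]_n -> 'rV[R]_m) x :
  smooth_on U f -> U x -> linear (Dv f x).
Proof. by move=> sf Ux; rewrite Dv.unlock; exact: derive_linear (smooth_diff sf Ux). Qed.

Lemma DvE m (f : 'rV[R]_n -> 'rV[R]_m) x v j :
  smooth_on U f -> U x -> Dv f x v 0 j = Ds (fun y => f y 0 j) x v.
Proof.
move=> sf Ux; rewrite Dv.unlock Ds.unlock.
exact: derive_rVE (smooth_diff sf Ux).
Qed.

Lemma DsD (f g : 'rV[R]_n -> R) x v : smooth_on U f -> smooth_on U g -> U x ->
  Ds (fun y => f y + g y) x v = Ds f x v + Ds g x v.
Proof.
move=> sf sg Ux; rewrite Ds.unlock; apply: deriveD; apply: diff_derivable.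
  exact: smooth_diff sf Ux.
exact: smooth_diff sg Ux.
Qed.

Lemma DsM (f g : 'rV[R]_n -> R) x v : smooth_on U f -> smooth_on U g -> U x ->
  Ds (fun y => f y * g y) x v = f x * Ds g x v + g x * Ds f x v.
Proof.
move=> sf sg Ux; rewrite Ds.unlock; apply: deriveM; apply: diff_derivable.
  exact: smooth_diff sf Ux.
exact: smooth_diff sg Ux.
Qed.

Lemma Ds_cst (c : R) x v : Ds (fun=> c) x v = 0.
Proof. by rewrite Ds.unlock; exact: derive_cst. Qed.

Lemma DvD m (f g : 'rV[R]_n -> 'rV[R]_m) x v :
  smooth_on U f -> smooth_on U g -> U x ->
  Dv (fun y => f y + g y) x v = Dv f x v + Dv g x v.
Proof.
move=> sf sg Ux; rewrite Dv.unlock; apply: deriveD; apply: diff_derivable.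
  exact: smooth_diff sf Ux.
exact: smooth_diff sg Ux.
Qed.

Lemma DvZ m (f : 'rV[R]_n -> R) (g : 'rV[R]_n -> 'rV[R]_m) x v :
  smooth_on U f -> smooth_on U g -> U x ->
  Dv (fun y => f y *: g y) x v = Ds f x v *: g x + f x *: Dv g x v.
Proof.
move=> sf sg Ux; apply/rowP => j; rewrite DvE //; last exact: smoothZ.
have sgj := (smooth_rV oU _).1 sg j.
rewrite !mxE DvE // -[Ds f x v * _]mulrC addrC -DsM //.
by congr (Ds _ x v); apply/funext => y; rewrite mxE.
Qed.

Lemma Ds_sym (f : 'rV[R]_n -> R) x u v : smooth_on U f -> U x ->
  Ds (fun y => Ds f y v) x u = Ds (fun y => Ds f y u) x v.
Proof.
move=> /smooth_onP/(_ 2%N) sf Ux; rewrite Ds.unlock.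
exact: (derive_symmetric u v oU sf Ux).
Qed.

Lemma Dv_sym m (f : 'rV[R]_n -> 'rV[R]_m) x u v : smooth_on U f -> U x ->
  Dv (fun y => Dv f y v) x u = Dv (fun y => Dv f y u) x v.
Proof.
move=> sf Ux; rewrite Dv.unlock.
exact: (smooth_derive_symmetric u v oU sf Ux).
Qed.

Section Families.
Variable m : nat.

Lemma Ds_apply (L : 'rV[R]_n -> 'rV[R]_m -> R) (Y : 'rV[R]_n -> 'rV[R]_m) x w :
  (forall y, U y -> scalar (L y)) -> (forall u : 'rV[R]_m, smooth_on U (fun y => L y u)) ->
  smooth_on U Y -> U x ->
  Ds (fun y => L y (Y y)) x w = Ds (fun y => L y (Y x)) x w + L x (Dv Y x w).
Proof.
by move=> linL smL smY Ux; rewrite Ds.unlock Dv.unlock; exact: (derive_apply oU linL smL smY w Ux).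
Qed.

Lemma Dv_apply p (L : 'rV[R]_n -> 'rV[R]_m -> 'rV[R]_p)
    (Y : 'rV[R]_n -> 'rV[R]_m) x w :
  (forall y, U y -> linear (L y)) -> (forall u : 'rV[R]_m, smooth_on U (fun y => L y u)) ->
  smooth_on U Y -> U x ->
  Dv (fun y => L y (Y y)) x w = Dv (fun y => L y (Y x)) x w + L x (Dv Y x w).
Proof.
by move=> linL smL smY Ux; rewrite Dv.unlock; exact: (derive_applyv oU linL smL smY w Ux).
Qed.

Lemma Ds_family (L : 'rV[R]_n -> 'rV[R]_m -> R) x w :
  (forall y, U y -> scalar (L y)) -> (forall u : 'rV[R]_m, smooth_on U (fun y => L y u)) ->
  U x -> scalar (fun u : 'rV[R]_m => Ds (fun y => L y u) x w).
Proof.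
by move=> linL smL Ux; rewrite Ds.unlock; exact: (derive_scalar_family oU w linL smL Ux).
Qed.

Variables (U' : set 'rV[R]_m) (psi : 'rV[R]_n -> 'rV[R]_m).
Hypothesis sU : forall x, U x -> U' (psi x).
Hypothesis spsi : smooth_on U psi.

Lemma Ds_comp (f : 'rV[R]_m -> R) x v : smooth_on U' f -> U x ->
  Ds (fun y => f (psi y)) x v = Ds f (psi x) (Dv psi x v).
Proof.
move=> sf Ux; rewrite Ds.unlock Dv.unlock.
exact: (derive_comp (f := f) v (smooth_diff spsi Ux) (smooth_diff sf (sU Ux))).
Qed.

Lemma Dv_comp p (f : 'rV[R]_m -> 'rV[R]_p) x v : smooth_on U' f -> U x ->
  Dv (fun y => f (psi y)) x v = Dv f (psi x) (Dv psi x v).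
Proof.
move=> sf Ux; rewrite Dv.unlock.
exact: (derive_comp (f := f) v (smooth_diff spsi Ux) (smooth_diff sf (sU Ux))).
Qed.

End Families.
End Derivatives.

(** * Forms, vector fields and endomorphism fields on open subsets of R^n *)

Section Euclidean.
Context (R : realType).

Definition form_on n (U : set 'rV[R]_n) (a : 'rV[R]_n -> 'rV[R]_n -> R) :=
  (forall x, U x -> scalar (a x)) /\ (forall u, smooth_on U (fun x => a x u)).

Definition endo_on n (U : set 'rV[R]_n) (A : 'rV[R]_n -> 'rV[R]_n -> 'rV[R]_n) :=
  (forall x, U x -> linear (A x)) /\ (forall u, smooth_on U (fun x => A x u)).

Definition extd_in n (a : 'rV[R]_n -> 'rV[R]_n -> R) (x u v : 'rV[R]_n) : R :=
  2^-1 * (Ds (fun y => a y v) x u - Ds (fun y => a y u) x v).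

Definition lie_in n (X Y : 'rV[R]_n -> 'rV[R]_n) (x : 'rV[R]_n) :=
  Dv Y x (X x) - Dv X x (Y x).

(** The Nijenhuis torsion in coordinates: on arbitrary fields the second-order
    terms cancel and only the first derivatives of [A] survive. *)
Definition torsion n (A : 'rV[R]_n -> 'rV[R]_n -> 'rV[R]_n)
    (x u v : 'rV[R]_n) :=
  Dv (fun y => A y v) x (A x u) - Dv (fun y => A y u) x (A x v)
  - A x (Dv (fun y => A y v) x u - Dv (fun y => A y u) x v).

Section Pull.
Context (n m : nat) (U : set 'rV[R]_n) (U' : set 'rV[R]_m).
Variable psi : 'rV[R]_n -> 'rV[R]_m.
Hypothesis oU : open U.
Hypothesis oU' : open U'.
Hypothesis sU : forall x, U x -> U' (psi x).
Hypothesis smpsi : smooth_on U psi.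

Let linpsi y : U y -> linear (Dv psi y).
Proof. exact: Dv_linear. Qed.

Let smDpsi u : smooth_on U (fun y => Dv psi y u).
Proof. exact: smooth_Dv. Qed.

Lemma form_pull a : form_on U' a -> form_on U (fun x u => a (psi x) (Dv psi x u)).
Proof.
move=> [lina sma]; split=> [x Ux c u v|u].
  by rewrite linpsi // lina //; exact: sU.
apply: (smooth_apply oU (L := fun x => a (psi x)) _ _ (smDpsi u)).
- by move=> x /sU; exact: lina.
- by move=> v; exact: (smooth_comp oU sU smpsi (sma v)).
Qed.

(** The second derivatives of [psi] cancel by symmetry. *)
Lemma extd_pull a x u v : form_on U' a -> U x ->
  extd_in (fun x u => a (psi x) (Dv psi x u)) x u v =
  extd_in a (psi x) (Dv psi x u) (Dv psi x v).
Proof.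
move=> [lina sma] Ux.
have E w t : Ds (fun y => a (psi y) (Dv psi y t)) x w =
    Ds (fun y => a y (Dv psi x t)) (psi x) (Dv psi x w)
    + a (psi x) (Dv (fun y => Dv psi y t) x w).
  rewrite (Ds_apply oU (L := fun x => a (psi x)) w _ _ (smDpsi t) Ux).
  - by congr (_ + _); exact: (Ds_comp sU smpsi w (sma _) Ux).
  - by move=> y /sU; exact: lina.
  - by move=> s; exact: (smooth_comp oU sU smpsi (sma s)).
rewrite /extd_in (E u v) (E v u) (Dv_sym oU u v smpsi Ux).
by rewrite opprD addrACA subrr addr0.
Qed.

(** Differentiating A' o d psi = d psi o A expresses the derivatives of [A'] by
    those of [A] and second derivatives of [psi], which cancel by symmetry. *)
Lemma torsion_related A A' x u v : endo_on U A -> endo_on U' A' ->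
  (forall x u, U x -> A' (psi x) (Dv psi x u) = Dv psi x (A x u)) -> U x ->
  torsion A' (psi x) (Dv psi x u) (Dv psi x v) = Dv psi x (torsion A x u v).
Proof.
move=> [linA smA] [linA' smA'] rel Ux.
have linp := linpsi Ux; have linA'x := linA' _ (sU Ux).
have E w t : Dv (fun y => A' y (Dv psi x t)) (psi x) (Dv psi x w) =
    Dv (fun y => Dv psi y (A x t)) x w + Dv psi x (Dv (fun y => A y t) x w)
    - A' (psi x) (Dv (fun y => Dv psi y t) x w).
  have smA'psi s : smooth_on U (fun x => A' (psi x) s).
    exact: (smooth_comp_rV oU oU' sU smpsi (smA' s)).
  have E1 := Dv_apply oU (L := fun x => A' (psi x)) w
    (fun y Uy => linA' _ (sU Uy)) smA'psi (smDpsi t) Ux.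
  have E2 := Dv_apply oU (L := Dv psi) w linpsi smDpsi (smA t) Ux.
  have E3 : Dv (fun y => A' (psi y) (Dv psi y t)) x w =
            Dv (fun y => Dv psi y (A y t)) x w.
    by apply: (Dv_eq oU) => // y; exact: rel.
  have E4 := Dv_comp sU smpsi w (smA' (Dv psi x t)) Ux.
  by apply: (canRL (addrK _)); rewrite -E4; rewrite E3 E2 in E1; rewrite E1.
have S a b := Dv_sym oU a b smpsi Ux.
rewrite /torsion !rel // !E (S (A x u) (A x v)) (S (A x u) v) (S (A x v) u) (S u v).
rewrite !(linB linp) !(linB linA'x) !(linD linA'x) !rel //.
rewrite !(linB (linA _ Ux)) !(linB linp).
by apply/rowP => j; rewrite !mxE; ring.
Qed.

End Pull.
End Euclidean.

(** * Torsion and commuting frames *)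

Section Torsion.
Context (R : realType) (n : nat) (U : set 'rV[R]_n).
Hypothesis oU : open U.
Implicit Types (x u v w : 'rV[R]_n) (A P : 'rV[R]_n -> 'rV[R]_n -> 'rV[R]_n).
Implicit Types (a : 'rV[R]_n -> 'rV[R]_n -> R).

(** The derivatives of the fields, produced by the Leibniz rule, cancel: the
    bracket expression depends only on the values of the fields at [x]. *)
Lemma torsion_fields A (X Y : 'rV[R]_n -> 'rV[R]_n) x :
  endo_on U A -> smooth_on U X -> smooth_on U Y -> U x ->
  A x (A x (lie_in X Y x)) + lie_in (fun y => A y (X y)) (fun y => A y (Y y)) x
  - A x (lie_in (fun y => A y (X y)) Y x) - A x (lie_in X (fun y => A y (Y y)) x)
  = torsion A x (X x) (Y x).
Proof.
move=> [linA smA] sX sY Ux; have lA := linA _ Ux.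
have EX w := Dv_apply oU w linA smA sX Ux.
have EY w := Dv_apply oU w linA smA sY Ux.
rewrite /lie_in /torsion !EX !EY !(linB lA) !(linD lA).
by apply/rowP => j; rewrite !mxE; ring.
Qed.

(** The torsion is a quadratic function of the endomorphism field. *)
Lemma torsion_parallelogram A P x u v : endo_on U A -> endo_on U P -> U x ->
  torsion (fun y w => A y w + P y w) x u v
  + torsion (fun y w => A y w - P y w) x u v
  = (torsion A x u v + torsion P x u v) *+ 2.
Proof.
move=> [linA smA] [linP smP] Ux; have lA := linA _ Ux; have lP := linP _ Ux.
have smNP w : smooth_on U (fun y => - P y w).
  have := smoothZ oU (smooth_cst (-1 : R)) (smP w).
  by apply: (smooth_eq oU) => y _; rewrite scaleN1r.
have EN w t : Dv (fun y => - P y w) x t = - Dv (fun y => P y w) x t.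
  rewrite -[RHS]scaleN1r.
  have := DvZ oU t (smooth_cst (-1 : R)) (smP w) Ux.
  rewrite Ds_cst scale0r add0r => <-.
  by congr (Dv _ x t); apply/funext => y; rewrite scaleN1r.
have EA w t := DvD t (smA w) (smP w) Ux.
have EB w t := DvD t (smA w) (smNP w) Ux.
have lDA w : linear (Dv (fun y => A y w) x) by exact: Dv_linear (smA w) Ux.
have lDP w : linear (Dv (fun y => P y w) x) by exact: Dv_linear (smP w) Ux.
rewrite /torsion !EA !EB !EN !(linD (lDA _)) !(linD (lDP _)) !(linN (lDA _)).
rewrite !(linN (lDP _)) !(linB lA) !(linB lP) !(linD lA) !(linD lP).
rewrite ?(linN lA) ?(linN lP).
by apply/rowP => j; rewrite !mxE; ring.
Qed.

Lemma extd_in_skew a x u v : extd_in a x u v = - extd_in a x v u.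
Proof. by rewrite /extd_in; ring. Qed.

Lemma extd_in_form a v : form_on U a -> form_on U (fun x u => extd_in a x u v).
Proof.
move=> [lina sma]; split=> [x Ux c u w|u].
  rewrite /extd_in (Ds_scalar (sma v) Ux) (Ds_family oU v lina sma Ux) /=.
  by ring.
apply: (smoothM oU); first exact: smooth_cst.
apply: (smoothD oU); first by apply: (smooth_Ds).
have := smoothM oU (smooth_cst (-1 : R)) (smooth_Ds v (sma u)).
by apply: (smooth_eq oU) => y _; rewrite mulN1r.
Qed.

(** d o d = 0, by symmetry of second derivatives. *)
Lemma extd_in_closed a x u v w : form_on U a -> U x ->
  Ds (fun y => extd_in a y u v) x w + Ds (fun y => extd_in a y v w) x u
  + Ds (fun y => extd_in a y w u) x v = 0.
Proof.
move=> [lina sma] Ux.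
have E p q r : Ds (fun y => extd_in a y p q) x r =
   2^-1 * (Ds (fun y => Ds (fun z => a z q) y p) x r
           - Ds (fun y => Ds (fun z => a z p) y q) x r).
  have s1 := smooth_Ds p (sma q); have s2 := smooth_Ds q (sma p).
  have s3 := smoothM oU (smooth_cst (-1 : R)) s2.
  have s4 := smoothD oU s1 s3.
  have := DsM r (smooth_cst (2^-1 : R)) s4 Ux.
  rewrite Ds_cst mulr0 addr0 (DsD r s1 s3 Ux).
  rewrite (DsM r (smooth_cst (-1 : R)) s2 Ux) Ds_cst mulr0 addr0 mulN1r => <-.
  by congr (Ds _ x r); apply/funext => y; rewrite /extd_in mulN1r.
rewrite !E (Ds_sym oU w u (sma v) Ux) (Ds_sym oU w v (sma u) Ux).
by rewrite (Ds_sym oU u v (sma w) Ux); ring.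
Qed.

Section ReebCommute.
Variables (Z1 Z2 : 'rV[R]_n -> 'rV[R]_n).
Hypotheses (sZ1 : smooth_on U Z1) (sZ2 : smooth_on U Z2).

(** Differentiate da(Z2, v) = 0 along Z1 and da(Z1, v) = 0 along Z2; in the
    difference the derivatives of da cancel because da is closed. *)
Lemma kernel_lie a x v : form_on U a -> U x ->
  (forall y w, U y -> extd_in a y (Z1 y) w = 0) ->
  (forall y w, U y -> extd_in a y (Z2 y) w = 0) ->
  extd_in a x (lie_in Z1 Z2 x) v = 0.
Proof.
move=> fa Ux K1 K2.
have D (Z : 'rV[R]_n -> 'rV[R]_n) : smooth_on U Z ->
    (forall y w, U y -> extd_in a y (Z y) w = 0) -> forall w t,
    extd_in a x (Dv Z x w) t = - Ds (fun y => extd_in a y (Z x) t) x w.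
  move=> sZ K w t; have [l s] := extd_in_form t fa.
  have E := Ds_apply oU w l s sZ Ux.
  have E0 : Ds (fun y => extd_in a y (Z y) t) x w = 0.
    rewrite -[RHS](Ds_cst (0 : R) x w).
    by apply: (Ds_eq oU) => // y Uy; exact: K.
  by apply/eqP; rewrite -addr_eq0 addrC -E E0.
have B0 : extd_in a x (Dv Z1 x v) (Z2 x) = 0.
  by rewrite extd_in_skew K2 // oppr0.
have C := extd_in_closed (Z2 x) v (Z1 x) fa Ux.
have [l _] := extd_in_form v fa; have lx := l _ Ux.
rewrite /lie_in (scalarB lx) /= (D _ sZ2 K2) (D _ sZ1 K1).
have E1 : Ds (fun y => extd_in a y (Z1 x) (Z2 x)) x v = 0.
  by apply/eqP; rewrite -oppr_eq0 -(D _ sZ1 K1) B0.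
have E2 : Ds (fun y => extd_in a y v (Z1 x)) x (Z2 x) =
   - Ds (fun y => extd_in a y (Z1 x) v) x (Z2 x).
  have [_ s] := extd_in_form v fa.
  have := DsM (Z2 x) (smooth_cst (-1 : R)) (s (Z1 x)) Ux.
  rewrite Ds_cst mulr0 addr0 mulN1r => <-; congr (Ds _ x _).
  by apply/funext => y; rewrite extd_in_skew mulN1r.
by move: C; rewrite E1 E2 addr0 => /eqP; rewrite subr_eq0 => /eqP ->; rewrite subrr.
Qed.

Lemma const_eval_derive a (Z : 'rV[R]_n -> 'rV[R]_n) (c : R) x w :
  form_on U a -> smooth_on U Z -> (forall y, U y -> a y (Z y) = c) -> U x ->
  a x (Dv Z x w) = - Ds (fun y => a y (Z x)) x w.
Proof.
move=> [l s] sZ K Ux; have E := Ds_apply oU w l s sZ Ux.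
have E0 : Ds (fun y => a y (Z y)) x w = 0.
  by rewrite -[RHS](Ds_cst c x w); apply: (Ds_eq oU).
by apply/eqP; rewrite -addr_eq0 addrC -E E0.
Qed.

Lemma eval_lie a (c1 c2 : R) x : form_on U a -> U x ->
  (forall y, U y -> a y (Z1 y) = c1) -> (forall y, U y -> a y (Z2 y) = c2) ->
  extd_in a x (Z1 x) (Z2 x) = 0 -> a x (lie_in Z1 Z2 x) = 0.
Proof.
move=> fa Ux k1 k2 K; rewrite /lie_in (scalarB (fa.1 _ Ux)).
rewrite (const_eval_derive _ fa sZ2 k2) // (const_eval_derive _ fa sZ1 k1) //.
move: K; rewrite /extd_in => /eqP; rewrite mulf_eq0 invr_eq0 pnatr_eq0 /=.
by rewrite subr_eq0 => /eqP ->; rewrite opprK addNr.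
Qed.

Variables (a1 a2 : 'rV[R]_n -> 'rV[R]_n -> R).
Hypotheses (fa1 : form_on U a1) (fa2 : form_on U a2).
Hypotheses (a11 : forall y, U y -> a1 y (Z1 y) = 1)
  (a12 : forall y, U y -> a1 y (Z2 y) = 0)
  (a21 : forall y, U y -> a2 y (Z1 y) = 0)
  (a22 : forall y, U y -> a2 y (Z2 y) = 1).
Hypotheses (K11 : forall y w, U y -> extd_in a1 y (Z1 y) w = 0)
  (K12 : forall y w, U y -> extd_in a1 y (Z2 y) w = 0)
  (K21 : forall y w, U y -> extd_in a2 y (Z1 y) w = 0)
  (K22 : forall y w, U y -> extd_in a2 y (Z2 y) w = 0).

(** The quarter turn of the plane spanned by the frame, zero on the kernel of both
    forms. *)
Definition frame_rotation x u := - (a2 x u *: Z1 x) + a1 x u *: Z2 x.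

Lemma frame_rotation_endo : endo_on U frame_rotation.
Proof.
split=> [x Ux c u v|u]; rewrite /frame_rotation.
  by rewrite (fa1.1 _ Ux) (fa2.1 _ Ux); apply/rowP => j; rewrite !mxE; ring.
apply: (smoothD oU); last exact: (smoothZ oU (fa1.2 u)).
have := smoothZ oU (smooth_cst (-1 : R)) (smoothZ oU (fa2.2 u) sZ1).
by apply: (smooth_eq oU) => y _; rewrite scaleN1r.
Qed.

(** The derivatives of the frame fields enter through the values of the forms on
    them, which are minus derivatives of the forms, and through their bracket. *)
Lemma frame_rotation_torsion x u v : U x -> lie_in Z1 Z2 x = 0 ->
  torsion frame_rotation x u v =
  (2 * extd_in a1 x u v) *: Z1 x + (2 * extd_in a2 x u v) *: Z2 x.
Proof.
move=> Ux /eqP; rewrite subr_eq0 => /eqP comm.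
have [l1 s1] := fa1; have [l2 s2] := fa2.
have DP w t : Dv (fun y => frame_rotation y w) x t =
    - (Ds (fun y => a2 y w) x t *: Z1 x + a2 x w *: Dv Z1 x t)
    + (Ds (fun y => a1 y w) x t *: Z2 x + a1 x w *: Dv Z2 x t).
  have sA := smoothZ oU (smooth_cst (-1 : R)) (smoothZ oU (s2 w) sZ1).
  have sB := smoothZ oU (s1 w) sZ2.
  have <- := DvZ oU t (s1 w) sZ2 Ux.
  have <- := DvZ oU t (s2 w) sZ1 Ux.
  have := DvZ oU t (smooth_cst (-1 : R)) (smoothZ oU (s2 w) sZ1) Ux.
  rewrite Ds_cst scale0r add0r scaleN1r => <-.
  rewrite -(DvD t sA sB Ux); congr (Dv _ x t).
  by apply/funext => y; rewrite scaleN1r.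
have sym (a : 'rV[R]_n -> 'rV[R]_n -> R) (Z : 'rV[R]_n -> 'rV[R]_n) w :
    extd_in a x (Z x) w = 0 ->
    Ds (fun y => a y w) x (Z x) = Ds (fun y => a y (Z x)) x w.
  rewrite /extd_in => /eqP; rewrite mulf_eq0 invr_eq0 pnatr_eq0 /=.
  by rewrite subr_eq0 => /eqP ->.
have c11 w := const_eval_derive w fa1 sZ1 a11 Ux.
have c12 w := const_eval_derive w fa1 sZ2 a12 Ux.
have c21 w := const_eval_derive w fa2 sZ1 a21 Ux.
have c22 w := const_eval_derive w fa2 sZ2 a22 Ux.
have d11 w := sym a1 Z1 w (K11 w Ux).
have d12 w := sym a1 Z2 w (K12 w Ux).
have d21 w := sym a2 Z1 w (K21 w Ux).
have d22 w := sym a2 Z2 w (K22 w Ux).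
have lD1 w : scalar (Ds (fun y => a1 y w) x) by exact: Ds_scalar (s1 w) Ux.
have lD2 w : scalar (Ds (fun y => a2 y w) x) by exact: Ds_scalar (s2 w) Ux.
have lZ1 : linear (Dv Z1 x) by exact: Dv_linear sZ1 Ux.
have lZ2 : linear (Dv Z2 x) by exact: Dv_linear sZ2 Ux.
have b1 := l1 _ Ux; have b2 := l2 _ Ux.
have half (e : R) : 2 * (2^-1 * e) = e by rewrite mulrA divff ?mul1r // pnatr_eq0.
rewrite /torsion !DP /frame_rotation.
rewrite !(linD lZ1) !(linD lZ2) !(linN lZ1) !(linN lZ2) !(linZ _ _ lZ1) !(linZ _ _ lZ2).
rewrite !(scalarD (lD1 _)) !(scalarD (lD2 _)) !(scalarN (lD1 _)) !(scalarN (lD2 _)).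
rewrite !(scalarZ _ _ (lD1 _)) !(scalarZ _ _ (lD2 _)).
rewrite !(scalarB b1) !(scalarB b2) !(scalarD b1) !(scalarD b2) !(scalarN b1) !(scalarN b2).
rewrite !(scalarD b1) !(scalarD b2) !(scalarZ _ _ b1) !(scalarZ _ _ b2).
rewrite !a11 ?a12 ?a21 ?a22 // !c11 !c12 !c21 !c22 !d11 !d12 !d21 !d22 !comm.
rewrite /extd_in !half.
by apply/rowP => j; rewrite !mxE; ring.
Qed.

(** The bracket is annihilated by a1 and a2 because these are constant on the
    frame, and by da1 and da2 because these are closed. *)
Lemma frame_commute x : U x ->
  (forall w, a1 x w = 0 -> a2 x w = 0 ->
     (forall v, extd_in a1 x w v + extd_in a2 x w v = 0) -> w = 0) ->
  lie_in Z1 Z2 x = 0.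
Proof.
move=> Ux; apply.
- by apply: eval_lie a11 a12 _ => //; exact: K11.
- by apply: eval_lie a21 a22 _ => //; exact: K21.
- by move=> v; rewrite !kernel_lie // addr0.
Qed.

End ReebCommute.
End Torsion.

(** * Tensor fields in charts *)

Section Charts.
Context (R : realType) (n : nat) (M : manifold R n).
Implicit Types (p q r : M).

Definition cimg q (W : set M) : set 'rV[R]_n :=
  coord (chart_at q) @` (dom (chart_at q) `&` W).

Lemma cimgP q (W : set M) x : cimg q W x <->
  [/\ dom (chart_at q) (icoord (chart_at q) x), W (icoord (chart_at q) x) &
      coord (chart_at q) (icoord (chart_at q) x) = x].
Proof.
split=> [[p [dp Wp] <-]|[dx Wx e]]; first by rewrite (coordK dp).
by exists (icoord (chart_at q) x).
Qed.

Lemma cimg_coord q (W : set M) p : dom (chart_at q) p -> W p ->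
  cimg q W (coord (chart_at q) p).
Proof. by move=> dp Wp; exists p. Qed.

Lemma cimg_open q (W : set M) : open W -> open (cimg q W).
Proof.
move=> oW; rewrite openE => x [p [dp Wp] <-]; rewrite /interior.
have ip : (coord (chart_at q) @` dom (chart_at q)) (coord (chart_at q) p).
  by exists p.
have c := icoord_cts ip.
have n1 : nbhs (coord (chart_at q) p) (coord (chart_at q) @` dom (chart_at q)).
  by apply: open_nbhs_nbhs; split=> //; exact: coord_open.
have n2 : nbhs (coord (chart_at q) p) (icoord (chart_at q) @^-1` W).
  apply: c; rewrite coordK //; exact: open_nbhs_nbhs (conj oW Wp).
apply: filterS2 n1 n2 => y [p' dp' <-] /= Wy.
by rewrite coordK // in Wy; exists p'.
Qed.

End Charts.

Section Maps.
Context (R : realType) (m n : nat) (N : manifold R m) (M : manifold R n).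
Variable F : N -> M.

Definition rep (q : N) (r : M) : 'rV[R]_m -> 'rV[R]_n :=
  coord (chart_at r) \o F \o icoord (chart_at q).

(** The differential of [F] at [p], read in the charts at [q] and [r].  Both
    [tmap] and, for the identity map, the coordinate changes [to_chart] and
    [of_chart] are instances, so that one chain rule covers all of them. *)
Definition dmap (q : N) (r : M) (p : N) : 'rV[R]_m -> 'rV[R]_n :=
  Dv (rep q r) (coord (chart_at q) p).

Definition repdom (q : N) (r : M) := cimg q (F @^-1` dom (chart_at r)).

Hypothesis smF : smooth_map F.

Lemma preimage_open (W : set M) : open W -> open (F @^-1` W).
Proof. by have [cF _] := smF; have /continuousP := cF; apply. Qed.

Lemma repdom_open q r : open (repdom q r).
Proof. by apply/cimg_open/preimage_open/dom_open. Qed.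

Lemma rep_smooth q r : smooth_on (repdom q r) (rep q r).
Proof. by have [_] := smF; apply. Qed.
Arguments rep_smooth : clear implicits.

Lemma dmap_linear q r p : dom (chart_at q) p -> dom (chart_at r) (F p) ->
  linear (dmap q r p).
Proof.
move=> dp dFp; have V : repdom q r (coord (chart_at q) p) by exact: cimg_coord.
exact: (Dv_linear (rep_smooth q r) V).
Qed.

Lemma tmapE p : tmap F p = dmap p (F p) p.
Proof.
apply/funext => u; rewrite /dmap Dv.unlock deriveE //.
have V : repdom p (F p) (coord (chart_at p) p).
  by apply: cimg_coord; exact: chart_at_dom.
exact: (smooth_diff (rep_smooth p (F p)) V).
Qed.

End Maps.
Arguments rep_smooth {R m n N M F} smF q r.
Arguments repdom_open {R m n N M F} smF q r.

Lemma smooth_map_id (R : realType) n (M : manifold R n) : smooth_map (@id M).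
Proof.
split; first by move=> x; exact: cvg_id.
by move=> p q; exact: chart_at_compat.
Qed.

Lemma dmap_comp (R : realType) l m n (P : manifold R l) (N : manifold R m)
    (M : manifold R n) (G : P -> N) (F : N -> M) (q : P) (r : N) (s : M) (p : P) u :
  smooth_map G -> smooth_map F -> dom (chart_at q) p ->
  dom (chart_at r) (G p) -> dom (chart_at s) (F (G p)) ->
  dmap (F \o G) q s p u = dmap F r s (G p) (dmap G q r p u).
Proof.
move=> sG sF dp dG dF.
pose W : set P := G @^-1` (dom (chart_at r) `&` F @^-1` dom (chart_at s)).
have oW : open W.
  apply: (preimage_open sG); apply: openI; first exact: dom_open.
  exact/(preimage_open sF)/dom_open.
pose V := cimg q W; have oV : open V by exact: cimg_open.
have Vp : V (coord (chart_at q) p) by exact: cimg_coord.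
have sub1 x : V x -> repdom F r s (rep G q r x).
  by move=> /cimgP[_ [d1 d2] _]; exact: cimg_coord.
have sub2 x : V x -> repdom G q r x.
  by move=> /cimgP[d1 [d2 _] e]; apply/cimgP.
have sGV : smooth_on V (rep G q r) by exact: smooth_sub sub2 (rep_smooth sG q r).
have E x : V x -> rep (F \o G) q s x = rep F r s (rep G q r x).
  by move=> /cimgP[_ [d1 _] _]; rewrite /rep /= (coordK d1).
rewrite /dmap (Dv_eq oV _ E Vp) (Dv_comp sub1 sGV u (rep_smooth sF r s) Vp).
by rewrite /rep /= (coordK dp).
Qed.

Section ChartChange.
Context (R : realType) (n : nat) (M : manifold R n).
Implicit Types (p q r : M).

Let sid := smooth_map_id M.

Lemma dmap_id q p u : dom (chart_at q) p -> dmap (@id M) q q p u = u.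
Proof.
move=> dp; have oV : open (coord (chart_at q) @` dom (chart_at q)) by exact: coord_open.
have Vp : (coord (chart_at q) @` dom (chart_at q)) (coord (chart_at q) p) by exists p.
rewrite /dmap (Dv_eq oV (g := id) _ _ Vp); first by rewrite Dv.unlock; exact: derive_id.
by move=> x [p' dp' <-]; rewrite /rep /= coordK.
Qed.

Lemma to_chartE q p : dom (chart_at q) p ->
  to_chart (chart_at q) p = dmap (@id M) p q p.
Proof.
move=> dp; apply/funext => u; rewrite /dmap Dv.unlock deriveE //.
have V : repdom (@id M) p q (coord (chart_at p) p).
  by apply: cimg_coord => //; exact: chart_at_dom.
exact: (smooth_diff (rep_smooth sid p q) V).
Qed.

Lemma of_chartE q p : dom (chart_at q) p ->
  of_chart (chart_at q) p = dmap (@id M) q p p.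
Proof.
move=> dp; apply/funext => u; rewrite /dmap Dv.unlock deriveE //.
have V : repdom (@id M) q p (coord (chart_at q) p).
  by apply: cimg_coord => //; exact: chart_at_dom.
exact: (smooth_diff (rep_smooth sid q p) V).
Qed.

Lemma of_chart_linear q p : dom (chart_at q) p ->
  linear (of_chart (chart_at q) p).
Proof. by move=> dp; rewrite of_chartE //; apply: dmap_linear => //; exact: chart_at_dom. Qed.

Lemma to_chart_linear q p : dom (chart_at q) p ->
  linear (to_chart (chart_at q) p).
Proof. by move=> dp; rewrite to_chartE //; apply: dmap_linear => //; exact: chart_at_dom. Qed.

Lemma to_chartK q p : dom (chart_at q) p ->
  cancel (to_chart (chart_at q) p) (of_chart (chart_at q) p).
Proof.
move=> dp u; have dpp := chart_at_dom p.
by rewrite to_chartE // of_chartE // -(dmap_comp (r := q) u sid sid) // dmap_id.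
Qed.

Lemma of_chartK q p : dom (chart_at q) p ->
  cancel (of_chart (chart_at q) p) (to_chart (chart_at q) p).
Proof.
move=> dp u; have dpp := chart_at_dom p.
by rewrite to_chartE // of_chartE // -(dmap_comp (r := p) u sid sid) // dmap_id.
Qed.

Lemma to_chart_id p u : to_chart (chart_at p) p u = u.
Proof. by have dpp := chart_at_dom p; rewrite to_chartE // dmap_id. Qed.

Lemma of_chart_id p u : of_chart (chart_at p) p u = u.
Proof. by have dpp := chart_at_dom p; rewrite of_chartE // dmap_id. Qed.

End ChartChange.

Section Naturality.
Context (R : realType) (m n : nat) (N : manifold R m) (M : manifold R n).
Variable F : N -> M.
Hypothesis smF : smooth_map F.
Implicit Types (p q : N) (r : M).

Let sidN := smooth_map_id N.
Let sidM := smooth_map_id M.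

Lemma tmap_linear p : linear (tmap F p).
Proof. by rewrite tmapE //; apply: dmap_linear => //; exact: chart_at_dom. Qed.

Lemma tmap_of_chart q r p u : dom (chart_at q) p -> dom (chart_at r) (F p) ->
  tmap F p (of_chart (chart_at q) p u) =
  of_chart (chart_at r) (F p) (dmap F q r p u).
Proof.
move=> dp dF; have dpp := chart_at_dom p; have dFF := chart_at_dom (F p).
rewrite tmapE // !of_chartE // -(dmap_comp (r := p) u sidN smF) //.
by rewrite -(dmap_comp (r := r) u smF sidM).
Qed.

Lemma tmap_to_chart q r p u : dom (chart_at q) p -> dom (chart_at r) (F p) ->
  to_chart (chart_at r) (F p) (tmap F p u) =
  dmap F q r p (to_chart (chart_at q) p u).
Proof.
move=> dp dF; rewrite -{1}(to_chartK dp u) (tmap_of_chart _ dp dF).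
by rewrite of_chartK.
Qed.

Lemma repdom_sub q r : repdom F q r `<=` coord (chart_at q) @` dom (chart_at q).
Proof. by move=> x [p [dp _] <-]; exists p. Qed.

Lemma rep_img q r x : repdom F q r x ->
  (coord (chart_at r) @` dom (chart_at r)) (rep F q r x).
Proof. by move=> /cimgP[_ d _]; exists (F (icoord (chart_at q) x)). Qed.

Lemma field1_in_pull a q r x u : repdom F q r x ->
  field1_in (chart_at q) (pull1 F a) x u =
  field1_in (chart_at r) a (rep F q r x) (Dv (rep F q r) x u).
Proof.
move=> /cimgP[d1 d2 e]; rewrite /field1_in /pull1 (tmap_of_chart u d1 d2).
by rewrite /rep /= (coordK d2) /dmap e.
Qed.

Lemma field2_in_pull g q r x u v : repdom F q r x ->
  field2_in (chart_at q) (pull2 F g) x u v =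
  field2_in (chart_at r) g (rep F q r x) (Dv (rep F q r) x u) (Dv (rep F q r) x v).
Proof.
move=> /cimgP[d1 d2 e]; rewrite /field2_in /pull2.
rewrite (tmap_of_chart u d1 d2) (tmap_of_chart v d1 d2).
by rewrite /rep /= (coordK d2) /dmap e.
Qed.

Lemma field11_in_restricts A AN q r x u : restricts11 F A AN -> repdom F q r x ->
  field11_in (chart_at r) A (rep F q r x) (Dv (rep F q r) x u) =
  Dv (rep F q r) x (field11_in (chart_at q) AN x u).
Proof.
move=> res /cimgP[d1 d2 e]; rewrite /field11_in [rep F q r x]/rep /=.
have -> : Dv (rep F q r) x = dmap F q r (icoord (chart_at q) x) by rewrite /dmap e.
by rewrite (coordK d2) -(tmap_of_chart u d1 d2) -(tmap_to_chart _ d1 d2) res.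
Qed.

End Naturality.

(** * Metric duals, exterior derivative and torsion on manifolds *)

Section Gram.
Context (R : realType) (n : nat) (g : 'rV[R]_n -> 'rV[R]_n -> R).
Hypothesis gr : forall u, scalar (g u).
Hypothesis gl : forall v, scalar (fun u => g u v).
Hypothesis gpos : forall u, u != 0 -> 0 < g u u.

Definition gram : 'M[R]_n := \matrix_(i, j) g (delta_mx 0 i) (delta_mx 0 j).

Lemma mul_gram w j : (w *m gram) 0 j = g w (delta_mx 0 j).
Proof.
rewrite mxE (scalar_sum (L := fun u => g u (delta_mx 0 j)) w (gl _)).
by apply: eq_bigr => i _; rewrite mxE.
Qed.

Lemma gram_unit : gram \in unitmx.
Proof.
rewrite -row_free_unit -kermx_eq0; apply/eqP/row_matrixP => i.
rewrite row0; apply/eqP/negPn/negP => /gpos.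
set w := row i _; have w0 : w *m gram = 0 by rewrite /w -row_mul mulmx_ker row0.
rewrite (scalar_sum w (gr w)) big1 ?ltxx // => j _.
by rewrite -mul_gram w0 [X in _ * X]mxE mulr0.
Qed.

Lemma riesz_representation (c : 'rV[R]_n -> R) : scalar c ->
  exists t, forall u, g t u = c u.
Proof.
move=> sc; pose cv : 'rV[R]_n := \row_j c (delta_mx 0 j).
exists (cv *m invmx gram) => u.
rewrite (scalar_sum u (gr _)) (scalar_sum u sc); apply: eq_bigr => j _.
by rewrite -mul_gram mulmxKV ?gram_unit // mxE.
Qed.

End Gram.

Section Congruence.
Context (R : realType) (n : nat) (U : set 'rV[R]_n).
Hypothesis oU : open U.

Lemma extd_in_eq (a b : 'rV[R]_n -> 'rV[R]_n -> R) x u v :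
  (forall y w, U y -> a y w = b y w) -> U x -> extd_in a x u v = extd_in b x u v.
Proof.
move=> ab Ux; rewrite /extd_in.
have E w t : Ds (fun y => a y w) x t = Ds (fun y => b y w) x t.
  by apply: (Ds_eq oU) => // y; exact: ab.
by rewrite !E.
Qed.

Lemma torsion_eq (A B : 'rV[R]_n -> 'rV[R]_n -> 'rV[R]_n) x u v :
  (forall y w, U y -> A y w = B y w) -> U x -> torsion A x u v = torsion B x u v.
Proof.
move=> ab Ux; rewrite /torsion.
have E w t : Dv (fun y => A y w) x t = Dv (fun y => B y w) x t.
  by apply: (Dv_eq oU) => // y; exact: ab.
by rewrite !E !ab.
Qed.

(** A field is recovered from its metric dual by the inverse Gram matrix, whose
    entries are quotients of polynomials in those of the metric. *)
Lemma smooth_metric_dual (g : 'rV[R]_n -> 'rV[R]_n -> 'rV[R]_n -> R)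
    (T : 'rV[R]_n -> 'rV[R]_n) :
  (forall x u, U x -> scalar (g x u)) ->
  (forall x v, U x -> scalar (fun u => g x u v)) ->
  (forall x u, U x -> u != 0 -> 0 < g x u u) ->
  (forall u v, smooth_on U (fun x => g x u v)) ->
  (forall u, smooth_on U (fun x => g x (T x) u)) ->
  smooth_on U T.
Proof.
move=> linr linl gpos smg smT.
pose e j : 'rV[R]_n := delta_mx 0 j.
pose G x := gram (g x).
pose c x : 'rV[R]_n := \row_j g x (T x) (e j).
have gE x w j : U x -> (w *m G x) 0 j = g x w (e j).
  by move=> Ux; apply: mul_gram => v; exact: linl.
have Gu x : U x -> G x \in unitmx.
  by move=> Ux; apply: gram_unit => // [u|v|u]; [exact: linr|exact: linl|exact: gpos].
have smdet (k : nat) (B : 'rV[R]_n -> 'M[R]_k) :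
    (forall i j, smooth_on U (fun x => B x i j)) -> smooth_on U (fun x => \det (B x)).
  move=> sB; apply: (smooth_sum oU) => s; apply: (smoothM oU); first exact: smooth_cst.
  by apply: (smooth_prod oU) => i; exact: sB.
have smG i j : smooth_on U (fun x => G x i j).
  by apply: (smooth_eq oU) (smg (e i) (e j)) => x _; rewrite mxE.
apply: (smooth_eq oU (f := fun x => (\det (G x))^-1 *: (c x *m \adj (G x)))).
  move=> x Ux; have -> : c x = T x *m G x.
    by apply/rowP => j; rewrite mxE gE.
  rewrite -mulmxA mul_mx_adj mul_mx_scalar scalerA mulVr ?scale1r //.
  by have := Gu x Ux; rewrite unitmxE.
apply: (smoothZ oU).
  apply: (smoothV oU); last exact: smdet.
  by move=> x Ux; rewrite -unitfE -unitmxE Gu.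
apply/(smooth_rV oU) => j.
apply: (smooth_eq oU (f := fun x => \sum_k g x (T x) (e k) * cofactor (G x) j k)).
  by move=> x _; rewrite mxE; apply: eq_bigr => k _; rewrite !mxE.
apply: (smooth_sum oU) => k; apply: (smoothM oU) => //.
apply: (smoothM oU); first exact: smooth_cst.
apply: smdet => i l; apply: (smooth_eq oU) (smG (lift j i) (lift k l)) => x _.
by rewrite !mxE.
Qed.

End Congruence.

Section Fields.
Context (R : realType) (n : nat) (M : manifold R n).
Implicit Types (p q r : M) (a : field1 M) (A : field11 M) (X Y : vfield M).

Let sid := smooth_map_id M.

Definition chart_img q : set 'rV[R]_n := coord (chart_at q) @` dom (chart_at q).

Lemma open_chart_img q : open (chart_img q).
Proof. exact: coord_open. Qed.

Lemma chart_img_coord q p : dom (chart_at q) p -> chart_img q (coord (chart_at q) p).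
Proof. by exists p. Qed.

Lemma chart_img_center p : chart_img p (coord (chart_at p) p).
Proof. exact/chart_img_coord/chart_at_dom. Qed.

Lemma chart_img_dom q x : chart_img q x -> dom (chart_at q) (icoord (chart_at q) x).
Proof. by move=> [p dp <-]; rewrite coordK. Qed.

Lemma icoordK q x : chart_img q x -> coord (chart_at q) (icoord (chart_at q) x) = x.
Proof. by move=> [p dp <-]; rewrite coordK. Qed.

Lemma icoord_center p : icoord (chart_at p) (coord (chart_at p) p) = p.
Proof. by rewrite coordK //; exact: chart_at_dom. Qed.

Lemma field1_in_center a p u :
  field1_in (chart_at p) a (coord (chart_at p) p) u = a p u.
Proof. by rewrite /field1_in icoord_center of_chart_id. Qed.

Lemma field11_in_center A p u :
  field11_in (chart_at p) A (coord (chart_at p) p) u = A p u.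
Proof. by rewrite /field11_in icoord_center of_chart_id to_chart_id. Qed.

Lemma vfield_in_center X p : vfield_in (chart_at p) X (coord (chart_at p) p) = X p.
Proof. by rewrite /vfield_in icoord_center to_chart_id. Qed.

Lemma one_form_on a q : one_form a ->
  form_on (chart_img q) (field1_in (chart_at q) a).
Proof.
move=> [lin sm]; split=> [x Ux c u v|u]; last exact: sm.
by rewrite /field1_in (of_chart_linear (chart_img_dom Ux)) lin.
Qed.

Lemma tensor11_on A q : tensor11 A ->
  endo_on (chart_img q) (field11_in (chart_at q) A).
Proof.
move=> [lin sm]; split=> [x Ux c u v|u]; last exact: sm.
have d := chart_img_dom Ux.
by rewrite /field11_in (of_chart_linear d) lin (to_chart_linear d).
Qed.

Lemma smooth_vfield_in X q : smooth_vfield X ->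
  smooth_on (chart_img q) (vfield_in (chart_at q) X).
Proof. by move=> /(_ q); rewrite setIT. Qed.

Lemma field1_in_app a X q x : chart_img q x ->
  field1_in (chart_at q) a x (vfield_in (chart_at q) X x) =
  a (icoord (chart_at q) x) (X (icoord (chart_at q) x)).
Proof.
by move=> Ux; rewrite /field1_in /vfield_in (to_chartK (chart_img_dom Ux)).
Qed.

Lemma vfield_in_app A X q x : chart_img q x ->
  vfield_in (chart_at q) (app11 A X) x =
  field11_in (chart_at q) A x (vfield_in (chart_at q) X x).
Proof.
by move=> Ux; rewrite /field11_in /vfield_in (to_chartK (chart_img_dom Ux)).
Qed.

Lemma smooth_vfield_dual (g : field2 M) X : riemannian_metric g ->
  (forall q u, smooth_on (chart_img q)
     (fun x => field2_in (chart_at q) g x (vfield_in (chart_at q) X x) u)) ->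
  smooth_vfield X.
Proof.
move=> hg sm q; rewrite setIT.
have ofl x (Ux : chart_img q x) := of_chart_linear (chart_img_dom Ux).
apply: (@smooth_metric_dual _ _ _ (@open_chart_img q) (field2_in (chart_at q) g)).
- by move=> x u Ux c v w; rewrite /field2_in ofl // (metric_scalar hg).
- move=> x v Ux c u w; rewrite /field2_in !(metric_sym hg _ _ (of_chart _ _ v)).
  by rewrite ofl // (metric_scalar hg).
- move=> x u Ux u0; apply: (metric_pos hg).
  apply: contraNneq u0 => e; rewrite -(of_chartK (chart_img_dom Ux) u) e.
  by rewrite (lin0 (to_chart_linear (chart_img_dom Ux))).
- by move=> u v; exact: (metric_smooth hg).
- exact: sm.
Qed.

Lemma smooth_vfield_sharp (g : field2 M) a X : riemannian_metric g ->
  one_form a -> (forall p u, g p (X p) u = a p u) -> smooth_vfield X.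
Proof.
move=> hg ha gX; apply: (smooth_vfield_dual hg) => q u.
apply: (smooth_eq (@open_chart_img q)) ((one_form_on q ha).2 u) => x Ux.
by rewrite /field2_in /vfield_in (to_chartK (chart_img_dom Ux)) gX.
Qed.

Lemma tensor11_dual (g B : field2 M) A : riemannian_metric g ->
  (forall p, linear (A p)) -> (forall p u v, g p (A p u) v = B p u v) ->
  (forall q u v, smooth_on (chart_img q)
     (fun x => field2_in (chart_at q) B x u v)) -> tensor11 A.
Proof.
move=> hg lA gA sB; split=> // q u.
have ofl x (Ux : chart_img q x) := of_chart_linear (chart_img_dom Ux).
apply: (@smooth_metric_dual _ _ _ (@open_chart_img q) (field2_in (chart_at q) g)).
- by move=> x w Ux c v t; rewrite /field2_in ofl // (metric_scalar hg).
- move=> x v Ux c w t; rewrite /field2_in !(metric_sym hg _ _ (of_chart _ _ v)).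
  by rewrite ofl // (metric_scalar hg).
- move=> x w Ux w0; apply: (metric_pos hg).
  apply: contraNneq w0 => e; rewrite -(of_chartK (chart_img_dom Ux) w) e.
  by rewrite (lin0 (to_chart_linear (chart_img_dom Ux))).
- by move=> w v; exact: (metric_smooth hg).
- move=> v; apply: (smooth_eq (@open_chart_img q)) (sB q u v) => x Ux.
  by rewrite /field2_in /field11_in (to_chartK (chart_img_dom Ux)) gA.
Qed.

Lemma extdE a p u v :
  extd a p u v = extd_in (field1_in (chart_at p) a) (coord (chart_at p) p) u v.
Proof. by rewrite /extd_in Ds.unlock. Qed.

Lemma nijenhuisE A X Y (U : set M) p : tensor11 A -> open U ->
  smooth_vfield_on U X -> smooth_vfield_on U Y -> U p ->
  nijenhuis A X Y p =
  torsion (field11_in (chart_at p) A) (coord (chart_at p) p) (X p) (Y p).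
Proof.
move=> tA oU sX sY Up.
have oV : open (cimg p U) by exact: cimg_open.
have Vp : cimg p U (coord (chart_at p) p).
  by apply: cimg_coord => //; exact: chart_at_dom.
have sub x : cimg p U x -> chart_img p x by move=> [p' [d' _] <-]; exists p'.
have [lA sA] := tensor11_on p tA.
have eA : endo_on (cimg p U) (field11_in (chart_at p) A).
  by split=> [x /sub|u]; [exact: lA|exact: smooth_sub sub (sA u)].
have lieE (Z W : vfield M) :
    lie Z W p = lie_in (vfield_in (chart_at p) Z) (vfield_in (chart_at p) W)
      (coord (chart_at p) p).
  by rewrite /lie_in !vfield_in_center Dv.unlock.
have T := torsion_fields oV eA (sX p) (sY p) Vp.
rewrite !vfield_in_center !field11_in_center in T.
rewrite -T /nijenhuis !lieE.
have E Z y : cimg p U y -> vfield_in (chart_at p) (app11 A Z) y =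
    field11_in (chart_at p) A y (vfield_in (chart_at p) Z y).
  by move=> /sub; exact: vfield_in_app.
have L (Z Z' W W' : 'rV[R]_n -> 'rV[R]_n) :
    (forall y, cimg p U y -> Z y = Z' y) -> (forall y, cimg p U y -> W y = W' y) ->
    lie_in Z W (coord (chart_at p) p) = lie_in Z' W' (coord (chart_at p) p).
  move=> ZZ WW; rewrite /lie_in !ZZ // !WW //.
  by rewrite (Dv_eq oV _ ZZ Vp) (Dv_eq oV _ WW Vp).
by rewrite (L _ _ _ _ (E X) (E Y)) (L _ _ _ _ (E X) (fun _ _ => erefl))
  (L _ _ _ _ (fun _ _ => erefl) (E Y)).
Qed.

(** The field with constant components in the chart at [q] extends any tangent
    vector to a local field. *)
Lemma const_field_smooth q u :
  smooth_vfield_on (dom (chart_at q)) (fun p => of_chart (chart_at q) p u).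
Proof.
move=> r; pose V := repdom (@id M) r q.
have oV : open V := repdom_open sid r q.
apply: (smooth_eq oV (f := fun x => Dv (rep (@id M) q r) (rep (@id M) r q x) u)).
  move=> x /cimgP[d1 d2 _]; have dpp := chart_at_dom (icoord (chart_at r) x).
  rewrite /vfield_in to_chartE // of_chartE //.
  by rewrite -(dmap_comp (r := icoord (chart_at r) x) u sid sid).
have sU x : V x -> repdom (@id M) q r (rep (@id M) r q x).
  by move=> /cimgP[d1 d2 _]; apply: cimg_coord.
exact: (smooth_comp_rV oV (repdom_open sid q r) sU (rep_smooth sid r q)
  (smooth_Dv u (rep_smooth sid q r))).
Qed.

Lemma integrable_torsion A p u v : tensor11 A -> integrable_acs A ->
  torsion (field11_in (chart_at p) A) (coord (chart_at p) p) u v = 0.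
Proof.
move=> tA iA; have su := @const_field_smooth p u; have sv := @const_field_smooth p v.
have := iA _ _ _ (dom_open (chart_at p)) su sv p (chart_at_dom p).
rewrite (nijenhuisE tA (dom_open (chart_at p)) su sv (chart_at_dom p)).
by rewrite !of_chart_id.
Qed.

End Fields.

Section Submanifold.
Context (R : realType) (m n : nat) (N : manifold R m) (M : manifold R n).
Variable F : N -> M.
Hypothesis smF : smooth_map F.
Implicit Types (p q : N) (r : M).

Lemma repdom_center p : repdom F p (F p) (coord (chart_at p) p).
Proof. by apply: cimg_coord; exact: chart_at_dom. Qed.

Lemma Dv_rep_center p u :
  Dv (rep F p (F p)) (coord (chart_at p) p) u = tmap F p u.
Proof. by rewrite tmapE. Qed.

Lemma rep_center p : rep F p (F p) (coord (chart_at p) p) = coord (chart_at (F p)) (F p).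
Proof. by rewrite /rep /= icoord_center. Qed.

(** [extd] at [p] is computed in the chart preferred at [p]; differentiating a
    relation between forms needs it at all points near a given one, in one
    fixed chart. *)
Lemma extd_in_chart (q p : M) a u v : one_form a -> dom (chart_at q) p ->
  extd_in (field1_in (chart_at q) a) (coord (chart_at q) p) u v =
  extd a p (of_chart (chart_at q) p u) (of_chart (chart_at q) p v).
Proof.
move=> ha dp; have sid := smooth_map_id M; have oV := repdom_open sid q p.
have Vp : repdom (@id M) q p (coord (chart_at q) p).
  by apply: cimg_coord => //; exact: chart_at_dom.
have pid : pull1 (@id M) a = a.
  apply/funext => p'; apply/funext => w.
  by rewrite /pull1 tmapE // dmap_id //; exact: chart_at_dom.
have E := @field1_in_pull _ _ _ M M (@id M) sid a q p; rewrite pid in E.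
rewrite (extd_in_eq oV u v (fun y w => E y w) Vp).
rewrite (extd_pull oV (@rep_img _ _ _ _ _ (@id M) q p) (rep_smooth sid q p) u v
  (one_form_on p ha) Vp).
by rewrite extdE !of_chartE // /dmap /rep /= coordK.
Qed.

Lemma extd_pull1 a p u v : one_form a ->
  extd (pull1 F a) p u v = extd a (F p) (tmap F p u) (tmap F p v).
Proof.
move=> ha; have oV := repdom_open smF p (F p); have Vp := repdom_center p.
rewrite !extdE (extd_in_eq oV u v (fun y w => @field1_in_pull _ _ _ _ _ _ smF a p (F p) y w) Vp).
rewrite (extd_pull oV (@rep_img _ _ _ _ _ F p (F p)) (rep_smooth smF p (F p)) u v
  (one_form_on (F p) ha) Vp).
by rewrite !Dv_rep_center rep_center.
Qed.

Lemma one_form_pull1 a : one_form a -> one_form (pull1 F a).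
Proof.
move=> ha; split=> [p c u v|q u].
  by rewrite /pull1 (tmap_linear smF p) ha.1.
apply: smooth_local => x [p dp <-].
pose r := F p; exists (repdom F q r).
  by apply: cimg_coord => //; exact: chart_at_dom.
have oV := repdom_open smF q r.
have [_ s] := form_pull oV (@rep_img _ _ _ _ _ F q r) (rep_smooth smF q r) (one_form_on r ha).
by apply: (smooth_eq oV) (s u) => y Vy; apply: esym; exact: field1_in_pull.
Qed.

Lemma smooth_pull2 (B : field2 M) q u v :
  (forall r w, scalar (B r w)) -> (forall r w, scalar (fun t => B r t w)) ->
  (forall r w t, smooth_on (chart_img r) (fun x => field2_in (chart_at r) B x w t)) ->
  smooth_on (chart_img q) (fun x => field2_in (chart_at q) (pull2 F B) x u v).
Proof.
move=> Br Bl sB; apply: smooth_local => x [p dp <-].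
pose r := F p; exists (repdom F q r).
  by apply: cimg_coord => //; exact: chart_at_dom.
have oV := repdom_open smF q r.
have sD w : smooth_on (repdom F q r) (fun y => Dv (rep F q r) y w).
  by apply: smooth_Dv; exact: rep_smooth.
have ofl y : repdom F q r y -> linear (of_chart (chart_at r)
    (icoord (chart_at r) (rep F q r y))).
  by move=> /rep_img/chart_img_dom; exact: of_chart_linear.
apply: (smooth_eq oV (f := fun y => field2_in (chart_at r) B (rep F q r y)
    (Dv (rep F q r) y u) (Dv (rep F q r) y v))).
  by move=> y Vy; apply: esym; exact: field2_in_pull.
apply: (smooth_apply oV (L := fun y w => field2_in (chart_at r) B (rep F q r y) w
    (Dv (rep F q r) y v))).
- by move=> y Vy c w t; rewrite /field2_in ofl // Bl.
- move=> w; apply: (smooth_apply oV (L := fun y t => field2_in (chart_at r) B (rep F q r y) w t)).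
  + by move=> y Vy c t s; rewrite /field2_in ofl // Br.
  + move=> t; apply: (smooth_comp oV _ (rep_smooth smF q r) (sB r w t)).
    exact: rep_img.
  + exact: sD.
- exact: sD.
Qed.

Lemma torsion_restricts A AN p u v : tensor11 A -> tensor11 AN ->
  restricts11 F A AN ->
  tmap F p (torsion (field11_in (chart_at p) AN) (coord (chart_at p) p) u v) =
  torsion (field11_in (chart_at (F p)) A) (coord (chart_at (F p)) (F p))
    (tmap F p u) (tmap F p v).
Proof.
move=> tA tAN res; have oV := repdom_open smF p (F p); have Vp := repdom_center p.
have [lN sN] := tensor11_on p tAN.
have sub := @repdom_sub _ _ _ _ _ F p (F p).
have eN : endo_on (repdom F p (F p)) (field11_in (chart_at p) AN).
  by split=> [x /sub|w]; [exact: lN|exact: smooth_sub sub (sN w)].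
have := torsion_related oV (@open_chart_img _ _ _ (F p)) (@rep_img _ _ _ _ _ F p (F p))
  (rep_smooth smF p (F p)) u v eN (tensor11_on (F p) tA)
  (fun x w Vx => field11_in_restricts smF w res Vx) Vp.
by rewrite rep_center !Dv_rep_center => ->.
Qed.

Lemma riemannian_pull2 g : riemannian_metric g -> (forall p, injective (tmap F p)) ->
  riemannian_metric (pull2 F g).
Proof.
move=> hg inj; have gl r w : scalar (fun t => g r t w).
  by move=> c t s; rewrite !(metric_sym hg r _ w) (metric_scalar hg).
split.
- by move=> p u c v w; rewrite /pull2 (tmap_linear smF p) (metric_scalar hg).
- by move=> p u v; rewrite /pull2 (metric_sym hg).
- move=> p u u0; apply: (metric_pos hg); apply: contraNneq u0 => e.
  by apply/eqP/(inj p); rewrite e (lin0 (tmap_linear smF p)).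
- move=> q u v; apply: smooth_pull2 => //; first exact: (metric_scalar hg).
  by move=> r w t; exact: (metric_smooth hg).
Qed.

End Submanifold.

(** * Bases adapted to a skew endomorphism *)

(** The matrix of the standard symplectic form. *)
Definition pairing (R : realType) (i j : nat) : R :=
  (~~ odd i && (j == i.+1))%:R - (~~ odd j && (i == j.+1))%:R.

Section Orthonormal.
Context (R : realType) (m : nat) (G : 'rV[R]_m -> 'rV[R]_m -> R).
Hypothesis Gscalar : forall u, scalar (G u).
Hypothesis Gsym : forall u v, G u v = G v u.
Hypothesis Gpos : forall u, u != 0 -> 0 < G u u.

Let Gscalarl v : scalar (fun u => G u v).
Proof. by move=> c u w; rewrite !(Gsym _ v) Gscalar. Qed.

Let GZl a u v : G (a *: u) v = a * G u v.
Proof. by rewrite !(Gsym _ v) (scalarZ _ _ (Gscalar v)). Qed.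

Definition orthonormal (s : seq 'rV[R]_m) := forall i j : nat,
  (i < size s)%N -> (j < size s)%N -> G s`_i s`_j = (i == j)%:R.

Lemma orthonormal_rcons s x : orthonormal s -> G x x = 1 ->
  (forall y, y \in s -> G x y = 0) -> orthonormal (rcons s x).
Proof.
move=> os x1 xs i j; rewrite size_rcons !ltnS !nth_rcons => li lj.
case: (ltngtP i (size s)) li => [li _|//|ei _]; case: (ltngtP j (size s)) lj => [lj _|//|ej _].
- exact: os.
- by rewrite ej Gsym xs ?mem_nth // ltn_eqF.
- by rewrite ei xs ?mem_nth // gtn_eqF.
- by rewrite ei ej eqxx.
Qed.

Lemma orthonormal_size s : orthonormal s -> (size s <= m)%N.
Proof.
move=> os; pose E : 'M[R]_(size s, m) := \matrix_(i < size s) s`_i.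
suff : row_free E by rewrite /row_free => /eqP <-; exact: rank_leq_col.
rewrite -kermx_eq0; apply/eqP/row_matrixP => i; rewrite row0.
set w := row i _; have w0 : w *m E = 0 by rewrite /w -row_mul mulmx_ker row0.
apply/rowP => j; rewrite [RHS]mxE; clearbody w.
have : G s`_j (w *m E) = w 0 j.
  rewrite mulmx_sum_row.
  pose Gm := GRing.isLinear.Build _ _ _ _ _ (Gscalar s`_j).
  pose G' : {scalar 'rV[R]_m} := HB.pack (G s`_j) Gm.
  rewrite -[G _]/(G' : _ -> _) linear_sum (bigD1 j) //= big1 ?addr0 => [|k kj].
    by rewrite (scalarZ _ _ (Gscalar _)) rowK os // eqxx mulr1.
  rewrite (scalarZ _ _ (Gscalar _)) rowK os //.
  by rewrite (inj_eq val_inj) eq_sym (negbTE kj) mulr0.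
by rewrite w0 (scalar0 (Gscalar _)) => <-.
Qed.

Lemma orthogonal_unit s : (size s < m)%N ->
  exists2 x, G x x = 1 & forall y, y \in s -> G x y = 0.
Proof.
move=> sm.
pose C : 'M[R]_(m, size s) := \matrix_(i, l) G (delta_mx 0 i) s`_l.
have /rowV0Pn[x /sub_kermxP xC x0] : kermx C != 0.
  rewrite kermx_eq0 /row_free; apply: contraTneq sm => e.
  by rewrite -leqNgt -{1}e; exact: rank_leq_col.
have xs y : y \in s -> G x y = 0.
  move=> ys; have li : (index y s < size s)%N by rewrite index_mem.
  have e : (x *m C) 0 (Ordinal li) = 0 by rewrite xC mxE.
  rewrite -e mxE (scalar_sum (L := fun w => G w y) x (Gscalarl y)).
  by apply: eq_bigr => i _; rewrite mxE nth_index.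
have p := Gpos x0; have r0 : Num.sqrt (G x x) != 0 by rewrite gt_eqF // sqrtr_gt0.
exists ((Num.sqrt (G x x))^-1 *: x).
  rewrite (scalarZ _ _ (Gscalar _)) GZl.
  by rewrite mulrA -invfM -expr2 sqr_sqrtr ?ltW // mulVf // gt_eqF.
by move=> y ys; rewrite GZl (xs _ ys) mulr0.
Qed.

Variables (A : 'rV[R]_m -> 'rV[R]_m) (K : seq 'rV[R]_m).
Hypothesis Askew : forall u v, G u (A v) = - G (A u) v.
Hypothesis oK : orthonormal K.
Hypothesis AK : forall y, y \in K -> A y = 0.
Hypothesis AA : forall x, (forall y, y \in K -> G x y = 0) -> A (A x) = - x.

(** After the kernel vectors [K] the family reads e, A e, e', A e', and so on. *)
Definition adapted (t : seq 'rV[R]_m) := orthonormal (K ++ t) /\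
  forall i, (i.*2.+1 < size t)%N -> t`_(i.*2.+1) = A t`_(i.*2).

(** The span of an adapted family is stable under [A], so [A x] is orthogonal to
    it whenever [x] is. *)
Lemma adapted_extend t : adapted t -> ~~ odd (size t) ->
  (size K + size t < m)%N -> exists x, adapted (rcons (rcons t x) (A x)).
Proof.
move=> [ot pt] et; rewrite -size_cat => sm; have [x x1 xo] := orthogonal_unit sm.
have xK y : y \in K -> G x y = 0 by move=> yK; rewrite xo // mem_cat yK.
have xt y : y \in t -> G x y = 0 by move=> yK; rewrite xo // mem_cat yK orbT.
have GN u v : G u (- v) = - G u v by exact: (scalarN (Gscalar u)).
have AxE u : G (A x) u = - G x (A u) by rewrite Askew opprK.
have AxAx : G (A x) (A x) = 1 by rewrite AxE AA // GN opprK.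
have Axx : G (A x) x = 0.
  by have := AxE x; rewrite [G x (A x)]Gsym => /eqP; rewrite -addr_eq0 -mulr2n mulrn_eq0 => /eqP.
have tK y z : y \in t -> z \in K -> G y z = 0.
  move=> yt zK; have ly : (index y t < size t)%N by rewrite index_mem.
  have lz : (index z K < size K)%N by rewrite index_mem.
  have e1 : (K ++ t)`_(size K + index y t) = y.
    by rewrite nth_cat ltnNge leq_addr /= addKn nth_index.
  have e2 : (K ++ t)`_(index z K) = z by rewrite nth_cat lz nth_index.
  rewrite -e1 -e2 ot ?size_cat ?ltn_add2l // ?ltn_addr //.
  by rewrite gtn_eqF // ltn_addr.
have Axt y : y \in t -> G (A x) y = 0.
  move=> yt; rewrite -(nth_index 0 yt); have := yt; rewrite -index_mem.
  set i := index y t => li; rewrite -[i]odd_double_half in li *.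
  case: (odd i) li => /= li; rewrite AxE.
    rewrite add1n pt // AA ?GN ?xt ?oppr0 ?opprK ?mem_nth //; first exact: ltnW.
    by move=> z zK; apply: tK => //; apply: mem_nth; exact: ltnW.
  rewrite add0n in li *.
  have li1 : ((i./2).*2.+1 < size t)%N.
    by rewrite ltn_neqAle li andbT; apply: contraNneq et => <-; rewrite /= odd_double.
  by rewrite -pt // xt ?oppr0 // mem_nth.
have AxK y : y \in K -> G (A x) y = 0.
  by move=> yK; rewrite AxE AK // (scalar0 (Gscalar _)) oppr0.
exists x; split.
  rewrite -!rcons_cat; apply: orthonormal_rcons => //.
    exact: orthonormal_rcons.
  move=> y; rewrite mem_rcons inE mem_cat => /orP[/eqP ->//|/orP[|]]; auto.
move=> i; rewrite !size_rcons !ltnS leq_eqVlt => /orP[/eqP e|li].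
  by rewrite e !nth_rcons !size_rcons !ltnn !eqxx ltnSn.
have li' : (i.*2.+1 < size t)%N.
  by rewrite ltn_neqAle li andbT; apply: contraNneq et => <-; rewrite /= odd_double.
have h1 : (i.*2.+1 < (size t).+1)%N by lia.
have h2 : (i.*2 < (size t).+1)%N by lia.
by rewrite !nth_rcons !size_rcons h1 h2 li li' pt.
Qed.

Lemma adapted_pairing t i j : adapted t -> ~~ odd (size t) ->
  (i < size t)%N -> (j < size t)%N -> G t`_i (A t`_j) = - pairing R i j.
Proof.
move=> [ot pt] et li lj.
have e c : (K ++ t)`_(size K + c) = t`_c by rewrite nth_cat ltnNge leq_addr /= addKn.
have o a b : (a < size t)%N -> (b < size t)%N -> G t`_a t`_b = (a == b)%:R.
  move=> la lb; have := ot (size K + a)%N (size K + b)%N.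
  by rewrite size_cat !ltn_add2l !e eqn_add2l; apply.
have tK a : (a < size t)%N -> forall y, y \in K -> G t`_a y = 0.
  move=> la y yK; have ly : (index y K < size K)%N by rewrite index_mem.
  have e2 : (K ++ t)`_(index y K) = y by rewrite nth_cat ly nth_index.
  rewrite -e2 -e ot ?size_cat ?ltn_add2l // ?ltn_addr //.
  by rewrite gtn_eqF // ltn_addr.
rewrite /pairing -[j]odd_double_half in lj *.
case oj: (odd j) lj => lj; rewrite ?add1n ?add0n in lj *; rewrite /= odd_double /=.
  rewrite pt // AA; last by apply: tK; exact: ltnW.
  rewrite (scalarN (Gscalar _)) o //; last exact: ltnW.
  rewrite subr0; congr (- _%:R); rewrite eqSS [i == _]eq_sym.
  by case: eqP => [<-|]; rewrite ?odd_double ?andbF.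
have lj1 : ((j./2).*2.+1 < size t)%N.
  by rewrite ltn_neqAle lj andbT; apply: contraNneq et => <-; rewrite /= odd_double.
rewrite -pt // o // opprB.
have -> : ~~ odd i && ((j./2).*2 == i.+1) = false.
  by apply/negbTE/negP => /andP[oi /eqP e1]; have := odd_double j./2; rewrite e1 /= oi.
by rewrite subr0.
Qed.

(** Extension succeeds as long as the family does not fill the space, and a family
    of more than [m] vectors cannot be orthonormal; so the pairs exactly fill
    the complement of [K]. *)
Lemma adapted_basis : exists2 t, adapted t & (size K + size t = m)%N /\ ~~ odd (size t).
Proof.
have ext j : (size K + j.*2 < m.+2)%N -> exists2 t, adapted t & size t = j.*2.
  elim: j => [|j IH] lj; first by exists [::]; rewrite // /adapted cats0; split.
  have [|t at_ st] := IH.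
    by apply: leq_ltn_trans lj; rewrite leq_add2l leq_double.
  have [||x ax] := adapted_extend at_.
  - by rewrite st odd_double.
  - by move: lj; rewrite st doubleS !addnS !ltnS.
  by exists (rcons (rcons t x) (A x)); rewrite // !size_rcons st.
have sK : (size K <= m)%N by exact: orthonormal_size.
have [|t at_ st] := ext (m - size K).+1./2.
  have := leq_add (leqnn (odd (m - size K).+1)) (leqnn 0).
  have := odd_double_half (m - size K).+1; lia.
exists t => //; split; last by rewrite st odd_double.
have /orthonormal_size : orthonormal (K ++ t) by case: at_.
by rewrite size_cat st; have := odd_double_half (m - size K).+1; lia.
Qed.

End Orthonormal.

(** * Powers of a two-form on an adapted family *)

Section Pfaffian.
Context (R : realType).

(** Deleting a whole pair of consecutive indices leaves the pairing of the others
    unchanged. *)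
Lemma pairing_bump e i j : ~~ odd e ->
  pairing R (bump e (bump e i)) (bump e (bump e j)) = pairing R i j.
Proof.
move=> oe; have E a b : (~~ odd (bump e (bump e a)) &&
    (bump e (bump e b) == (bump e (bump e a)).+1)) = (~~ odd a && (b == a.+1)).
  have B c : bump e (bump e c) = if (c < e)%N then c else c.+2.
    by rewrite /bump; case: (ltnP c e) => h; lia.
  rewrite !B; case: (ltnP a e) => ha; case: (ltnP b e) => hb //=.
  - have -> : (b.+2 == a.+1) = false by lia.
    rewrite andbF; apply/esym/negbTE/negP => /andP[oa /eqP e1].
    have e2 : e = b by lia.
    by move: oe; rewrite e2 e1 /= oa.
  - have -> : (b == a.+3) = false by lia.
    have -> : (b == a.+1) = false by lia.
    by rewrite !andbF.
  - by rewrite !eqSS negbK.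
by rewrite /pairing !E.
Qed.

Lemma lift_permP n (u : 'S_n.+1) : exists t : 'S_n, u = lift_perm ord0 (u ord0) t.
Proof.
pose f k := odflt k (unlift (u ord0) (u (lift ord0 k))).
have fE k : lift (u ord0) (f k) = u (lift ord0 k).
  have ne : u ord0 != u (lift ord0 k) by rewrite (inj_eq perm_inj) neq_lift.
  by rewrite /f; have [j e1 e2] := unlift_some ne; rewrite e2 /=.
have f_inj : injective f.
  move=> a b e; apply: (@lift_inj _ ord0); apply: (@perm_inj _ u).
  by rewrite -!fE e.
exists (perm f_inj); apply/permP => k; case: (unliftP ord0 k) => [j ->|->].
  by rewrite lift_perm_lift permE fE.
by rewrite lift_perm_id.
Qed.

Lemma sum_gt0_one (n : nat) (f : 'S_n -> R) :
  (forall s, 0 <= f s) -> 0 < f 1%g -> 0 < \sum_s f s.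
Proof. by move=> f0 f1; rewrite (bigD1 1%g) //= ltr_pwDl // sumr_ge0. Qed.

End Pfaffian.

(** All nonzero terms of the antisymmetrized power have the same sign: they come
    from permutations carrying pairs to pairs, and the sign of such a permutation
    is that of its flips inside pairs, each of which also changes the sign of a
    value of [b]. *)
Lemma wedge_pow_paired (R : realType) n (b : 'rV[R]_n -> 'rV[R]_n -> R) (lam : R)
    (k : nat) (v : 'I_(k * 2) -> 'rV[R]_n) (s : 'S_(k * 2)) : lam != 0 ->
  (forall i j, b (v i) (v j) = lam * pairing R i j) ->
  0 < lam ^+ k * ((-1) ^+ odd_perm s * wedge_pow (kform2 b) k (fun i => v (s i))).
Proof.
move=> lam0; elim: k v s => [|k IH] v s0 vp.
  have -> : s0 = 1%g by apply/permP => -[].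
  by rewrite odd_perm1 expr0 !mul1r /=.
pose T (u : 'S_(2 + k * 2)) : R := (-1) ^+ odd_perm u *
  b (v (u (lshift _ ord0))) (v (u (lshift _ ord_max))) *
  wedge_pow (kform2 b) k (fun j => v (u (rshift 2 j))).
have E : (-1) ^+ odd_perm s0 * wedge_pow (kform2 b) k.+1 (fun i => v (s0 i)) =
    ((2 + k * 2)`!%:R)^-1 * \sum_u T u.
  rewrite /= /wedge mulrCA; congr (_ * _); rewrite big_distrr /=.
  rewrite [RHS](reindex_inj (mulIg s0)) /=; apply: eq_bigr => u _.
  rewrite /T /kform2 !permM odd_permM signr_addb.
  have -> : (fun j => v ((u * s0)%g (rshift 2 j))) = (fun j => v (s0 (u (rshift 2 j)))).
    by apply/funext => j; rewrite permM.
  by rewrite !mulrA [(-1) ^+ odd_perm s0 * _]mulrC.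
rewrite E mulrCA pmulr_rgt0 ?invr_gt0 ?ltr0n ?fact_gt0 // big_distrr /=.
(* u is determined by i = u 0, by the position j of u 1 among the remaining
   indices, and by a permutation t of the others *)
have step (u : 'S_(2 + k * 2)) : 0 <= lam ^+ k.+1 * T u /\
    (u = 1%g -> 0 < lam ^+ k.+1 * T u).
  have [u' eu] := lift_permP u; have [t eu'] := lift_permP u'.
  set i := u ord0 in eu; set j := u' ord0 in eu'.
  have ui : u (lshift _ ord0) = i by congr (u _); apply: val_inj.
  have uj : u (lshift _ ord_max) = lift i j.
    have -> : lshift (k * 2) (ord_max : 'I_2) = lift ord0 ord0 by apply: val_inj.
    by rewrite eu lift_perm_lift.
  have ur l : u (rshift 2 l) = lift i (lift j (t l)).
    have -> : rshift 2 l = lift ord0 (lift ord0 l) by apply: val_inj.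
    by rewrite eu lift_perm_lift eu' lift_perm_lift.
  have ou : odd_perm u = odd i (+) odd j (+) odd_perm t.
    by rewrite eu odd_lift_perm eu' odd_lift_perm /= addbA.
  have Tu : T u = (-1) ^+ (odd i (+) odd j (+) odd_perm t) *
      (lam * pairing R i (lift i j)) *
      wedge_pow (kform2 b) k (fun l => v (lift i (lift j (t l)))).
    have er : (fun l => v (u (rshift 2 l))) = (fun l => v (lift i (lift j (t l)))).
      by apply/funext => l; rewrite ur.
    by rewrite /T er ou ui uj vp.
  have H e : ~~ odd e -> (forall l : 'I_(k * 2), lift i (lift j l) = bump e (bump e l) :> nat) ->
    0 < lam ^+ k * ((-1) ^+ odd_perm t *
       wedge_pow (kform2 b) k (fun l => v (lift i (lift j (t l))))).
    move=> oe he; apply: (IH (fun l => v (lift i (lift j l))) t) => a c.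
    by rewrite vp !he pairing_bump.
  (* i and lift i j form a pair exactly when i = j is even or i = j + 1 with j
     even; the sign of the pairing is then that of (-1)^(i + j) *)
  have P0 : (pairing R i (lift i j) = 0 /\ u != 1%g) \/
     (exists2 e, ~~ odd e & (forall l : 'I_(k * 2), lift i (lift j l) = bump e (bump e l) :> nat)
       /\ (-1) ^+ (odd i (+) odd j) * pairing R i (lift i j) = 1).
    have bE : lift i j = bump i j :> nat by [].
    case: (boolP (~~ odd i && (lift i j == i.+1 :> nat))) => [/andP[oi /eqP e1]|c1].
      right; have ji : j = i :> nat by move: e1; rewrite bE /bump; case: leqP => h; lia.
      exists i => //; split; first by move=> l; rewrite /= ji.
      rewrite /pairing e1 oi eqxx ji addbb /=.
      have -> : (i == i.+2 :> nat) = false by lia.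
      by rewrite andbF subr0 mulr1.
    case: (boolP (~~ odd (lift i j) && (i == (lift i j).+1 :> nat))) => [/andP[oi /eqP e1]|c2].
      have ji : i = j.+1 :> nat by move: e1; rewrite bE /bump; case: leqP => h; lia.
      have lj : lift i j = j :> nat by lia.
      have oj : ~~ odd j by rewrite -lj.
      right; exists j; first exact: oj.
      split; first by move=> l; rewrite /= /bump ji; lia.
      rewrite /pairing lj ji eqxx oj.
      have -> : (j == j.+2 :> nat) = false by lia.
      by rewrite andbF sub0r addNb addbb /= mulrNN mulr1.
    left; rewrite /pairing (negbTE c1) (negbTE c2) subrr; split=> //.
    apply: contraNneq c1 => e1; rewrite -uj -ui e1 !perm1 /=.
    by [].
  case: P0 => [[p0 u1]|[e oe [he pe]]].
    rewrite Tu p0 mulr0 mulr0 mul0r mulr0; split; first exact: lexx.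
    by move=> e; rewrite e eqxx in u1.
  have {}H := H e oe he.
  suff -> : lam ^+ k.+1 * T u = lam ^+ 2 * (lam ^+ k * ((-1) ^+ odd_perm t *
       wedge_pow (kform2 b) k (fun l => v (lift i (lift j (t l)))))).
    by split=> [|_]; rewrite ?ltW // mulr_gt0 // exprn_even_gt0.
  rewrite Tu signr_addb exprS; move: (wedge_pow _ _ _) => W.
  move: ((-1) ^+ odd_perm t) pe => f.
  move: ((-1) ^+ (odd i (+) odd j)) (pairing R i (lift i j)) (lam ^+ k) => e' p l pe.
  by rewrite -[RHS]mul1r -[in RHS]pe; ring.
apply: sum_gt0_one => [u|]; first by have [] := step u.
by have [_] := step 1%g; apply.
Qed.

Lemma contact_wedge_paired (R : realType) n (w : 'rV[R]_n -> R)
    (b : 'rV[R]_n -> 'rV[R]_n -> R) (lam : R) (k : nat)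
    (v : 'I_(1 + k * 2) -> 'rV[R]_n) : lam != 0 -> w (v ord0) = 1 ->
  (forall i : 'I_(k * 2), w (v (lift ord0 i)) = 0) ->
  (forall i j : 'I_(k * 2),
     b (v (lift ord0 i)) (v (lift ord0 j)) = lam * pairing R i j) ->
  wedge (kform1 w) (wedge_pow (kform2 b) k) v != 0.
Proof.
move=> lam0 w1 w0 bp.
pose T (u : 'S_(1 + k * 2)) : R := (-1) ^+ odd_perm u * w (v (u (lshift _ ord0))) *
  wedge_pow (kform2 b) k (fun j => v (u (rshift 1 j))).
have -> : wedge (kform1 w) (wedge_pow (kform2 b) k) v =
    ((1 + k * 2)`!%:R)^-1 * \sum_u T u by [].
have e0 : lshift (k * 2) (ord0 : 'I_1) = ord0 by apply: val_inj.
have step (u : 'S_(1 + k * 2)) : 0 <= lam ^+ k * T u /\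
    (u = 1%g -> 0 < lam ^+ k * T u).
  have [t eu] := lift_permP u.
  case: (unliftP ord0 (u ord0)) => [i ui|ui].
    rewrite /T e0 ui w0 mulr0 mul0r mulr0; split; first exact: lexx.
    by move=> u1; have := neq_lift ord0 i; rewrite -ui u1 perm1 eqxx.
  rewrite ui in eu.
  have er : (fun j => v (u (rshift 1 j))) = (fun j => v (lift ord0 (t j))).
    apply/funext => j; have -> : rshift 1 j = lift ord0 j by apply: val_inj.
    by rewrite eu lift_perm_lift.
  have ou : odd_perm u = odd_perm t by rewrite eu odd_lift_perm addbb.
  rewrite /T e0 ui w1 mulr1 er ou.
  have H := wedge_pow_paired t lam0 bp.
  by split=> [|_]; [exact: ltW|].
have H : 0 < lam ^+ k * \sum_u T u.
  rewrite big_distrr /=; apply: sum_gt0_one => [u|]; first by have [] := step u.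
  by have [_] := step 1%g; apply.
rewrite mulf_neq0 // ?invr_eq0 ?pnatr_eq0 -?lt0n ?fact_gt0 //.
by apply: contraTneq H => ->; rewrite mulr0 ltxx.
Qed.

(** * The structure induced on an invariant submanifold *)

Section ExteriorDerivative.
Context (R : realType) (n : nat) (M : manifold R n).
Implicit Types (a : field1 M) (p : M).

Lemma extd_skew a p u v : extd a p u v = - extd a p v u.
Proof. by rewrite /extd; ring. Qed.

Lemma extd_scalarl a p v : one_form a -> scalar (fun u => extd a p u v).
Proof.
move=> ha; have [l _] := extd_in_form (@open_chart_img _ _ _ p) v (one_form_on p ha).
by move=> c u w; rewrite !extdE (l _ (chart_img_center p)).
Qed.

End ExteriorDerivative.

(** What a metric contact pair induces on an invariant submanifold, [t1] and
    [t2] being the tangential parts of the Reeb fields.  The frame is not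
    required to be dual to the forms, so that the ambient manifold and its
    invariant submanifolds of either parity are covered alike. *)
Record induced_pair (R : realType) m (N : manifold R m) (c1 c2 : field1 N)
    (t1 t2 : vfield N) (A : field11 N) (G : field2 N) : Prop := InducedPair {
  ip_metric : riemannian_metric G;
  ip_form1 : one_form c1;
  ip_form2 : one_form c2;
  ip_tensor : tensor11 A;
  ip_dual1 : forall p u, G p u (t1 p) = c1 p u;
  ip_dual2 : forall p u, G p u (t2 p) = c2 p u;
  ip_assoc : forall p u v, G p u (A p v) = extd c1 p u v + extd c2 p u v;
  ip_ker1 : forall p, A p (t1 p) = 0;
  ip_ker2 : forall p, A p (t2 p) = 0;
  ip_sqr : forall p u, A p (A p u) = - u + c1 p u *: t1 p + c2 p u *: t2 p;
  ip_inner11 : forall p u, extd c1 p (t1 p) u = 0;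
  ip_inner12 : forall p u, extd c1 p (t2 p) u = 0;
  ip_inner21 : forall p u, extd c2 p (t1 p) u = 0;
  ip_inner22 : forall p u, extd c2 p (t2 p) u = 0 }.

Lemma induced_pair_swap (R : realType) m (N : manifold R m) (c1 c2 : field1 N)
    (t1 t2 : vfield N) (A : field11 N) (G : field2 N) :
  induced_pair c1 c2 t1 t2 A G -> induced_pair c2 c1 t2 t1 A G.
Proof.
case=> *; split=> //; first by move=> *; rewrite addrC.
by move=> *; rewrite addrAC.
Qed.

Lemma metric_contact_pair_induced (R : realType) n (M : manifold R n) h k
    a1 a2 Z1 Z2 phi g : metric_contact_pair h k a1 a2 Z1 Z2 phi g ->
  @induced_pair R n M a1 a2 Z1 Z2 phi g.
Proof.
case=> [[[_ f1 f2 _ _ _] [_ _ inner] tphi sq ker] hg assoc reeb].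
split=> //.
- by move=> p u; have [] := reeb p u.
- by move=> p u; have [] := reeb p u.
- by move=> p; have [] := ker p.
- by move=> p; have [] := ker p.
- by move=> p u; have [] := inner p u.
- by move=> p u; have [] := inner p u.
- by move=> p u; have [] := inner p u.
- by move=> p u; have [] := inner p u.
Qed.

Section InducedPair.
Context (R : realType) (m : nat) (N : manifold R m).
Variables (c1 c2 : field1 N) (t1 t2 : vfield N) (A : field11 N) (G : field2 N).
Hypothesis H : induced_pair c1 c2 t1 t2 A G.
Implicit Types (p : N) (u v : 'rV[R]_m).

Let hG := ip_metric H.

Lemma ip_Gr p u : scalar (G p u). Proof. exact: metric_scalar hG p u. Qed.

Lemma ip_Gsym p u v : G p u v = G p v u. Proof. exact: metric_sym hG p u v. Qed.

Lemma ip_Gl p v : scalar (fun u => G p u v).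
Proof. by move=> c u w; rewrite !(ip_Gsym p _ v) ip_Gr. Qed.

Lemma ip_GDl p u v w : G p (u + v) w = G p u w + G p v w.
Proof. exact: (scalarD (ip_Gl p w)). Qed.

Lemma ip_GNl p u w : G p (- u) w = - G p u w.
Proof. exact: (scalarN (ip_Gl p w)). Qed.

Lemma ip_GZl p c u w : G p (c *: u) w = c * G p u w.
Proof. exact: (scalarZ _ _ (ip_Gl p w)). Qed.

Lemma ip_nondeg p u : G p u u = 0 -> u = 0.
Proof.
by move=> Guu; apply/eqP/negPn/negP => /(metric_pos hG p); rewrite Guu ltxx.
Qed.

Lemma ip_skew p u v : G p u (A p v) = - G p (A p u) v.
Proof.
rewrite (ip_Gsym p (A p u)) !(ip_assoc H) (extd_skew c1) (extd_skew c2).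
by rewrite -opprD.
Qed.

Lemma ip_im1 p u : c1 p (A p u) = 0.
Proof.
by rewrite -(ip_dual1 H) ip_Gsym ip_skew (ip_ker1 H) (scalar0 (ip_Gl _ _)) oppr0.
Qed.

Lemma ip_im2 p u : c2 p (A p u) = 0.
Proof.
by rewrite -(ip_dual2 H) ip_Gsym ip_skew (ip_ker2 H) (scalar0 (ip_Gl _ _)) oppr0.
Qed.

Lemma ip_cross p : c1 p (t2 p) = c2 p (t1 p).
Proof. by rewrite -(ip_dual1 H) -(ip_dual2 H) ip_Gsym. Qed.

Lemma ip_lin1 p : scalar (c1 p). Proof. by have [l _] := ip_form1 H; exact: l. Qed.

Lemma ip_lin2 p : scalar (c2 p). Proof. by have [l _] := ip_form2 H; exact: l. Qed.

(** Since [A] kills [t1], its square gives the expansion of [t1] in t1 and t2. *)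
Lemma ip_expand1 p : t1 p = c1 p (t1 p) *: t1 p + c2 p (t1 p) *: t2 p.
Proof.
have := ip_sqr H p (t1 p); rewrite (ip_ker1 H) (lin0 ((ip_tensor H).1 p)).
by move/eqP; rewrite -addrA eq_sym addrC addr_eq0 opprK => /eqP.
Qed.

Lemma ip_gram1 p : c1 p (t1 p) = c1 p (t1 p) ^+ 2 + c2 p (t1 p) ^+ 2.
Proof.
by rewrite {1}ip_expand1 (scalarD (ip_lin1 p)) !(scalarZ _ _ (ip_lin1 p)) ip_cross !expr2.
Qed.

Lemma ip_gram12 p : c2 p (t1 p) = c2 p (t1 p) * (c1 p (t1 p) + c2 p (t2 p)).
Proof.
rewrite {1}ip_expand1 (scalarD (ip_lin2 p)) !(scalarZ _ _ (ip_lin2 p)); ring.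
Qed.

Lemma ip_smooth1 : smooth_vfield t1.
Proof.
apply: (smooth_vfield_sharp hG (ip_form1 H)) => p u.
by rewrite ip_Gsym (ip_dual1 H).
Qed.

Lemma ip_dual1l p u : G p (t1 p) u = c1 p u.
Proof. by rewrite ip_Gsym (ip_dual1 H). Qed.

Lemma ip_dual2l p u : G p (t2 p) u = c2 p u.
Proof. by rewrite ip_Gsym (ip_dual2 H). Qed.

End InducedPair.

Lemma ip_smooth2 (R : realType) m (N : manifold R m) (c1 c2 : field1 N)
    (t1 t2 : vfield N) (A : field11 N) (G : field2 N) :
  induced_pair c1 c2 t1 t2 A G -> smooth_vfield t2.
Proof. by move/induced_pair_swap; exact: ip_smooth1. Qed.

Section Induce.
Context (R : realType) (m n : nat) (N : manifold R m) (M : manifold R n).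
Variables (F : N -> M) (a1 a2 : field1 M) (Z1 Z2 : vfield M).
Variables (phi : field11 M) (g : field2 M).
Hypothesis H : induced_pair a1 a2 Z1 Z2 phi g.
Hypothesis sN : submanifold F.

Let smF : smooth_map F. Proof. by case: sN. Qed.
Let inj p : injective (tmap F p). Proof. by case: sN. Qed.
Let tl p := tmap_linear smF p.

(** The tangential part exists because the metric of the submanifold represents
    every linear form. *)
Lemma tangential_partP (Z : vfield M) (a : field1 M) p u :
  one_form a -> (forall q w, g q w (Z q) = a q w) ->
  pull2 F g p (tangential_part F g Z p) u = pull1 F a p u.
Proof.
move=> [la _] gZ; have hG := riemannian_pull2 smF (ip_metric H) inj.
have sc : scalar (pull1 F a p) by move=> c v w; rewrite /pull1 tl la.
have Gl v : scalar (fun u => pull2 F g p u v).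
  by move=> c x y; rewrite !(metric_sym hG p _ v) (metric_scalar hG).
have [t tP] := riesz_representation (metric_scalar hG p) Gl (metric_pos hG p) sc.
have ex : [set t | forall u, g (F p) (Z (F p) - tmap F p t) (tmap F p u) = 0] t.
  move=> w /=; rewrite (scalarB (ip_Gl H (F p) (tmap F p w))).
  have := tP w; rewrite /pull2 /pull1 => ->.
  by rewrite (ip_Gsym H) gZ subrr.
have := xgetI 0 ex; rewrite -/(tangential_part F g Z p) /= => /(_ u).
rewrite (scalarB (ip_Gl H (F p) (tmap F p u))) (ip_Gsym H) gZ => /eqP.
by rewrite subr_eq0 => /eqP.
Qed.

Hypothesis inv : invariant_under F phi.

Definition restricted_endo : field11 N := fun p u =>
  xget 0 [set w | tmap F p w = phi (F p) (tmap F p u)].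

Lemma restricted_endoP : restricts11 F phi restricted_endo.
Proof.
move=> p u; have [w ew] := inv p u.
by have := @xgetI _ 0 [set w | tmap F p w = phi (F p) (tmap F p u)] w ew.
Qed.

Lemma restricted_endo_linear p : linear (restricted_endo p).
Proof.
move=> c u v; apply: (inj (p := p)); have := restricted_endoP p => E.
by rewrite tl !E tl ((ip_tensor H).1 (F p)).
Qed.

(** The form g(phi u, v) pulls back to a smooth one, of which the restricted
    endomorphism is the metric dual. *)
Lemma restricted_endo_tensor : tensor11 restricted_endo.
Proof.
have hg := ip_metric H; have hG := riemannian_pull2 smF hg inj.
pose B : field2 M := fun r u v => g r (phi r u) v.
have lphi r := (ip_tensor H).1 r.
apply: (tensor11_dual (B := pull2 F B) hG).
- exact: restricted_endo_linear.
- by move=> p u v; rewrite /pull2 /B restricted_endoP.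
- move=> q u v; apply: (smooth_pull2 smF).
  + by move=> r w; exact: ip_Gr H r _.
  + by move=> r w c x y; rewrite /B lphi (ip_Gl H r w).
  move=> r w t; have ofl x Ux := of_chart_linear (@chart_img_dom _ _ _ r x Ux).
  have [_ s] := tensor11_on r (ip_tensor H).
  apply: (smooth_eq (@open_chart_img _ _ _ r)
    (f := fun x => field2_in (chart_at r) g x (field11_in (chart_at r) phi x w) t)).
    move=> x Ux; rewrite /field2_in /B /field11_in.
    by rewrite (to_chartK (chart_img_dom Ux)).
  apply: (smooth_apply (@open_chart_img _ _ _ r)
    (L := fun x u => field2_in (chart_at r) g x u t)).
  + by move=> x Ux c y z; rewrite /field2_in ofl // (ip_Gl H).
  + by move=> y; exact: (metric_smooth hg).
  + exact: s.
Qed.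

(** The tangential part of a Reeb field is annihilated by the restricted
    endomorphism, so it lies in the span of the Reeb fields, on which the
    exterior derivatives vanish. *)
Lemma induced_pair_submanifold :
  induced_pair (pull1 F a1) (pull1 F a2) (tangential_part F g Z1)
    (tangential_part F g Z2) restricted_endo (pull2 F g).
Proof.
have hg := ip_metric H; have hG := riemannian_pull2 smF hg inj.
have Gs p u v : pull2 F g p u v = pull2 F g p v u by exact: (metric_sym hG).
have f1 := one_form_pull1 smF (ip_form1 H).
have f2 := one_form_pull1 smF (ip_form2 H).
have d1 p u := tangential_partP p u (ip_form1 H) (ip_dual1 H).
have d2 p u := tangential_partP p u (ip_form2 H) (ip_dual2 H).
have as_ p u v : pull2 F g p u (restricted_endo p v) =
    extd (pull1 F a1) p u v + extd (pull1 F a2) p u v.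
  rewrite (extd_pull1 smF _ _ _ (ip_form1 H)) (extd_pull1 smF _ _ _ (ip_form2 H)).
  by rewrite /pull2 restricted_endoP (ip_assoc H).
have nd p u : (forall x, pull2 F g p u x = 0) -> u = 0.
  move=> z; apply/eqP/negPn/negP => /(metric_pos hG p).
  by rewrite z ltxx.
have ker (Z : vfield M) (a : field1 M) p :
    (forall u, pull2 F g p (tangential_part F g Z p) u = pull1 F a p u) ->
    (forall u, a (F p) (phi (F p) u) = 0) ->
    restricted_endo p (tangential_part F g Z p) = 0.
  move=> dZ aphi; apply: (nd p) => x; rewrite Gs as_ (extd_skew (pull1 F a1)).
  rewrite (extd_skew (pull1 F a2)) -opprD -as_ dZ /pull1 restricted_endoP aphi.
  by rewrite oppr0.
have k1 p := ker Z1 a1 p (d1 p) (ip_im1 H (F p)).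
have k2 p := ker Z2 a2 p (d2 p) (ip_im2 H (F p)).
have inner (a : field1 M) p t u : one_form a ->
    (forall w, extd a (F p) (Z1 (F p)) w = 0) ->
    (forall w, extd a (F p) (Z2 (F p)) w = 0) -> restricted_endo p t = 0 ->
    extd (pull1 F a) p t u = 0.
  move=> fa i1 i2 At; rewrite (extd_pull1 smF _ _ _ fa).
  have : phi (F p) (phi (F p) (tmap F p t)) = 0.
    by rewrite -!restricted_endoP At (lin0 (restricted_endo_linear p)) (lin0 (tl p)).
  rewrite (ip_sqr H) -addrA addrC => /eqP; rewrite subr_eq0 => /eqP <-.
  have l := extd_scalarl (F p) (tmap F p u) fa.
  have := scalarD l (a1 (F p) (tmap F p t) *: Z1 (F p)) (a2 (F p) (tmap F p t) *: Z2 (F p)).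
  move=> /= ->.
  have E c z := scalarZ c z l; rewrite /= in E.
  by rewrite !E i1 i2 !mulr0 addr0.
split=> //.
- exact: restricted_endo_tensor.
- by move=> p u; rewrite Gs d1.
- by move=> p u; rewrite Gs d2.
- move=> p u; apply/eqP; rewrite -subr_eq0; apply/eqP/(nd p) => x.
  have Gl v : scalar (fun u => pull2 F g p u v).
    by move=> c y z; rewrite !(Gs p _ v) (metric_scalar hG).
  have GD y z := scalarD (Gl x) y z; have GN y := scalarN (Gl x) y.
  have GZ c y := scalarZ c y (Gl x); rewrite /= in GD GN GZ.
  rewrite !GD GN !GD GN !GZ d1 d2.
  have -> : pull2 F g p (restricted_endo p (restricted_endo p u)) x =
      - pull2 F g p u x + pull1 F a1 p u * pull1 F a1 p x
      + pull1 F a2 p u * pull1 F a2 p x.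
    rewrite /pull2 !restricted_endoP (ip_sqr H).
    rewrite !(ip_GDl H) (ip_GNl H) !(ip_GZl H) (ip_dual1l H) (ip_dual2l H).
    by [].
  by rewrite subrr.
- by move=> p u; apply: inner => //; [exact: ip_form1 H|exact: ip_inner11 H _|exact: ip_inner12 H _].
- by move=> p u; apply: inner => //; [exact: ip_form1 H|exact: ip_inner11 H _|exact: ip_inner12 H _].
- by move=> p u; apply: inner => //; [exact: ip_form2 H|exact: ip_inner21 H _|exact: ip_inner22 H _].
- by move=> p u; apply: inner => //; [exact: ip_form2 H|exact: ip_inner21 H _|exact: ip_inner22 H _].
Qed.

End Induce.

(** * Parity of the dimension and rank of the kernel *)

Lemma smooth_open_preimage (R : realType) n (U : set 'rV[R]_n)
    (f : 'rV[R]_n -> R) (O : set R) x : open U -> smooth_on U f -> open O ->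
  U x -> O (f x) ->
  exists V, [/\ open V, V x & forall y, V y -> U y /\ O (f y)].
Proof.
move=> oU sf oO Ux Of.
have cf : {for x, continuous f} by exact/differentiable_continuous/(smooth_diff sf Ux).
have nO : nbhs x (f @^-1` O) by exact: (cf O (open_nbhs_nbhs (conj oO Of))).
have nU : nbhs x U by exact: open_nbhs_nbhs (conj oU Ux).
exists (interior (U `&` f @^-1` O)); split; first exact: open_interior.
  exact: filterI nU nO.
exact: interior_subset.
Qed.

(** Contracting the differential of [c2 = lam * c1] with [T] gives
    [d lam = f * c1]; differentiating once more gives [f * d c1 = 0] on the
    kernel of [c1]. *)
Lemma proportional_forms (R : realType) n (V : set 'rV[R]_n)
    (c1 c2 : 'rV[R]_n -> 'rV[R]_n -> R) (T : 'rV[R]_n -> 'rV[R]_n)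
    (lam : 'rV[R]_n -> R) : open V -> form_on V c1 -> form_on V c2 ->
  smooth_on V T -> smooth_on V lam ->
  (forall x u, V x -> c2 x u = lam x * c1 x u) ->
  (forall x, V x -> c1 x (T x) != 0) ->
  (forall x v, V x -> extd_in c1 x (T x) v = 0) ->
  (forall x v, V x -> extd_in c2 x (T x) v = 0) ->
  (forall x, V x -> exists w v, [/\ c1 x w = 0, c1 x v = 0 &
     extd_in c1 x w v + extd_in c2 x w v != 0]) ->
  forall x, V x -> (forall v, Ds lam x v = 0) /\
    (forall u v, extd_in c2 x u v = lam x * extd_in c1 x u v).
Proof.
move=> oV [l1 s1] [l2 s2] sT slam c2E cT K1 K2 nd.
have half (r : R) : 2 * (2^-1 * r) = r by rewrite mulrA divff ?mul1r // pnatr_eq0.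
have D x u v : V x -> Ds (fun y => c2 y v) x u =
    lam x * Ds (fun y => c1 y v) x u + c1 x v * Ds lam x u.
  move=> Vx; rewrite -(DsM u slam (s1 v) Vx).
  by apply: (Ds_eq oV) => // y Vy; exact: c2E.
have dE x u v : V x -> 2 * extd_in c2 x u v =
    Ds lam x u * c1 x v - Ds lam x v * c1 x u + lam x * (2 * extd_in c1 x u v).
  by move=> Vx; rewrite /extd_in !half (D _ u v Vx) (D _ v u Vx); ring.
pose f x := Ds lam x (T x) / c1 x (T x).
have Df x v : V x -> Ds lam x v = f x * c1 x v.
  move=> Vx; have := dE x (T x) v Vx; rewrite K1 // K2 // !mulr0 addr0.
  move/eqP; rewrite eq_sym subr_eq0 => /eqP e.
  by rewrite /f mulrAC e mulfK // cT.
have sf : smooth_on V f.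
  apply: (smoothM oV).
    apply: (smooth_apply oV (L := Ds lam)) => //; first by move=> x; exact: Ds_scalar.
    by move=> u; exact: smooth_Ds.
  by apply: (smoothV oV) => //; exact: smooth_apply.
have DDf x u v : V x -> Ds (fun y => Ds lam y v) x u =
    f x * Ds (fun y => c1 y v) x u + c1 x v * Ds f x u.
  move=> Vx; rewrite -(DsM u sf (s1 v) Vx).
  by apply: (Ds_eq oV) => // y Vy; exact: Df.
have f0 x : V x -> f x = 0.
  move=> Vx; have [w [v [w0 v0 ne]]] := nd x Vx.
  have ne1 : extd_in c1 x w v != 0.
    apply: contra_neq ne => e0; have := dE x w v Vx.
    rewrite e0 w0 v0 !mulr0 subrr addr0 add0r => /eqP.
    by rewrite mulf_eq0 pnatr_eq0 /= => /eqP.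
  have := Ds_sym oV w v slam Vx; rewrite !DDf // w0 v0 !mul0r !addr0.
  move/eqP; rewrite -subr_eq0 -mulrBr mulf_eq0 => /orP[/eqP //|/eqP e].
  by case/eqP: ne1; rewrite /extd_in e mulr0.
have Dl x v : V x -> Ds lam x v = 0 by move=> Vx; rewrite Df // f0 // mul0r.
move=> x Vx; split=> [v|u v]; first exact: Dl.
have two0 : (2 : R) != 0 by rewrite pnatr_eq0.
have := dE x u v Vx; rewrite !Dl // !mul0r subrr add0r => e.
by apply: (mulfI two0); rewrite e mulrCA.
Qed.

Section Parity.
Context (R : realType) (m : nat) (N : manifold R m).
Implicit Types (c : field1 N) (t : vfield N) (A : field11 N) (G : field2 N).
Implicit Types (p : N) (u v : 'rV[R]_m).

Lemma ip_norm1 c1 c2 t1 t2 A G p : induced_pair c1 c2 t1 t2 A G ->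
  (c1 p (t1 p) == 0) = (t1 p == 0).
Proof.
move=> H; apply/eqP/eqP => [e|->]; last exact: scalar0 (ip_lin1 H p).
by apply: (ip_nondeg H (p := p)); rewrite (ip_dual1 H).
Qed.

Lemma ip_norm1_ge0 c1 c2 t1 t2 A G p : induced_pair c1 c2 t1 t2 A G ->
  0 <= c1 p (t1 p).
Proof.
move=> H; have [e|ne] := eqVneq (t1 p) 0.
  by rewrite e (scalar0 (ip_lin1 H p)).
by rewrite -(ip_dual1 H) ltW // (metric_pos (ip_metric H)).
Qed.

(** The Gram matrix of [t1] and [t2] is symmetric and idempotent. *)
Lemma ip_cases c1 c2 t1 t2 A G p : induced_pair c1 c2 t1 t2 A G ->
  [\/ t1 p = 0 /\ t2 p = 0, c1 p (t1 p) + c2 p (t2 p) = 1 |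
      [/\ c1 p (t1 p) = 1, c2 p (t1 p) = 0 & c2 p (t2 p) = 1]].
Proof.
move=> H; have H' := induced_pair_swap H.
have e1 := ip_gram1 H p; have e2 := ip_gram1 H' p; have e3 := ip_gram12 H p.
rewrite (ip_cross H) in e2.
have n1 := ip_norm1 p H; have n2 := ip_norm1 p H'.
set a := c1 p (t1 p) in e1 e3 n1 *; set d := c2 p (t2 p) in e2 e3 n2 *.
set b := c2 p (t1 p) in e1 e2 e3 *.
have [b0|nb] := eqVneq b 0; last first.
  by apply: Or32; apply: (mulfI nb); rewrite -e3 mulr1.
have /eqP : a * (a - 1) = 0.
  by rewrite mulrBr mulr1 -expr2 [X in _ - X]e1 b0 expr0n addr0 subrr.
have /eqP : d * (d - 1) = 0.
  by rewrite mulrBr mulr1 -expr2 [X in _ - X]e2 b0 expr0n addr0 subrr.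
rewrite !mulf_eq0 !subr_eq0 => /orP[/eqP d0|/eqP d1] /orP[/eqP a0|/eqP a1].
- by apply: Or31; split; apply/eqP; rewrite -?n1 -?n2 ?a0 ?d0.
- by apply: Or32; rewrite a1 d0 addr0.
- by apply: Or32; rewrite a0 d1 add0r.
- by apply: Or33.
Qed.

(** The vector t2 - (b / a) t1 has squared length d - b^2 / a, which vanishes
    because the Gram matrix then has rank one. *)
Lemma ip_rank1 c1 c2 t1 t2 A G p : induced_pair c1 c2 t1 t2 A G ->
  c1 p (t1 p) + c2 p (t2 p) = 1 -> c1 p (t1 p) != 0 ->
  t2 p = (c2 p (t1 p) / c1 p (t1 p)) *: t1 p.
Proof.
move=> H s1 a0; have e1 := ip_gram1 H p; have cr := ip_cross H p.
apply/eqP; rewrite -subr_eq0; apply/eqP/(ip_nondeg H (p := p)).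
set b := c2 p (t1 p) in e1 cr *; set a := c1 p (t1 p) in s1 a0 e1 *.
have l1 := ip_lin1 H p; have l2 := ip_lin2 H p.
rewrite (scalarB (ip_Gr H p _)) (scalarZ _ _ (ip_Gr H p _)) (ip_dual1 H) (ip_dual2 H).
rewrite (scalarB l1) (scalarB l2) (scalarZ _ _ l1) (scalarZ _ _ l2) cr -/b -/a.
have -> : c2 p (t2 p) = 1 - a by rewrite -s1 addrC addKr.
have b2 : b * b = a - a * a by rewrite {1}e1 !expr2; ring.
have -> : 1 - a - b / a * b - b / a * (b - b / a * a) = 1 - a - b * b / a.
  by field.
by rewrite b2; field.
Qed.

Definition unit_field (c : field1 N) (t : vfield N) p :=
  (Num.sqrt (c p (t p)))^-1 *: t p.

Lemma ip_adapted1 c1 c2 t1 t2 A G p : induced_pair c1 c2 t1 t2 A G ->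
  c1 p (t1 p) + c2 p (t2 p) = 1 -> c1 p (t1 p) != 0 ->
  exists t : seq ('rV[R]_m), [/\ (size t).+1 = m, ~~ odd (size t),
    forall i, (i < size t)%N -> c1 p t`_i = 0 &
    forall i j, (i < size t)%N -> (j < size t)%N ->
      G p t`_i (A p t`_j) = - pairing R i j].
Proof.
move=> H s1 a0; have t2E := ip_rank1 H s1 a0.
have a_gt0 : 0 < c1 p (t1 p) by rewrite lt0r a0 (ip_norm1_ge0 p H).
have r0 : Num.sqrt (c1 p (t1 p)) != 0 by rewrite gt_eqF // sqrtr_gt0.
have oK : orthonormal (G p) [:: unit_field c1 t1 p].
  move=> [|//] [|//] _ _ /=; rewrite /unit_field (ip_GZl H) (scalarZ _ _ (ip_Gr H p _)).
  by rewrite (ip_dual1 H) mulrA -invfM -expr2 sqr_sqrtr ?ltW // mulVf.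
have AK y : y \in [:: unit_field c1 t1 p] -> A p y = 0.
  rewrite inE => /eqP ->.
  by rewrite (linZ _ _ ((ip_tensor H).1 p)) (ip_ker1 H) scaler0.
have AA x : (forall y, y \in [:: unit_field c1 t1 p] -> G p x y = 0) ->
    A p (A p x) = - x.
  move=> /(_ _ (mem_head _ _)); rewrite /unit_field (scalarZ _ _ (ip_Gr H p _)).
  move/eqP; rewrite mulf_eq0 invr_eq0 (negbTE r0) /= (ip_dual1 H) => /eqP x0.
  have x2 : c2 p x = 0 by rewrite -(ip_dual2 H) t2E (scalarZ _ _ (ip_Gr H p _)) (ip_dual1 H) x0 mulr0.
  by rewrite (ip_sqr H) x0 x2 !scale0r !addr0.
have [t at_ [st et]] := adapted_basis (ip_Gr H p) (ip_Gsym H p)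
  (metric_pos (ip_metric H) p) (ip_skew H p) oK AK AA.
exists t; split=> // [i li|i j li lj].
  have [/(_ 0%N i.+1)] := at_; rewrite /= !ltnS => /(_ isT li) + _.
  rewrite /unit_field (ip_GZl H) (ip_dual1l H) => /eqP.
  by rewrite mulf_eq0 invr_eq0 (negbTE r0) => /eqP.
exact: (adapted_pairing (ip_Gr H p) AA at_ et li lj).
Qed.

Lemma ip_rank1_odd c1 c2 t1 t2 A G p : induced_pair c1 c2 t1 t2 A G ->
  c1 p (t1 p) + c2 p (t2 p) = 1 -> odd m.
Proof.
move=> H s1; have [a0|a0] := eqVneq (c1 p (t1 p)) 0.
  have s1' : c2 p (t2 p) + c1 p (t1 p) = 1 by rewrite addrC.
  have [|t [st et _ _]] := ip_adapted1 (induced_pair_swap H) s1'.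
    by move: s1; rewrite a0 add0r => ->; exact: oner_neq0.
  by rewrite -st /= et.
by have [t [st et _ _]] := ip_adapted1 H s1 a0; rewrite -st /= et.
Qed.

Lemma ip_rank0_even c1 c2 t1 t2 A G p : induced_pair c1 c2 t1 t2 A G ->
  t1 p = 0 -> t2 p = 0 -> ~~ odd m.
Proof.
move=> H z1 z2.
have := @adapted_basis R m (G p) (ip_Gr H p) (ip_Gsym H p) (metric_pos (ip_metric H) p)
  (A p) [::] (ip_skew H p).
case=> //.
  by move=> x _; rewrite (ip_sqr H) z1 z2 !scaler0 !addr0.
by move=> t _ [st et]; rewrite -st.
Qed.

Lemma ip_rank2_even c1 c2 t1 t2 A G p : induced_pair c1 c2 t1 t2 A G ->
  c1 p (t1 p) = 1 -> c2 p (t1 p) = 0 -> c2 p (t2 p) = 1 -> ~~ odd m.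
Proof.
move=> H e11 e12 e22; have e21 : c1 p (t2 p) = 0 by rewrite (ip_cross H).
have := @adapted_basis R m (G p) (ip_Gr H p) (ip_Gsym H p) (metric_pos (ip_metric H) p)
  (A p) [:: t1 p; t2 p] (ip_skew H p).
case.
- by move=> [|[|//]] [|[|//]] _ _ /=; rewrite ?(ip_dual1 H) ?(ip_dual2 H) ?e11 ?e12 ?e21 ?e22.
- by move=> y; rewrite !inE => /orP[|] /eqP ->; [exact: (ip_ker1 H)|exact: (ip_ker2 H)].
- move=> x xK; have x1 : c1 p x = 0 by rewrite -(ip_dual1 H) xK // mem_head.
  have x2 : c2 p x = 0 by rewrite -(ip_dual2 H) xK // !inE eqxx orbT.
  by rewrite (ip_sqr H) x1 x2 !scale0r !addr0.
- by move=> t _ [st et]; rewrite -st /= negbK.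
Qed.

Lemma ip_odd c1 c2 t1 t2 A G p : induced_pair c1 c2 t1 t2 A G -> odd m ->
  c1 p (t1 p) + c2 p (t2 p) = 1.
Proof.
move=> H om; case: (ip_cases p H) => [[z1 z2]||[a b d]] //.
  by have := ip_rank0_even H z1 z2; rewrite om.
by have := ip_rank2_even H a b d; rewrite om.
Qed.

(** In even dimension the rank cannot drop to zero: it would do so on an open
    set, where both forms vanish and with them their exterior derivatives. *)
Lemma ip_even c1 c2 t1 t2 A G p : induced_pair c1 c2 t1 t2 A G ->
  ~~ odd m -> (1 < m)%N ->
  [/\ c1 p (t1 p) = 1, c2 p (t1 p) = 0 & c2 p (t2 p) = 1].
Proof.
move=> H em m2; have cs q : (t1 q = 0 /\ t2 q = 0) \/
    [/\ c1 q (t1 q) = 1, c2 q (t1 q) = 0 & c2 q (t2 q) = 1].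
  case: (ip_cases q H) => [|/(ip_rank1_odd H)|]; [by left|by rewrite (negbTE em)|by right].
case: (cs p) => // -[z1 z2]; exfalso.
pose q := chart_at p.
pose tau x := field1_in q c1 x (vfield_in q t1 x) + field1_in q c2 x (vfield_in q t2 x).
have oI := @open_chart_img _ _ _ p.
have F1 := one_form_on p (ip_form1 H); have F2 := one_form_on p (ip_form2 H).
have stau : smooth_on (chart_img p) tau.
  apply: (smoothD oI).
    exact: (smooth_apply oI F1.1 F1.2 (@smooth_vfield_in _ _ _ _ p (ip_smooth1 H))).
  exact: (smooth_apply oI F2.1 F2.2 (@smooth_vfield_in _ _ _ _ p (ip_smooth2 H))).
have [|V [oV Vp HV]] := smooth_open_preimage oI stau (@open_lt R 1) (chart_img_center p).
  rewrite /tau /= !field1_in_center !vfield_in_center z1 z2.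
  by rewrite (scalar0 (ip_lin1 H p)) (scalar0 (ip_lin2 H p)) addr0.
have Z x u : V x -> field1_in q c1 x u = 0 /\ field1_in q c2 x u = 0.
  move=> /HV[Ux]; rewrite /tau /q /= !field1_in_app //.
  set r := icoord _ x; case: (cs r) => [[y1 y2] _|[-> _ ->]]; last first.
    by rewrite -subr_gt0 opprD addNKr oppr_gt0 ltr10.
  rewrite /field1_in -/r -(ip_dual1 H) -(ip_dual2 H) y1 y2.
  by rewrite (scalar0 (ip_Gr H _ _)).
have Z' (c : field1 N) u v : (forall x w, V x -> field1_in q c x w = 0) -> extd c p u v = 0.
  move=> zc; rewrite extdE (extd_in_eq oV (b := fun _ _ => 0) u v zc Vp).
  by rewrite /extd_in !Ds_cst subrr mulr0.
have A0 v : A p v = 0.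
  apply: (ip_nondeg H (p := p)); rewrite (ip_assoc H).
  by rewrite !Z' ?addr0 // => x w /(Z x w)[].
have e0 v : v = 0.
  have := ip_sqr H p v; rewrite !A0 z1 z2 !scaler0 !addr0 => /eqP.
  by rewrite eq_sym oppr_eq0 => /eqP.
have := e0 (const_mx 1); move/rowP => /(_ (Ordinal (ltnW m2))).
by rewrite !mxE => /eqP; rewrite oner_eq0.
Qed.

(** The witnesses are [x] and [A x], for a unit vector [x] orthogonal to [t1]. *)
Lemma ip_contact_nondeg c1 c2 t1 t2 A G p : induced_pair c1 c2 t1 t2 A G ->
  c1 p (t1 p) + c2 p (t2 p) = 1 -> c1 p (t1 p) != 0 -> (1 < m)%N ->
  exists w v, [/\ c1 p w = 0, c1 p v = 0 & extd c1 p w v + extd c2 p w v != 0].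
Proof.
move=> H s1 a0 m2; have t2E := ip_rank1 H s1 a0.
have [|x x1 xo] := orthogonal_unit (ip_Gr H p) (ip_Gsym H p)
  (metric_pos (ip_metric H) p) (s := [:: t1 p]) _; first exact: m2.
have cx : c1 p x = 0 by rewrite -(ip_dual1 H) xo // mem_head.
have cx2 : c2 p x = 0 by rewrite -(ip_dual2 H) t2E (scalarZ _ _ (ip_Gr H p _)) (ip_dual1 H) cx mulr0.
exists x, (A p x); split=> //; first exact: (ip_im1 H).
rewrite -(ip_assoc H) (ip_sqr H) cx cx2 !scale0r !addr0 (scalarN (ip_Gr H p _)) x1.
by rewrite oppr_eq0 oner_neq0.
Qed.

(** With [lam] the ratio of the forms, the squared length of [t1] is
    1 / (1 + lam^2), and [lam] has zero derivative by [proportional_forms]. *)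
Lemma ip_odd_local c1 c2 t1 t2 A G p : induced_pair c1 c2 t1 t2 A G ->
  odd m -> (1 < m)%N -> c1 p (t1 p) != 0 ->
  (\forall r \near p, c1 r (t1 r) = c1 p (t1 p)) /\
  (forall u v, extd c2 p u v = c2 p (t1 p) / c1 p (t1 p) * extd c1 p u v).
Proof.
move=> H om m2 a0; have s1 r := ip_odd r H om.
pose q := chart_at p.
pose a x := field1_in q c1 x (vfield_in q t1 x).
pose b x := field1_in q c2 x (vfield_in q t1 x).
have oI := @open_chart_img _ _ _ p.
have F1 := one_form_on p (ip_form1 H); have F2 := one_form_on p (ip_form2 H).
have sT := @smooth_vfield_in _ _ _ _ p (ip_smooth1 H).
have sa : smooth_on (chart_img p) a by exact: (smooth_apply oI F1.1 F1.2 sT).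
have sb : smooth_on (chart_img p) b by exact: (smooth_apply oI F2.1 F2.2 sT).
have [|V [oV Vp HV]] := smooth_open_preimage oI sa (@open_neq R 0) (chart_img_center p).
  by rewrite /a /= field1_in_center vfield_in_center.
have aE x : chart_img p x -> a x = c1 (icoord q x) (t1 (icoord q x)).
  exact: field1_in_app.
have bE x : chart_img p x -> b x = c2 (icoord q x) (t1 (icoord q x)).
  exact: field1_in_app.
have sub x : V x -> chart_img p x by move=> /HV[].
have ne x : V x -> c1 (icoord q x) (t1 (icoord q x)) != 0.
  by move=> /HV[Ux]; rewrite /= aE.
have slam : smooth_on V (fun x => b x / a x).
  apply: (smoothM oV); first exact: smooth_sub sub sb.
  by apply: (smoothV oV); [move=> x /HV[]|exact: smooth_sub sub sa].
have ext_in (c : field1 N) x u v : one_form c -> chart_img p x ->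
    extd_in (field1_in q c) x u v =
    extd c (icoord q x) (of_chart q (icoord q x) u) (of_chart q (icoord q x) v).
  move=> fc Ux; rewrite -{1}(icoordK Ux).
  exact: extd_in_chart fc (chart_img_dom Ux).
have oT x : chart_img p x -> of_chart q (icoord q x) (vfield_in q t1 x) = t1 (icoord q x).
  by move=> Ux; rewrite /vfield_in (to_chartK (chart_img_dom Ux)).
have P := proportional_forms (c1 := field1_in q c1) (c2 := field1_in q c2) oV
  (conj (fun x Vx => F1.1 x (sub x Vx)) (fun u => smooth_sub sub (F1.2 u)))
  (conj (fun x Vx => F2.1 x (sub x Vx)) (fun u => smooth_sub sub (F2.2 u)))
  (smooth_sub sub sT) slam.
have {}P x : V x -> (forall v, Ds (fun x => b x / a x) x v = 0) /\
    (forall u v, extd_in (field1_in q c2) x u v =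
       (b x / a x) * extd_in (field1_in q c1) x u v).
  apply: P.
  - move=> y u Vy; rewrite aE ?bE; [|exact: sub|exact: sub].
    rewrite /field1_in -(ip_dual2 H) (ip_rank1 H (s1 _) (ne _ Vy)).
    by rewrite (scalarZ _ _ (ip_Gr H _ _)) (ip_dual1 H).
  - by move=> y /HV[].
  - move=> y v Vy; rewrite ext_in ?oT; [|exact: sub|exact: (ip_form1 H)|exact: sub].
    exact: (ip_inner11 H).
  - move=> y v Vy; rewrite ext_in ?oT; [|exact: sub|exact: (ip_form2 H)|exact: sub].
    exact: (ip_inner21 H).
  - move=> y Vy; have Uy := sub _ Vy; have dy := chart_img_dom Uy.
    have [w [v [w0 v0 nz]]] := ip_contact_nondeg H (s1 _) (ne _ Vy) m2.
    exists (to_chart q (icoord q y) w), (to_chart q (icoord q y) v).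
    rewrite (ext_in _ _ _ _ (ip_form1 H) Uy) (ext_in _ _ _ _ (ip_form2 H) Uy).
    by rewrite /field1_in !(to_chartK dy).
split; last first.
  move=> u v; have [_ E] := P _ Vp; have := E u v.
  by rewrite /a /b !field1_in_center vfield_in_center -!extdE.
have near_lam : \forall x \near coord q p, b x / a x = b (coord q p) / a (coord q p).
  apply: (derive0_near_constant (U := V)) => // [y Vy|y v Vy].
    exact: smooth_diff slam Vy.
  by have [D _] := P y Vy; have := D v; rewrite Ds.unlock.
have nV : nbhs (coord q p) V by exact: open_nbhs_nbhs.
have alam r : c1 r (t1 r) != 0 ->
    c1 r (t1 r) = (1 + (c2 r (t1 r) / c1 r (t1 r)) ^+ 2)^-1.
  move=> nr; have e := ip_gram1 H r; have := ip_norm1_ge0 r H.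
  move: (c1 r (t1 r)) (c2 r (t1 r)) nr e => x y x0 e xge.
  have xx : x * x != 0 by rewrite mulf_neq0.
  have -> : 1 + (y / x) ^+ 2 = (x ^+ 2 + y ^+ 2) / (x * x) by field.
  by rewrite -e; field.
have ca : {for p, continuous (coord q)} by apply: coord_cts; exact: chart_at_dom.
have nd : nbhs p (dom q) by apply: open_nbhs_nbhs; split; [exact: dom_open|exact: chart_at_dom].
have n1 : nbhs p (coord q @^-1` (V `&`
    [set x | b x / a x = b (coord q p) / a (coord q p)])).
  by exact: (ca _ (filterI nV near_lam)).
apply: filterS2 nd n1 => r dr [/= Vr lr].
have rE : icoord q (coord q r) = r by rewrite coordK.
have pE : icoord q (coord q p) = p by exact: icoord_center.
have nr := ne _ Vr; rewrite rE in nr.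
move: lr; rewrite !aE ?bE; try exact: sub; rewrite rE pE => lr.
by rewrite (alam r nr) lr -(alam p a0).
Qed.

(** The squared lengths of [t1] and [t2] add up to one, so where [t1] vanishes [t2]
    does not and its length is locally constant. *)
Lemma ip_odd_const c1 c2 t1 t2 A G p r : induced_pair c1 c2 t1 t2 A G ->
  odd m -> (1 < m)%N -> connected [set: N] -> c1 r (t1 r) = c1 p (t1 p).
Proof.
move=> H om m2 cN; have s1 q := ip_odd q H om.
have loc q : \forall x \near q, c1 x (t1 x) = c1 q (t1 q).
  have [a0|/(ip_odd_local H om m2)[]//] := eqVneq (c1 q (t1 q)) 0.
  have d0 : c2 q (t2 q) != 0 by move: (s1 q); rewrite a0 add0r => ->; exact: oner_neq0.
  have [n _] := ip_odd_local (induced_pair_swap H) om m2 d0.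
  apply: filterS n => x e.
  by apply: (addIr (c2 x (t2 x))); rewrite s1 e s1.
pose S : set N := [set x | c1 x (t1 x) = c1 p (t1 p)].
have oS : open S.
  by rewrite openE => x Sx; rewrite /interior; apply: filterS (loc x) => y e; rewrite /S /= e.
have oC : open (~` S).
  rewrite openE => x Sx; rewrite /interior; apply: filterS (loc x) => y e.
  by rewrite /S /= e.
have cS : closed S by rewrite -[S]setCK; exact: open_closedC.
have ST : S = [set: N].
  by apply: cN; [exists p|exists S; rewrite ?setTI|exists S; rewrite ?setTI].
by have : S r by rewrite ST.
Qed.

End Parity.

(** * Normality *)

(** The almost complex structures J and T are phi plus and minus the rotation of
    the Reeb plane; their torsions add up to twice those of phi and of the
    rotation, and the latter is the correction term of normality. *)
Lemma normal_torsion (R : realType) n (M : manifold R n) (a1 a2 : field1 M)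
    (Z1 Z2 : vfield M) (phi : field11 M) (g : field2 M) q u v :
  induced_pair a1 a2 Z1 Z2 phi g ->
  (forall p, [/\ a1 p (Z1 p) = 1, a1 p (Z2 p) = 0, a2 p (Z1 p) = 0 & a2 p (Z2 p) = 1]) ->
  normal_contact_pair a1 a2 Z1 Z2 phi ->
  torsion (field11_in (chart_at q) phi) (coord (chart_at q) q) u v =
  - ((2 * extd a1 q u v) *: Z1 q + (2 * extd a2 q u v) *: Z2 q).
Proof.
move=> H dual [iJ iT].
have lphi p := (ip_tensor H).1 p.
have l1 p := ip_lin1 H p; have l2 p := ip_lin2 H p.
have oI r := @open_chart_img _ _ M r.
pose P r := frame_rotation (vfield_in (chart_at r) Z1) (vfield_in (chart_at r) Z2)
  (field1_in (chart_at r) a1) (field1_in (chart_at r) a2).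
have sZ1 r := @smooth_vfield_in _ _ _ _ r (ip_smooth1 H).
have sZ2 r := @smooth_vfield_in _ _ _ _ r (ip_smooth2 H).
have fa1 r := one_form_on r (ip_form1 H).
have fa2 r := one_form_on r (ip_form2 H).
have eP r : endo_on (chart_img r) (P r).
  exact: (frame_rotation_endo (oI r) (sZ1 r) (sZ2 r) (fa1 r) (fa2 r)).
have ephi r := tensor11_on r (ip_tensor H).
pose J : field11 M := fun p u => phi p u - a2 p u *: Z1 p + a1 p u *: Z2 p.
pose T : field11 M := fun p u => phi p u + a2 p u *: Z1 p - a1 p u *: Z2 p.
have JE r x w : chart_img r x ->
    field11_in (chart_at r) J x w = field11_in (chart_at r) phi x w + P r x w.
  move=> Ux; have tl := to_chart_linear (chart_img_dom Ux).
  rewrite /field11_in /J /P /frame_rotation /vfield_in /field1_in -addrA.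
  by rewrite (linD tl) (linD tl) (linN tl) !(linZ _ _ tl).
have TE r x w : chart_img r x ->
    field11_in (chart_at r) T x w = field11_in (chart_at r) phi x w - P r x w.
  move=> Ux; have tl := to_chart_linear (chart_img_dom Ux).
  rewrite /field11_in /T /P /frame_rotation /vfield_in /field1_in -addrA opprD opprK.
  by rewrite (linD tl) (linB tl) !(linZ _ _ tl).
have tJ : tensor11 J.
  split=> [p c x y|r w].
    by rewrite /J lphi l1 l2; apply/rowP => j; rewrite !mxE; ring.
  apply: (smooth_eq (oI r)) (smoothD (oI r) ((ephi r).2 w) ((eP r).2 w)) => x Ux.
  by rewrite JE.
have tT : tensor11 T.
  split=> [p c x y|r w].
    by rewrite /T lphi l1 l2; apply/rowP => j; rewrite !mxE; ring.
  have sN := smoothZ (oI r) (smooth_cst (-1 : R)) ((eP r).2 w).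
  apply: (smooth_eq (oI r)) (smoothD (oI r) ((ephi r).2 w) sN) => x Ux.
  by rewrite TE // scaleN1r.
have Uq := chart_img_center q.
have := torsion_parallelogram (oI q) u v (ephi q) (eP q) Uq.
rewrite -(torsion_eq (oI q) u v (fun y w => @JE q y w) Uq).
rewrite -(torsion_eq (oI q) u v (fun y w => @TE q y w) Uq).
rewrite (integrable_torsion q u v tJ iJ) (integrable_torsion q u v tT iT) addr0.
move/eqP; rewrite eq_sym -scaler_nat scaler_eq0 pnatr_eq0 /= addr_eq0 => /eqP ->.
congr (- _).
have val (a : field1 M) (Z : vfield M) (c : R) : (forall p, a p (Z p) = c) ->
    forall y, chart_img q y ->
    field1_in (chart_at q) a y (vfield_in (chart_at q) Z y) = c.
  by move=> E y Uy; rewrite field1_in_app.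
have ker (a : field1 M) (Z : vfield M) : one_form a ->
    (forall p w, extd a p (Z p) w = 0) -> forall y w, chart_img q y ->
    extd_in (field1_in (chart_at q) a) y (vfield_in (chart_at q) Z y) w = 0.
  move=> fa E y w Uy; rewrite -{1}(icoordK Uy).
  rewrite (extd_in_chart _ _ fa (chart_img_dom Uy)).
  by rewrite /vfield_in (to_chartK (chart_img_dom Uy)) E.
have a11 := val a1 Z1 1 (fun p => let: And4 e _ _ _ := dual p in e).
have a12 := val a1 Z2 0 (fun p => let: And4 _ e _ _ := dual p in e).
have a21 := val a2 Z1 0 (fun p => let: And4 _ _ e _ := dual p in e).
have a22 := val a2 Z2 1 (fun p => let: And4 _ _ _ e := dual p in e).
have K11 := ker a1 Z1 (ip_form1 H) (ip_inner11 H).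
have K12 := ker a1 Z2 (ip_form1 H) (ip_inner12 H).
have K21 := ker a2 Z1 (ip_form2 H) (ip_inner21 H).
have K22 := ker a2 Z2 (ip_form2 H) (ip_inner22 H).
have comm : lie_in (vfield_in (chart_at q) Z1) (vfield_in (chart_at q) Z2)
    (coord (chart_at q) q) = 0.
  apply: (frame_commute (oI q) (sZ1 q) (sZ2 q) (fa1 q) (fa2 q)
    a11 a12 a21 a22 K11 K12 K21 K22 Uq) => w.
  rewrite !field1_in_center => w1 w2 nd.
  have pw : phi q w = 0.
    apply: (ip_nondeg H (p := q)); rewrite (ip_assoc H) (extd_skew a1) (extd_skew a2).
    by rewrite -opprD !extdE nd oppr0.
  have := ip_sqr H q w; rewrite pw (lin0 (lphi q)) w1 w2 !scale0r !addr0 => /eqP.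
  by rewrite eq_sym oppr_eq0 => /eqP.
rewrite (frame_rotation_torsion (oI q) (sZ1 q) (sZ2 q) (fa1 q) (fa2 q)
    a11 a12 a21 a22 K11 K12 K21 K22 u v Uq comm).
by rewrite !vfield_in_center !extdE.
Qed.

(** The inclusion relates the torsions of [phi] and [A]; taking inner products with
    tangent vectors replaces the Reeb fields by their tangential parts. *)
Lemma induced_torsion (R : realType) m n (N : manifold R m) (M : manifold R n)
    (F : N -> M) (a1 a2 : field1 M) (Z1 Z2 : vfield M) (phi : field11 M)
    (g : field2 M) (A : field11 N) p u v :
  induced_pair a1 a2 Z1 Z2 phi g -> submanifold F ->
  restricts11 F phi A ->
  induced_pair (pull1 F a1) (pull1 F a2) (tangential_part F g Z1)
    (tangential_part F g Z2) A (pull2 F g) ->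
  (forall q w z, torsion (field11_in (chart_at q) phi) (coord (chart_at q) q) w z =
     - ((2 * extd a1 q w z) *: Z1 q + (2 * extd a2 q w z) *: Z2 q)) ->
  torsion (field11_in (chart_at p) A) (coord (chart_at p) p) u v
  + (2 * extd (pull1 F a1) p u v) *: tangential_part F g Z1 p
  + (2 * extd (pull1 F a2) p u v) *: tangential_part F g Z2 p = 0.
Proof.
move=> H [smF _ _] res HN nrm.
have E := torsion_restricts smF p u v (ip_tensor H) (ip_tensor HN) res.
move: (torsion (field11_in (chart_at p) A) _ _ _) E => X E.
have nd w : (forall x, pull2 F g p w x = 0) -> w = 0.
  by move=> z; apply: (ip_nondeg HN (p := p)).
apply: nd => x; rewrite !(ip_GDl HN) !(ip_GZl HN) (ip_dual1l HN) (ip_dual2l HN).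
rewrite /pull2 E nrm (ip_GNl H) (ip_GDl H) !(ip_GZl H) (ip_dual1l H) (ip_dual2l H).
rewrite (extd_pull1 smF _ _ _ (ip_form1 H)) (extd_pull1 smF _ _ _ (ip_form2 H)).
by rewrite /pull1; ring.
Qed.

(** * Scaling by a constant *)

Section Scaling.
Context (R : realType) (n : nat) (M : manifold R n) (k : R).

Lemma one_formZ (a : field1 M) : one_form a -> one_form (fun p u => k * a p u).
Proof.
move=> [l s]; split=> [p c u v|q u]; first by rewrite l mulrDr mulrCA.
exact: (smoothM (@open_chart_img _ _ M q) (smooth_cst k) (s q u)).
Qed.

Lemma smooth_vfieldZ (X : vfield M) : smooth_vfield X ->
  smooth_vfield (fun p => k *: X p).
Proof.
move=> sX q; rewrite setIT; have sq := @smooth_vfield_in _ _ _ _ q sX.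
apply: (smooth_eq (@open_chart_img _ _ M q))
  (smoothZ (@open_chart_img _ _ M q) (smooth_cst k) sq) => x Ux.
by rewrite /vfield_in (linZ _ _ (to_chart_linear (chart_img_dom Ux))).
Qed.

Lemma extdZ (a : field1 M) p u v : one_form a ->
  extd (fun p u => k * a p u) p u v = k * extd a p u v.
Proof.
move=> ha; rewrite !extdE /extd_in.
have E w t : Ds (fun y => field1_in (chart_at p) (fun p u => k * a p u) y w)
    (coord (chart_at p) p) t =
    k * Ds (fun y => field1_in (chart_at p) a y w) (coord (chart_at p) p) t.
  have := DsM t (smooth_cst k) ((one_form_on p ha).2 w) (chart_img_center p).
  by rewrite Ds_cst mulr0 addr0.
by rewrite !E; ring.
Qed.

End Scaling.

(** * The odd-dimensional case *)

Section OddCase.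
Context (R : realType) (m : nat) (N : manifold R m).
Variables (c1 c2 : field1 N) (t1 t2 : vfield N) (A : field11 N) (G : field2 N).
Hypothesis H : induced_pair c1 c2 t1 t2 A G.
Hypotheses (om : odd m) (m2 : (1 < m)%N) (cN : connected [set: N]).
Variable p0 : N.
Hypothesis t10 : t1 p0 != 0.

Let zeta := normalized G t1.
Let omega : field1 N := fun p u => G p (zeta p) u.
Let alpha := c1 p0 (t1 p0).
Let kappa := (Num.sqrt alpha)^-1.
(* the ratio of the two induced forms *)
Let lam p := c2 p (t1 p) / c1 p (t1 p).
(* the factor between the metric two-form and d omega *)
Let mu p := (1 + lam p) / kappa.

Let alphaE p : c1 p (t1 p) = alpha.
Proof. exact: ip_odd_const H om m2 cN. Qed.

Let alpha0 : alpha != 0. Proof. by rewrite /alpha (ip_norm1 p0 H). Qed.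

Let alpha_gt0 : 0 < alpha.
Proof. by rewrite lt0r alpha0 (ip_norm1_ge0 p0 H). Qed.

Let kappa0 : kappa != 0.
Proof. by rewrite invr_eq0 gt_eqF // sqrtr_gt0. Qed.

Let kappa2 : kappa * kappa = alpha^-1.
Proof. by rewrite -invfM -expr2 sqr_sqrtr // ltW. Qed.

Let zetaE p : zeta p = kappa *: t1 p.
Proof. by rewrite /zeta /normalized (ip_dual1 H) alphaE. Qed.

Let omegaE p u : omega p u = kappa * c1 p u.
Proof. by rewrite /omega zetaE (ip_GZl H) (ip_dual1l H). Qed.

Let omega_def : omega = fun p u => kappa * c1 p u.
Proof. by apply/funext => p; apply/funext => u; exact: omegaE. Qed.

Let zeta_def : zeta = fun p => kappa *: t1 p.
Proof. by apply/funext => p; exact: zetaE. Qed.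

Let s1 p : c1 p (t1 p) + c2 p (t2 p) = 1.
Proof. exact: ip_odd H om. Qed.

Let a0 p : c1 p (t1 p) != 0. Proof. by rewrite alphaE. Qed.

Let t2E p : t2 p = lam p *: t1 p.
Proof. exact: ip_rank1 H (s1 p) (a0 p). Qed.

Let c2E p u : c2 p u = lam p * c1 p u.
Proof. by rewrite -(ip_dual2 H) t2E (scalarZ _ _ (ip_Gr H p u)) (ip_dual1 H). Qed.

Let extd_omega p u v : extd omega p u v = kappa * extd c1 p u v.
Proof. by rewrite omega_def (extdZ _ _ _ _ (ip_form1 H)). Qed.

Let extd2 p u v : extd c2 p u v = lam p * extd c1 p u v.
Proof. by have [_] := ip_odd_local H om m2 (a0 p); apply. Qed.

Let assoc_omega p u v : G p u (A p v) = mu p * extd omega p u v.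
Proof.
by rewrite (ip_assoc H) extd2 extd_omega /mu -mulrA mulKf // mulrDl mul1r.
Qed.

Let mu0 p : mu p != 0.
Proof.
have [w [v [_ _]]] := ip_contact_nondeg H (s1 p) (a0 p) m2.
by rewrite -(ip_assoc H) assoc_omega mulf_eq0 negb_or => /andP[].
Qed.

Let lam2 p : 1 + lam p ^+ 2 = alpha^-1.
Proof.
have e := ip_gram1 H p; rewrite /lam alphaE in e *.
have -> : 1 + (c2 p (t1 p) / alpha) ^+ 2 =
    (alpha ^+ 2 + c2 p (t1 p) ^+ 2) / (alpha * alpha) by field.
by rewrite -e; field.
Qed.

Lemma odd_contact_form : contact_form omega.
Proof.
split=> //; first by rewrite omega_def; exact: one_formZ (ip_form1 H).
move=> p; have [t [st et tc tA]] := ip_adapted1 H (s1 p) (a0 p).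
have sz : size t = (m./2 * 2)%N.
  by have := odd_double_half m; rewrite om -muln2; lia.
have nl (i : 'I_(m./2 * 2)) : (zeta p :: t)`_(lift ord0 i) = t`_i by [].
exists (fun i => (zeta p :: t)`_i); rewrite /contact_wedge.
apply: (contact_wedge_paired (lam := - (mu p)^-1)).
- by rewrite oppr_eq0 invr_eq0.
- by rewrite /= omegaE zetaE (scalarZ _ _ (ip_lin1 H p)) mulrA kappa2 alphaE mulVf.
- by move=> i; rewrite nl omegaE tc ?mulr0 // sz.
- move=> i j; rewrite !nl.
  have := tA i j; rewrite sz assoc_omega => /(_ (ltn_ord i) (ltn_ord j)) e.
  by rewrite mulNr -mulrN -e mulKf.
Qed.

Lemma odd_reeb : reeb_field omega zeta.
Proof.
split; first by rewrite zeta_def; exact: smooth_vfieldZ (ip_smooth1 H).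
- by move=> p; rewrite omegaE zetaE (scalarZ _ _ (ip_lin1 H p)) mulrA kappa2 alphaE mulVf.
- move=> p u; rewrite extd_omega zetaE.
  have := scalarZ kappa (t1 p) (extd_scalarl p u (ip_form1 H)) => /= ->.
  by rewrite (ip_inner11 H) !mulr0.
Qed.

Lemma odd_almost_contact : almost_contact_metric A zeta omega G.
Proof.
have [sz oz _] := odd_reeb; have [_ fo _] := odd_contact_form.
have sq p u : A p (A p u) = - u + omega p u *: zeta p.
  rewrite (ip_sqr H) c2E t2E omegaE zetaE -addrA; congr (_ + _).
  rewrite !scalerA -scalerDl; congr (_ *: _).
  rewrite (_ : kappa * _ * kappa = c1 p u * (kappa * kappa)); last by ring.
  by rewrite kappa2 -(lam2 p); ring.
have im p u : omega p (A p u) = 0 by rewrite omegaE (ip_im1 H) mulr0.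
split=> //.
- exact: ip_tensor H.
- exact: ip_metric H.
- by move=> p; rewrite zetaE (linZ _ _ ((ip_tensor H).1 p)) (ip_ker1 H) scaler0.
- move=> p u v; rewrite (ip_skew H) sq (ip_GDl H) (ip_GNl H) (ip_GZl H).
  by rewrite opprD opprK.
Qed.

(** The associated metric condition says mu = 1, that is (a + b)^2 = a; together
    with a^2 + b^2 = a and a > 0 this leaves only a = 1, b = 0. *)
Lemma odd_contact_metric : contact_metric A zeta omega G <-> alpha = 1.
Proof.
have b2 p : c2 p (t1 p) = lam p * alpha by rewrite /lam alphaE divfK.
split=> [[_ _ as_]|a1].
  have [w [v [_ _]]] := ip_contact_nondeg H (s1 p0) (a0 p0) m2.
  rewrite -(ip_assoc H) => nz; have := assoc_omega p0 w v.
  rewrite -as_ -{1}[G _ _ _]mul1r => /(mulIf nz); rewrite /mu => e.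
  have e1 : 1 + lam p0 = kappa by rewrite -[LHS](divfK kappa0) -e mul1r.
  have := lam2 p0; rewrite -kappa2 -e1 => e2.
  have l0 : lam p0 = 0.
    apply/eqP; have : lam p0 *+ 2 = 0.
      apply: (addrI (1 + lam p0 ^+ 2)); rewrite addr0 [RHS]e2; ring.
    by rewrite -mulr_natr => /eqP; rewrite mulf_eq0 pnatr_eq0 orbF.
  by have := lam2 p0; rewrite l0 expr0n addr0 => /eqP; rewrite eq_sym invr_eq1 => /eqP.
have k1 : kappa = 1 by rewrite /kappa a1 sqrtr1 invr1.
have l0 p : lam p = 0.
  have := lam2 p; rewrite a1 invr1 => /eqP.
  by rewrite -subr_eq0 addrAC subrr add0r sqrf_eq0 => /eqP.
split; first exact: odd_almost_contact.
- by move=> p u; rewrite /omega (ip_Gsym H).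
- by move=> p u v; rewrite assoc_omega /mu l0 k1 addr0 divr1 mul1r.
Qed.

Lemma odd_alpha1 : alpha = 1 -> forall p, c1 p (t1 p) = 1 /\ t2 p = 0.
Proof.
move=> a1 p; split; first by rewrite alphaE.
have := lam2 p; rewrite a1 invr1 => /eqP.
rewrite -subr_eq0 addrAC subrr add0r sqrf_eq0 => /eqP l0.
by rewrite t2E l0 scale0r.
Qed.

Lemma odd_normal :
  (forall p u v, torsion (field11_in (chart_at p) A) (coord (chart_at p) p) u v
     + (2 * extd c1 p u v) *: t1 p + (2 * extd c2 p u v) *: t2 p = 0) ->
  normal_almost_contact A zeta omega.
Proof.
move=> nrm U X Y oU sX sY p Up; rewrite (nijenhuisE (ip_tensor H) oU sX sY Up).
have := nrm p (X p) (Y p); move: (torsion _ _ _ _) => W e0.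
rewrite -[RHS]e0 -addrA; congr (_ + _).
rewrite extd2 t2E extd_omega zetaE !scalerA -scalerDl; congr (_ *: _).
set e := extd c1 _ _ _.
rewrite (_ : 2 * (kappa * e) * kappa = 2 * e * (kappa * kappa)); last by ring.
by rewrite kappa2 -(lam2 p); ring.
Qed.

End OddCase.

Lemma normal_contact_pair_swap (R : realType) n (M : manifold R n)
    (a1 a2 : field1 M) (Z1 Z2 : vfield M) (phi : field11 M) :
  normal_contact_pair a1 a2 Z1 Z2 phi -> normal_contact_pair a2 a1 Z2 Z1 phi.
Proof.
move=> [iJ iT]; split.
  have <- : (fun p u => phi p u + a2 p u *: Z1 p - a1 p u *: Z2 p) =
      (fun p u => phi p u - a1 p u *: Z2 p + a2 p u *: Z1 p).
    by apply/funext => p; apply/funext => u; rewrite addrAC.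
  exact: iT.
have <- : (fun p u => phi p u - a2 p u *: Z1 p + a1 p u *: Z2 p) =
    (fun p u => phi p u + a1 p u *: Z2 p - a2 p u *: Z1 p).
  by apply/funext => p; apply/funext => u; rewrite addrAC.
exact: iJ.
Qed.

Section OddSubmanifold.
Context (R : realType) (m n : nat) (N : manifold R m) (M : manifold R n).
Variables (F : N -> M) (a1 a2 : field1 M) (Z1 Z2 : vfield M).
Variables (phi : field11 M) (g : field2 M) (A : field11 N).
Hypothesis H : induced_pair a1 a2 Z1 Z2 phi g.
Hypothesis dual : forall p,
  [/\ a1 p (Z1 p) = 1, a1 p (Z2 p) = 0, a2 p (Z1 p) = 0 & a2 p (Z2 p) = 1].
Hypothesis sN : submanifold F.
Hypothesis res : restricts11 F phi A.
Let t1 := tangential_part F g Z1.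
Let t2 := tangential_part F g Z2.
Hypothesis HN : induced_pair (pull1 F a1) (pull1 F a2) t1 t2 A (pull2 F g).

(** The tangential part of a unit vector has length one only if it is the whole
    vector. *)
Lemma tangent_reeb p : pull1 F a1 p (t1 p) = 1 -> tmap F p (t1 p) = Z1 (F p).
Proof.
move=> e; apply/eqP; rewrite -subr_eq0; apply/eqP/(ip_nondeg H (p := F p)).
have [d1 _ _ _] := dual (F p).
rewrite (scalarB (ip_Gr H (F p) _)) (ip_dual1 H) (scalarB (ip_lin1 H (F p))) d1.
rewrite -/(pull1 F a1 p (t1 p)) e subrr subr0 (ip_Gsym H).
rewrite (scalarB (ip_Gr H (F p) _)) (ip_dual1 H).
have := ip_dual1 HN p (t1 p); rewrite /pull2 => ->.
by rewrite -/(pull1 F a1 p (t1 p)) subrr.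
Qed.

Lemma orthogonal_reeb : orthogonal_to F g Z2 <-> forall p, t2 p = 0.
Proof.
split=> [orthZ p|z p u].
  apply: (ip_nondeg HN (p := p)); rewrite (ip_dual2 HN) /pull1 -(ip_dual2l H).
  exact: orthZ.
rewrite (ip_dual2l H) -/(pull1 F a2 p u) -(ip_dual2l HN) z.
exact: scalar0 (ip_Gl HN p u).
Qed.

Lemma tangent_reebE p : (exists u, tmap F p u = Z1 (F p)) -> pull1 F a1 p (t1 p) = 1.
Proof.
move=> [u e]; have [d1 _ _ _] := dual (F p).
have : t1 p = u.
  apply/eqP; rewrite -subr_eq0; apply/eqP/(ip_nondeg HN (p := p)).
  rewrite (scalarB (ip_Gr HN p _)) (ip_Gsym HN p _ u).
  rewrite (ip_dual1 HN) /pull2 e (ip_dual1l H) -/(pull1 F a1 p (t1 p - u)).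
  by rewrite subrr.
by move=> ->; rewrite /pull1 e.
Qed.

End OddSubmanifold.

(** * Invariant submanifolds of a metric contact pair *)

Lemma odd_submanifold (R : realType) m n (N : manifold R m) (M : manifold R n)
    (F : N -> M) (a1 a2 : field1 M) (Z1 Z2 : vfield M)
    (phi : field11 M) (g : field2 M) (A : field11 N) :
  induced_pair a1 a2 Z1 Z2 phi g ->
  (forall p, [/\ a1 p (Z1 p) = 1, a1 p (Z2 p) = 0, a2 p (Z1 p) = 0 & a2 p (Z2 p) = 1]) ->
  submanifold F -> restricts11 F phi A ->
  induced_pair (pull1 F a1) (pull1 F a2) (tangential_part F g Z1)
    (tangential_part F g Z2) A (pull2 F g) ->
  odd m -> (1 < m)%N -> connected [set: N] ->
  (exists p, tangential_part F g Z1 p != 0) ->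
  let zeta := normalized (pull2 F g) (tangential_part F g Z1) in
  let omega : field1 N := fun p u => pull2 F g p (zeta p) u in
  [/\ contact_form omega /\ reeb_field omega zeta,
      almost_contact_metric A zeta omega (pull2 F g),
      contact_metric A zeta omega (pull2 F g) <->
        (tangent_to F Z1 /\ orthogonal_to F g Z2) \/
        (tangent_to F Z2 /\ orthogonal_to F g Z1) &
      normal_contact_pair a1 a2 Z1 Z2 phi -> normal_almost_contact A zeta omega].
Proof.
move=> H dual sN res HN om m2 cN [p0 t10] zeta omega.
have H' := induced_pair_swap H; have HN' := induced_pair_swap HN.
split.
- split; first exact: (odd_contact_form HN om m2 cN t10).
  exact: (odd_reeb HN om m2 cN t10).
- exact: (odd_almost_contact HN om m2 cN t10).
- apply: (iff_trans (odd_contact_metric HN om m2 cN t10)); split.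
    move=> al; have E := odd_alpha1 HN om m2 cN t10 al; left; split.
      move=> p; exists (tangential_part F g Z1 p).
      by apply: (tangent_reeb H dual HN); have [] := E p.
    by apply/(orthogonal_reeb H HN) => p; have [] := E p.
  case=> [[tZ1 _]|[_ oZ1]].
    exact: (tangent_reebE H dual HN (tZ1 p0)).
  have := (orthogonal_reeb H' HN').1 oZ1 p0.
  by move/eqP; rewrite (negbTE t10).
- move=> nrm; apply: (odd_normal HN om m2 cN t10) => p u v.
  apply: (@induced_torsion _ _ _ _ _ _ _ _ _ _ _ _ _ p u v H sN res HN) => q w z.
  exact: (normal_torsion q w z H dual nrm).
Qed.

(** The tangential parts of the Reeb fields have length one, so they are the Reeb
    fields themselves. *)
Lemma even_submanifold (R : realType) m n (N : manifold R m) (M : manifold R n)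
    (F : N -> M) (a1 a2 : field1 M) (Z1 Z2 : vfield M)
    (phi : field11 M) (g : field2 M) (A : field11 N) :
  induced_pair a1 a2 Z1 Z2 phi g ->
  (forall p, [/\ a1 p (Z1 p) = 1, a1 p (Z2 p) = 0, a2 p (Z1 p) = 0 & a2 p (Z2 p) = 1]) ->
  submanifold F -> restricts11 F phi A ->
  let t1 := tangential_part F g Z1 in let t2 := tangential_part F g Z2 in
  induced_pair (pull1 F a1) (pull1 F a2) t1 t2 A (pull2 F g) ->
  ~~ odd m -> (1 < m)%N ->
  [/\ restricts_vfield F Z1 t1, restricts_vfield F Z2 t2,
      metric_f_structure A t1 t2 (pull1 F a1) (pull1 F a2) (pull2 F g) &
      normal_contact_pair a1 a2 Z1 Z2 phi ->
        normal_f_structure A t1 t2 (pull1 F a1) (pull1 F a2)].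
Proof.
move=> H dual sN res t1 t2 HN em m2.
have H' := induced_pair_swap H; have HN' := induced_pair_swap HN.
have dual' p : [/\ a2 p (Z2 p) = 1, a2 p (Z1 p) = 0, a1 p (Z2 p) = 0 & a1 p (Z1 p) = 1].
  by have [] := dual p.
have E p := ip_even p HN em m2.
split.
- by move=> p; apply: (tangent_reeb H dual HN); have [] := E p.
- by move=> p; apply: (tangent_reeb H' dual' HN'); have [] := E p.
- split.
  + exact: ip_tensor HN.
  + by split; [exact: ip_smooth1 HN|exact: ip_smooth2 HN].
  + by split; [exact: ip_form1 HN|exact: ip_form2 HN].
  + exact: ip_metric HN.
  + exact: ip_sqr HN.
  + by move=> p; split; [exact: ip_ker1 HN p|exact: ip_ker2 HN p].
  + by move=> p u; split; [exact: ip_im1 HN p u|exact: ip_im2 HN p u].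
  + by move=> p; have [e1 e2 e3] := E p; rewrite (ip_cross HN).
  + move=> p u v; rewrite (ip_skew HN) (ip_sqr HN) !(ip_GDl HN) (ip_GNl HN) !(ip_GZl HN).
    by rewrite (ip_dual1l HN) (ip_dual2l HN) !opprD opprK.
- move=> nrm U X Y oU sX sY p Up.
  rewrite (nijenhuisE (ip_tensor HN) oU sX sY Up).
  apply: (@induced_torsion _ _ _ _ _ _ _ _ _ _ _ _ _ p (X p) (Y p) H sN res HN).
  by move=> q w z; exact: (normal_torsion q w z H dual nrm).
Qed.

Theorem theorem19 (R : realType) (n m h k : nat)
    (M : manifold R n) (a1 a2 : field1 M) (Z1 Z2 : vfield M)
    (phi : field11 M) (g : field2 M)
    (N : manifold R m) (F : N -> M)
    (hM : metric_contact_pair h k a1 a2 Z1 Z2 phi g)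
    (hdec : decomposable a1 a2 phi)
    (hN : submanifold F) (hconn : connected [set: N])
    (hinv : invariant_under F phi) (hdim : (2 <= m)%N) :
  exists phiN : field11 N,
  [/\ restricts11 F phi phiN,
      (* even dimension *)
      ~~ odd m ->
        exists xi1 xi2 : vfield N,
        [/\ restricts_vfield F Z1 xi1, restricts_vfield F Z2 xi2,
            metric_f_structure phiN xi1 xi2 (pull1 F a1) (pull1 F a2) (pull2 F g) &
            normal_contact_pair a1 a2 Z1 Z2 phi ->
              normal_f_structure phiN xi1 xi2 (pull1 F a1) (pull1 F a2)] &
      (* odd dimension *)
      odd m ->
        (exists2 Z : vfield M, Z = Z1 \/ Z = Z2 &
           forall p, tangential_part F g Z p != 0) /\
        forall Z : vfield M, Z = Z1 \/ Z = Z2 ->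
          (exists p, tangential_part F g Z p != 0) ->
          let zeta := normalized (pull2 F g) (tangential_part F g Z) in
          let omega : field1 N := fun p u => pull2 F g p (zeta p) u in
          [/\ contact_form omega /\ reeb_field omega zeta,
              almost_contact_metric phiN zeta omega (pull2 F g),
              contact_metric phiN zeta omega (pull2 F g) <->
                (tangent_to F Z1 /\ orthogonal_to F g Z2) \/
                (tangent_to F Z2 /\ orthogonal_to F g Z1) &
              normal_contact_pair a1 a2 Z1 Z2 phi ->
                normal_almost_contact phiN zeta omega]].
Proof.
have H := metric_contact_pair_induced hM; have H' := induced_pair_swap H.
have dual : forall p, [/\ a1 p (Z1 p) = 1, a1 p (Z2 p) = 0, a2 p (Z1 p) = 0 &
    a2 p (Z2 p) = 1] by case: hM => [[_ []]].
have dual' p : [/\ a2 p (Z2 p) = 1, a2 p (Z1 p) = 0, a1 p (Z2 p) = 0 & a1 p (Z1 p) = 1].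
  by have [] := dual p.
have res := restricted_endoP hinv.
have HN := induced_pair_submanifold H hN hinv; have HN' := induced_pair_swap HN.
exists (restricted_endo F phi); split=> // [em|om].
  exists (tangential_part F g Z1), (tangential_part F g Z2).
  exact: even_submanifold H dual hN res HN em hdim.
split.
  have [[p0 t10]|none] := pselect (exists p, tangential_part F g Z1 p != 0).
    exists Z1; first by left.
    move=> p; rewrite -(ip_norm1 p HN) (ip_odd_const p0 p HN om hdim hconn).
    by rewrite (ip_norm1 p0 HN).
  exists Z2; first by right.
  move=> p; rewrite -(ip_norm1 p HN').
  have z1 : tangential_part F g Z1 p = 0.
    by apply: contrapT => /eqP ne; apply: none; exists p.
  have := ip_odd p HN om; rewrite z1 (scalar0 (ip_lin1 HN p)) add0r => ->.
  exact: oner_neq0.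
move=> Z [->|->] ex zeta omega.
  exact: (odd_submanifold H dual hN res HN om hdim hconn ex).
have [cr am [cm1 cm2] nm] := odd_submanifold H' dual' hN res HN' om hdim hconn ex.
split=> //.
  by split=> [/cm1 []|[]] => ?; [right|left|apply: cm2; right|apply: cm2; left].
by move=> /normal_contact_pair_swap; exact: nm.
Qed.
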